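(* Let $X$ be a complex 3-manifold endowed with a solution $(\omega,\Omega,E,A,\alpha')$ of the heterotic $\mathrm{SU}(3)$ system, with deformation operator $\bar D$ and formal $L^2$-adjoint $\bar D^*$. The symbol of $\bar D+\bar D^*:\Gamma(Q^{0,1})\to\Gamma(Q^{0,2}\oplus Q)$ is given, by its action on a section $s=(\kappa,\gamma,W)$ of $Q^{0,1}$, given a cotangent vector $\xi$, by the local formula $$\sigma_\xi(\bar D+\bar D^* )(s)=\sigma_\xi(\bar D+\bar D^* )\begin{bmatrix}\kappa\\ \gamma\\ W\end{bmatrix}=\begin{bmatrix}\big(\xi_{\bar k}\kappa_{j\bar l}+\alpha'R_{\bar kj}{}^m{}_n\xi_mW^n{}_{\bar l}\big)dz^j\otimes d\bar z^{\bar k\bar l}+\xi_{\bar k}\kappa_{j\bar k}\,dz^j\\[2pt] \xi_{\bar k}\gamma_{\bar l}\otimes d\bar z^{\bar k\bar l}+\xi_{\bar k}\gamma_{\bar k}\\[2pt] \xi_{\bar k}W^j{}_{\bar l}\frac{\partial}{\partial z^j}\otimes d\bar z^{\bar k\bar l}+\big(-\alpha'R_{\bar lj}{}^m{}_n\xi_m\kappa_{j\bar l}+\xi_{\bar k}W^n{}_{\bar k}\big)\frac{\partial}{\partial z^n}\end{bmatrix}.$$ Hence, if $R$ is bounded by $R_0$ and $\alpha'/R_0$ is sufficiently small, then $\ker\sigma_\xi(\bar D+\bar D^* )=0$ for $\xi\neq0$, and thus $\bar D+\bar D^*$ is overdetermined elliptic.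
   Context: Data. $X$ is a complex 3-manifold with local holomorphic coordinates $z^j$ (repeated indices are summed); $g$ is a Hermitian metric with form $\omega=ig_{j\bar k}dz^j\wedge d\bar z^k$; $\Omega$ is a nowhere vanishing $(3,0)$-form. $\nabla$ is the Chern connection of $g$ on $T^{1,0}X$, with curvature $R$ whose coefficients satisfy $[\nabla_j,\nabla_{\bar k}]V^l=-R_{\bar kj}{}^l{}_mV^m$. Writing $\nabla_jV^l=\partial_jV^l+\Gamma_j{}^l{}_mV^m$, the form $T=i\partial\omega$ has components $T_{jk\bar l}=T(\partial_{z^j},\partial_{z^k},\partial_{\bar z^l})$, and $T^l{}_{jk}=\Gamma_j{}^l{}_k-\Gamma_k{}^l{}_j=-g^{l\bar m}T_{jk\bar m}$. $E\to X$ is a holomorphic vector bundle with Hermitian metric $h$, with structure group such that endomorphisms of $E$ are trace-free ($\mathrm{End}(E)$ denotes these); $A$ is its Chern connection, with curvature $F=F_{j\bar k}dz^j\wedge d\bar z^k$. $\alpha'\in\mathbb{R}\setminus\{0\}$. Heterotic $\mathrm{SU}(3)$ system: $d\Omega=0$; $2i\partial\bar\partial\omega=\alpha'(\mathrm{tr}(F\wedge F)-\mathrm{tr}(R\wedge R))$; $F\wedge\omega\wedge\omega=0$; $d(|\Omega|_\omega\,\omega\wedge\omega)=0$. Operator. $Q=(T^{1,0}X)^*\oplus\mathrm{End}(E)\oplus T^{1,0}X$, $Q^{0,p}=Q\otimes\Lambda^p(T^{0,1}X)^*$. For $s=(\kappa,\gamma,W)\in\Gamma(Q^{0,p})$ (with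 $\kappa=\kappa_jdz^j$, $W=W^j\partial_{z^j}$, coefficients being $(0,p)$-forms) set $\mathscr{F}\gamma=dz^j\otimes d\bar z^k\wedge\mathrm{tr}(F_{j\bar k}\gamma)$, $\mathscr{F}W=d\bar z^k\wedge F_{j\bar k}W^j$, $\mathscr{T}W=dz^j\otimes d\bar z^k\wedge T_{lj\bar k}W^l$, $\mathcal{R}\nabla^+W=dz^j\otimes d\bar z^k\wedge R_{\bar kj}{}^l{}_m\nabla^+_lW^m$, where $\nabla^+_kW^j=\nabla_kW^j-T^j{}_{kl}W^l$ (acting as the Chern connection on $(0,p)$-form indices). Then $\bar D(\kappa,\gamma,W)=(\bar\partial\kappa+\alpha'\mathscr{F}\gamma+\mathscr{T}W+\alpha'\mathcal{R}\nabla^+W,\ \bar\partial_E\gamma+\mathscr{F}W,\ \bar\partial W)$. For $p=1$ the components are $\kappa=\kappa_{j\bar l}dz^j\otimes d\bar z^l$, $\gamma=\gamma_{\bar l}\otimes d\bar z^l$, $W=W^j{}_{\bar l}\partial_{z^j}\otimes d\bar z^l$, and $d\bar z^{\bar k\bar l}=d\bar z^k\wedge d\bar z^l$; in the symbol formula, repeated lower indices are summed (contraction with the metric). $\bar D^*:\Gamma(Q^{0,1})\to\Gamma(Q)$ is the formal $L^2$-adjoint of $\bar D:\Gamma(Q)\to\Gamma(Q^{0,1})$ with respect to the metrics on $Q$ and $Q^{0,1}$ induced by $g$ and $h$. Overdetermined elliptic means that the principal symbol is injective for every $\xi\neq0$. *)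

(* Defs.v *)
From HB Require Import structures.
From mathcomp Require Import all_boot all_order all_algebra all_fingroup.
From mathcomp Require Import complex.
From mathcomp Require Import all_classical all_reals all_analysis.

Set Implicit Arguments.
Unset Strict Implicit.
Unset Printing Implicit Defensive.

Import Order.TTheory GRing.Theory Num.Theory.
Import numFieldNormedType.Exports.

Local Open Scope classical_set_scope.
Local Open Scope complex_scope.
Local Open Scope ring_scope.

(** * Calculus on the model space

   C^3 is modelled by R^6 = 'rV[R]_(3 + 3) with real coordinates
   (x^1, x^2, x^3, y^1, y^2, y^3) and z^j = x^j + i y^j. *)

Notation model R := ('rV[R]_(3 + 3)) (only parsing).

Section Calculus.
Variable R : realType.
Local Notation C := R[i].
Local Notation V := (model R).

Definition zcoord (j : 'I_3) (p : V) : C :=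
  p ord0 (lshift 3 j) +i* p ord0 (rshift 3 j).

Definition dx (j : 'I_3) : V := delta_mx ord0 (lshift 3 j).
Definition dy (j : 'I_3) : V := delta_mx ord0 (rshift 3 j).

Definition iterD (vs : seq V) (f : V -> R) : V -> R :=
  foldr (fun v (g : V -> R) => fun p => 'D_v g p) f vs.

(* C^oo on an open set: all iterated directional derivatives exist and are
   continuous. *)
Definition smooth_on (U : set V) (f : V -> R) : Prop :=
  forall (vs : seq V) (p : V), U p ->
    {for p, continuous (iterD vs f)} /\
    (forall v : V, derivable (iterD vs f) p v).

Definition csmooth_on (U : set V) (f : V -> C) : Prop :=
  smooth_on U (fun p => complex.Re (f p)) /\
  smooth_on U (fun p => complex.Im (f p)).

Definition cderive (v : V) (f : V -> C) (p : V) : C :=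
  'D_v (fun q => complex.Re (f q)) p +i* 'D_v (fun q => complex.Im (f q)) p.

Definition dhol (j : 'I_3) (f : V -> C) (p : V) : C :=
  2%:R^-1 * (cderive (dx j) f p - 'i * cderive (dy j) f p).

Definition dbar (j : 'I_3) (f : V -> C) (p : V) : C :=
  2%:R^-1 * (cderive (dx j) f p + 'i * cderive (dy j) f p).

Definition holomorphic_on (U : set V) (f : V -> C) : Prop :=
  csmooth_on U f /\ (forall j p, U p -> dbar j f p = 0).

(* Integration against Lebesgue measure on R^n, as an iterated integral; it is
   only applied to smooth functions of compact support. *)
Fixpoint iterated_integral (n : nat) : ('rV[R]_n -> R) -> R :=
  match n return ('rV[R]_n -> R) -> R with
  | 0 => fun F => F 0
  | m.+1 => fun F => \int[lebesgue_measure]_x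
      iterated_integral (fun v : 'rV[R]_m => F (row_mx (x%:M : 'rV[R]_1) v))
  end.

(** * Differential forms in a chart

   A k-form is given by its values on k-tuples of coordinate fields; the index
   [inl j] stands for d/dz^j and [inr k] for d/d\bar z^k. *)

Definition cidx : Type := ('I_3 + 'I_3)%type.
Definition form (k : nat) : Type := {ffun 'I_k -> cidx} -> V -> C.

Definition fdrop (T : finType) (k : nat) (a : 'I_k.+1)
  (K : {ffun 'I_k.+1 -> T}) : {ffun 'I_k -> T} := [ffun b => K (lift a b)].

Definition partial (a : cidx) : (V -> C) -> V -> C :=
  match a with inl j => dhol j | inr k => dbar k end.

(* The part of the exterior derivative that differentiates along the
   coordinates selected by [A]. *)
Definition extd (A : pred cidx) (k : nat) (u : form k) : form k.+1 :=
  fun K p => \sum_(a < k.+1 | A (K a))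
    (-1) ^+ a * partial (K a) (u (fdrop a K)) p.

Definition d_ext (k : nat) : form k -> form k.+1 := @extd predT k.
Definition d_hol (k : nat) : form k -> form k.+1 :=
  @extd (fun a => if a is inl _ then true else false) k.
Definition d_bar (k : nat) : form k -> form k.+1 :=
  @extd (fun a => if a is inr _ then true else false) k.

Definition wedge (k l : nat) (u : form k) (v : form l) : form (k + l) :=
  fun K p => (k`! * l`!)%:R^-1 *
    \sum_(s : 'S_(k + l)) (-1) ^+ (odd_perm s) *
      (u [ffun a => K (s (lshift l a))] p * v [ffun b => K (s (rshift k b))] p).

Definition scale_form (c : V -> C) (k : nat) (u : form k) : form k :=
  fun K p => c p * u K p.

(* The (1,1)-form a_{j \bar k} dz^j /\ d\bar z^k. *)
Definition form11 (a : 'I_3 -> 'I_3 -> V -> C) : form 2 := fun K p =>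
  match K ord0, K ord_max with
  | inl j, inr k => a j k p
  | inr k, inl j => - a j k p
  | _, _ => 0
  end.

(* The (3,0)-form f dz^1 /\ dz^2 /\ dz^3. *)
Definition form30 (f : V -> C) : form 3 := fun K p =>
  f p * \det (\matrix_(a < 3, b < 3) (K a == inl b)%:R).

Definition idx3 (a b c : cidx) : {ffun 'I_3 -> cidx} :=
  [ffun i => tnth [tuple a; b; c] i].

(** * Hermitian geometry in a chart

   A Hermitian metric in a holomorphic frame is a function [G] with
   [G p a b] = g_{a \bar b}, that is |u|^2 = g_{a \bar b} u^a \bar{u^b}. *)

Definition hermitian_posdef (n : nat) (A : 'M[C]_n) : Prop :=
  (forall a b, A b a = (A a b)^*) /\
  (forall u : 'I_n -> C, (exists a, u a != 0) ->
     0 < \sum_a \sum_b A a b * u a * (u b)^*).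

(* g^{a \bar b}, normalised by g^{a \bar b} g_{c \bar b} = delta^a_c. *)
Definition upper (n : nat) (A : 'M[C]_n) (a b : 'I_n) : C := invmx A b a.

(* Chern connection: [chern G j p c a] = Gamma_j{}^c{}_a, the solution of
   d_j g_{a \bar b} = Gamma_j{}^c{}_a g_{c \bar b}. *)
Definition chern (n : nat) (G : V -> 'M[C]_n) (j : 'I_3) (p : V) : 'M[C]_n :=
  \matrix_(c, a) \sum_b dhol j (fun q => G q a b) p * upper (G p) c b.

(* F_{j \bar k}, the endomorphism [nabla_j, nabla_{\bar k}]. *)
Definition curvature (n : nat) (G : V -> 'M[C]_n) (j k : 'I_3) (p : V) :
  'M[C]_n := \matrix_(c, a) - dbar k (fun q => chern G j q c a) p.

(* tr (F /\ F) *)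
Definition tr_curv2 (n : nat) (G : V -> 'M[C]_n) : form 4 := fun K p =>
  \sum_a \sum_b
    wedge (form11 (fun j k q => curvature G j k q a b))
          (form11 (fun j k q => curvature G j k q b a)) K p.

Definition kahler_form (G : V -> 'M[C]_3) : form 2 :=
  form11 (fun j k q => 'i * G q j k).

(* R_{\bar k j}{}^l{}_m, where
   [nabla_j, nabla_{\bar k}] V^l = - R_{\bar k j}{}^l{}_m V^m. *)
Definition riem (G : V -> 'M[C]_3) (k j l m : 'I_3) (p : V) : C :=
  - curvature G j k p l m.

(* The same curvature components for the conjugate connection on T^{0,1}:
   R_{\bar k j}{}^{\bar l}{}_{\bar m}, where
   [nabla_j, nabla_{\bar k}] V^{\bar l}
     = - R_{\bar k j}{}^{\bar l}{}_{\bar m} V^{\bar m}.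
   Here nabla_j acts on V^{\bar l} as d_j and nabla_{\bar k} has the
   coefficients \bar{Gamma_k{}^l{}_m}.  Note that
   R_{\bar k j}{}^{\bar l}{}_{\bar m} = - \bar{R_{\bar j k}{}^l{}_m}. *)
Definition riem_conj (G : V -> 'M[C]_3) (k j l m : 'I_3) (p : V) : C :=
  - dhol j (fun q => (chern G k q l m)^*) p.

(* T_{jk \bar l} for T = i \partial omega. *)
Definition tors_form (G : V -> 'M[C]_3) (j k l : 'I_3) (p : V) : C :=
  'i * d_hol (kahler_form G) (idx3 (inl j) (inl k) (inr l)) p.

(* T^l{}_{jk} = - g^{l \bar m} T_{jk \bar m} *)
Definition tors (G : V -> 'M[C]_3) (l j k : 'I_3) (p : V) : C :=
  - \sum_m upper (G p) l m * tors_form G j k m p.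

(* Squared pointwise norm of R with respect to g. *)
Definition riem_norm2 (G : V -> 'M[C]_3) (p : V) : C :=
  \sum_k \sum_j \sum_l \sum_m \sum_k' \sum_j' \sum_l' \sum_m'
    upper (G p) k' k * upper (G p) j j' * G p l l' * upper (G p) m m' *
    riem G k j l m p * (riem G k' j' l' m' p)^*.

(** * The fibres of Q^{0,p} *)

(* Coefficients in d\bar z^K = d\bar z^{K 0} /\ ... /\ d\bar z^{K (p-1)}. *)
Local Notation midx p := {ffun 'I_p -> 'I_3}.

(* (kappa_{j \bar K}, gamma_{\bar K}, W^j{}_{\bar K}) *)
Definition Qfib (r p : nat) : Type :=
  ({ffun 'I_3 * midx p -> C} * {ffun midx p -> 'M[C]_r} *
   {ffun 'I_3 * midx p -> C})%type.

Definition kap (r p : nat) (s : Qfib r p) (j : 'I_3) (K : midx p) : C :=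
  s.1.1 (j, K).
Definition gam (r p : nat) (s : Qfib r p) (K : midx p) : 'M[C]_r := s.1.2 K.
Definition vec (r p : nat) (s : Qfib r p) (j : 'I_3) (K : midx p) : C :=
  s.2 (j, K).

Definition in_fibre (r p : nat) (s : Qfib r p) : Prop :=
  [/\ forall K, \tr (gam s K) = 0,
      forall j (K : midx p) (t : 'S_p), kap s j [ffun a => K (t a)] =
        (-1) ^+ (odd_perm t) * kap s j K,
      forall (K : midx p) (t : 'S_p), gam s [ffun a => K (t a)] =
        (-1) ^+ (odd_perm t) *: gam s K &
      forall j (K : midx p) (t : 'S_p), vec s j [ffun a => K (t a)] =
        (-1) ^+ (odd_perm t) * vec s j K].

(* Coefficients of d\bar z^k /\ X_k, for (0,p)-forms X_k. *)
Definition wedge1 (L : lmodType C) (p : nat) (X : 'I_3 -> midx p -> L)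
  (K : midx p.+1) : L :=
  \sum_(a < p.+1) (-1) ^+ a *: X (K a) (fdrop a K).

(* Pointwise Hermitian product on Q^{0,p} induced by g and h. *)
Definition Qinner (r p : nat) (g : 'M[C]_3) (h : 'M[C]_r)
  (u v : Qfib r p) : C :=
  (p`!)%:R^-1 * \sum_(K : midx p) \sum_(L : midx p)
    (\prod_(c < p) upper g (L c) (K c)) *
    ((\sum_j \sum_k upper g j k * kap u j K * (kap v k L)^*) +
     (\sum_a \sum_b \sum_c \sum_d h a c * upper h b d *
        gam u K a b * (gam v L c d)^*) +
     (\sum_j \sum_k g j k * vec u j K * (vec v k L)^*)).

(** * The operator \bar D in a chart *)

Section DbarOperator.
Variables (r : nat) (alpha : R) (G : V -> 'M[C]_3) (H : V -> 'M[C]_r).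

(* nabla^+_l W^m *)
Definition nabla_plus (p : nat) (s : V -> Qfib r p) (l m : 'I_3) (K : midx p)
  (x : V) : C :=
  dhol l (fun q => vec (s q) m K) x
  + \sum_n chern G l x m n * vec (s x) n K
  - \sum_n tors G m l n x * vec (s x) n K.

Definition Dbar_loc (p : nat) (s : V -> Qfib r p) (x : V) : Qfib r p.+1 :=
  ([ffun jK => wedge1 (fun k L =>
      dbar k (fun q => kap (s q) jK.1 L) x
      + alpha%:C * \tr (curvature H jK.1 k x *m gam (s x) L)
      + \sum_l tors_form G l jK.1 k x * vec (s x) l L
      + alpha%:C * \sum_l \sum_m riem G k jK.1 l m x * nabla_plus s l m L x)
      jK.2],
   [ffun K => wedge1 (fun k L =>
      (\matrix_(a, b) dbar k (fun q => gam (s q) L a b) x)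
      + \sum_j vec (s x) j L *: curvature H j k x) K],
   [ffun jK => wedge1 (fun k L => dbar k (fun q => vec (s q) jK.1 L) x) jK.2]).

End DbarOperator.
End Calculus.

(** * Complex 3-manifolds, bundles and sections *)

Record complex_threefold (R : realType) (X : topologicalType) := {
  chart_idx : Type;
  cdom : chart_idx -> set X;
  chart : chart_idx -> X -> model R;
  chart_inv : chart_idx -> model R -> X;
  cdom_open : forall i, open (cdom i);
  cdom_cover : \bigcup_i cdom i = setT;
  cimg_open : forall i, open (chart i @` cdom i);
  chartK : forall i x, cdom i x -> chart_inv i (chart i x) = x;
  chart_continuous : forall i, {within cdom i, continuous (chart i)};
  chart_inv_continuous : forall i,
    {within chart i @` cdom i, continuous (chart_inv i)};
  transition_holomorphic : forall i j a,
    holomorphic_on (chart i @` (cdom i `&` cdom j))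
      (fun p => zcoord a (chart j (chart_inv i p)));
  X_hausdorff : hausdorff_space X;
  X_second_countable : @second_countable X
}.

Section Geometry.
Variables (R : realType) (X : topologicalType).
Local Notation C := R[i].
Local Notation V := (model R).
Local Notation midx p := {ffun 'I_p -> 'I_3}.

Section Manifold.
Variable M : complex_threefold R X.

Definition cimg (i : chart_idx M) : set V := chart i @` cdom i.
Definition overlap (i j : chart_idx M) : set V :=
  chart i @` (cdom i `&` cdom j).
Definition transition (i j : chart_idx M) (p : V) : V :=
  chart j (chart_inv i p).

(* [jac i j p a b] = d z_j^a / d z_i^b at p *)
Definition jac (i j : chart_idx M) (p : V) : 'M[C]_3 :=
  \matrix_(a, b) dhol b (fun q => zcoord a (transition i j q)) p.

Definition smooth_fun (f : X -> R) : Prop :=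
  forall i : chart_idx M, smooth_on (cimg i) (fun p => f (chart_inv i p)).

End Manifold.

(* The data (g, Omega, E, h, alpha') on X.  The charts are taken small enough
   for E to be trivialised over each of them by a holomorphic frame; [trans i j]
   maps components in the frame over chart i to those over chart j. *)
Record het_data (r : nat) := {
  mfd :> complex_threefold R X;
  gmet : chart_idx mfd -> V -> 'M[C]_3;
  Omega : chart_idx mfd -> V -> C;
  trans : chart_idx mfd -> chart_idx mfd -> V -> 'M[C]_r;
  hmet : chart_idx mfd -> V -> 'M[C]_r;
  alphap : R
}.

Section Data.
Variables (r : nat) (D : het_data r).
Local Notation I := (chart_idx D).

Definition metric_axiom : Prop :=
  (forall (i : I) j k, csmooth_on (cimg i) (fun p => gmet i p j k)) /\
  (forall (i : I) p, cimg i p -> hermitian_posdef (gmet i p)) /\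
  (forall (i j : I) p, overlap i j p -> forall b b',
     gmet i p b b' = \sum_a \sum_a' gmet j (transition i j p) a a' *
       jac i j p a b * (jac i j p a' b')^*).

Definition Omega_axiom : Prop :=
  (forall i : I, csmooth_on (cimg i) (Omega i)) /\
  (forall (i : I) p, cimg i p -> Omega i p != 0) /\
  (forall (i j : I) p, overlap i j p ->
     Omega i p = Omega j (transition i j p) * \det (jac i j p)).

Definition bundle_axiom : Prop :=
  (forall (i j : I) a b, holomorphic_on (overlap i j)
     (fun p => trans i j p a b)) /\
  (forall (i : I) p, cimg i p -> trans i i p = 1%:M) /\
  (forall (i j k : I) x, cdom i x -> cdom j x -> cdom k x ->
     trans i k (chart i x) =
       trans j k (chart j x) *m trans i j (chart i x)).

(* The structure group enters through the last clause: the frames are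
   h-unimodular, so that the Chern connection and curvature of h are
   trace-free. *)
Definition bundle_metric_axiom : Prop :=
  [/\ forall (i : I) a b, csmooth_on (cimg i) (fun p => hmet i p a b),
      forall (i : I) p, cimg i p -> hermitian_posdef (hmet i p),
      forall (i j : I) p, overlap i j p ->
        hmet i p = (trans i j p)^T *m hmet j (transition i j p) *m
          map_mx (fun z : C => z^*) (trans i j p) &
      forall (i : I) p, cimg i p -> \det (hmet i p) = 1].

(* |Omega|_omega, for |Omega|^2_omega omega^3 / 3! = i Omega /\ \bar Omega up
   to a constant factor. *)
Definition Omega_norm (i : I) (p : V) : C :=
  `|Omega i p| / sqrtC (\det (gmet i p)).

Definition heterotic_system : Prop :=
  forall (i : I) (p : V), cimg i p ->
  let w := kahler_form (gmet i) in
  [/\ forall K, d_ext (form30 (Omega i)) K p = 0,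
      forall K, 2%:R * 'i * d_hol (d_bar w) K p =
        (alphap D)%:C * (tr_curv2 (hmet i) K p - tr_curv2 (gmet i) K p),
      forall a b K, wedge (form11 (fun j k q => curvature (hmet i) j k q a b))
        (wedge w w) K p = 0 &
      forall K, d_ext (scale_form (Omega_norm i) (wedge w w)) K p = 0].

Definition heterotic_solution : Prop :=
  alphap D != 0 /\ metric_axiom /\ Omega_axiom /\ bundle_axiom /\
  bundle_metric_axiom /\ heterotic_system.

(* Fields of fibre elements, given in each chart; the values of the i-th
   component outside [cimg i] are irrelevant. *)
Definition field (F : Type) : Type := I -> V -> F.

Definition conj_jac (p : nat) (J : 'M[C]_3) (K L : midx p) : C :=
  \prod_(c < p) (J (K c) (L c))^*.

(* Smooth sections of Q^{0,p}. *)
Definition is_section (p : nat) (s : field (Qfib R r p)) : Prop :=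
  [/\ forall i, (forall j K, csmooth_on (cimg i) (fun q => kap (s i q) j K)) /\
        (forall K a b, csmooth_on (cimg i) (fun q => gam (s i q) K a b)) /\
        (forall j K, csmooth_on (cimg i) (fun q => vec (s i q) j K)),
      forall i q, cimg i q -> in_fibre (s i q) &
      forall i j q, overlap i j q ->
        let J := jac i j q in
        let T := trans i j q in
        let s' := s j (transition i j q) in
        [/\ forall b L, kap (s i q) b L =
              \sum_a \sum_K J a b * conj_jac J K L * kap s' a K,
            forall L, T *m gam (s i q) L =
              (\sum_K conj_jac J K L *: gam s' K) *m T &
            forall a L, \sum_b J a b * vec (s i q) b L =
              \sum_K conj_jac J K L * vec s' a K]].

Definition Dbar (p : nat) (s : field (Qfib R r p)) : field (Qfib R r p.+1) :=
  fun i => Dbar_loc (alphap D) (gmet i) (hmet i) (s i).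

(* Sections supported in a compact subset of the domain of chart i. *)
Definition supported_in (p : nat) (i : I) (s : field (Qfib R r p)) : Prop :=
  exists K : set X, [/\ compact K, K `<=` cdom i &
    forall j q, cimg j q -> ~ K (chart_inv j q) -> s j q = 0].

(* L^2 product of u and v over the domain of chart i; the Riemannian volume is
   omega^3 / 3! = 8 det(g_{j \bar k}) dx^1 dy^1 dx^2 dy^2 dx^3 dy^3. *)
Definition L2_chart (p : nat) (i : I) (u v : field (Qfib R r p)) : C :=
  let F q := 8%:R * \det (gmet i q) *
             Qinner (gmet i q) (hmet i q) (u i q) (v i q) in
  iterated_integral (fun q : V => \1_(cimg i) q * complex.Re (F q)) +i*
  iterated_integral (fun q : V => \1_(cimg i) q * complex.Im (F q)).

(* By a partition of unity it is enough to test against sections supported in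
   a chart, for which the L^2 product over X is an integral in that chart. *)
Definition formal_adjoint (p : nat)
  (P : field (Qfib R r p) -> field (Qfib R r p.+1))
  (P' : field (Qfib R r p.+1) -> field (Qfib R r p)) : Prop :=
  forall t, is_section t -> is_section (P' t) /\
    (forall i s, is_section s -> supported_in i s ->
       L2_chart i (P s) t = L2_chart i s (P' t)).

(** * Principal symbols of first-order operators

   [xi] lists the components xi_j of the (1,0)-part of a real cotangent vector;
   the others are xi_{\bar j} = \bar{xi_j}.  The symbol is normalised so that
   d_j has symbol i xi_j: for a real function f with df = xi and a section s
   with value e at the point, sigma_xi(P)(e) = i [P, f] s. *)

Definition principal_symbol (p : nat) (W : lmodType C)
  (P : field (Qfib R r p) -> field W)
  (i : I) (x : V) (xi : 'rV[C]_3) (e : Qfib R r p) : W :=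
  xget 0 [set v | exists (f : X -> R) (s : field (Qfib R r p)),
    [/\ smooth_fun D f, is_section s,
        forall j, dhol j (fun q => (f (chart_inv i q))%:C) x = xi ord0 j,
        s i x = e &
        v = 'i *: (P (fun k q => (f (chart_inv k q))%:C *: s k q) i x -
                   (f (chart_inv i x))%:C *: P s i x)]].

(* The symbol has trivial kernel for every xi <> 0. *)
Definition symbol_ker0 (p : nat) (W : lmodType C)
  (P : field (Qfib R r p) -> field W) : Prop :=
  forall i x xi, cimg i x -> xi != 0 -> forall e, in_fibre e ->
    principal_symbol P i x xi e = 0 -> e = 0.

Definition overdetermined_elliptic (p : nat) (W : lmodType C)
  (P : field (Qfib R r p) -> field W) : Prop :=
  forall i x xi, cimg i x -> xi != 0 -> forall e e',
    in_fibre e -> in_fibre e' ->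
    principal_symbol P i x xi e = principal_symbol P i x xi e' -> e = e'.

(* \bar D + \bar D^* : Gamma(Q^{0,1}) -> Gamma(Q^{0,2} (+) Q) *)
Definition Dbar_plus (Dstar : field (Qfib R r 1) -> field (Qfib R r 0))
  (s : field (Qfib R r 1)) : field (Qfib R r 2 * Qfib R r 0)%type :=
  fun i x => (Dbar s i x, Dstar s i x).

(* The local formula.  Below th_j = i xi_j and thb_k = i xi_{\bar k}, the
   factor i coming from the normalisation of the symbol.  A pair of repeated
   lower indices is contracted with g, which pairs barred indices with unbarred
   ones; hence in the (0,0)-form part, the components of th, thb and R
   contracted with kappa, gamma, W are those of the conjugate types:
     xi_{\bar k} kappa_{j \bar k}  is  g^{q \bar k} \bar{thb_q} kappa_{j \bar k},
     R_{\bar l j}{}^m{}_n xi_m kappa_{j \bar l}  is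
       g^{a \bar j} g^{l \bar b} R_{\bar j l}{}^{\bar m}{}_{\bar n}
         \bar{th_m} kappa_{a \bar b},
   and the index \bar n of the latter is raised with g^{s \bar n}. *)
Definition symbol_formula (i : I) (x : V) (xi : 'rV[C]_3) (e : Qfib R r 1) :
  (Qfib R r 2 * Qfib R r 0)%type :=
  let g := gmet i x in
  let al : C := (alphap D)%:C in
  let th (j : 'I_3) : C := 'i * xi ord0 j in
  let thb (k : 'I_3) : C := 'i * (xi ord0 k)^* in
  let one (l : 'I_3) : midx 1 := [ffun=> l] in
  (([ffun jK => wedge1 (fun k (L : midx 1) =>
       thb k * kap e jK.1 L + al * \sum_m \sum_n
         riem (gmet i) k jK.1 m n x * th m * vec e n L) jK.2],
    [ffun K => wedge1 (fun k (L : midx 1) => thb k *: gam e L) K],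
    [ffun jK => wedge1 (fun k (L : midx 1) => thb k * vec e jK.1 L) jK.2]),
   ([ffun jK => \sum_q \sum_k
       upper g q k * (thb q)^* * kap e jK.1 (one k)],
    [ffun _ => \sum_q \sum_k (upper g q k * (thb q)^*) *: gam e (one k)],
    [ffun jK =>
       - al * (\sum_n \sum_a \sum_b \sum_j \sum_l \sum_m
           upper g jK.1 n * upper g a j * upper g l b *
           riem_conj (gmet i) j l m n x * (th m)^* * kap e a (one b))
       + \sum_q \sum_k upper g q k * (thb q)^* * vec e jK.1 (one k)])).

Definition curvature_bounded (R0 : R) : Prop :=
  forall (i : I) x, cimg i x -> riem_norm2 (gmet i) x <= (R0 ^+ 2)%:C.

End Data.
End Geometry.

(* Main.v *)
Require Import Defs.
From HB Require Import structures.
From mathcomp Require Import all_boot all_order all_algebra all_fingroup.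
From mathcomp Require Import complex ring lra.
From mathcomp Require Import all_classical all_reals all_analysis.

Set Implicit Arguments.
Unset Strict Implicit.
Unset Printing Implicit Defensive.

Import Order.TTheory GRing.Theory Num.Theory.
Import numFieldNormedType.Exports.
Local Open Scope classical_set_scope.
Local Open Scope complex_scope.
Local Open Scope ring_scope.
(** Write D for the deformation operator, sigma for its symbol in degree 0 or 1
    and sigma^* for the pointwise adjoint of the symbol in degree 0.

    The symbol of D.  The operator D is of order one, so the Leibniz rule gives
    D (f s) - f D s = sigma(df) s; the curvature enters because R nabla^+
    differentiates W ([Dbar_loc_leibniz]).

    The symbol of D^*.  The adjoint is known only through the pairing with
    sections supported in a chart.  If u is such a section of Q, adjointness for
    the two pairs (u, f s) and (f u, s) gives
      < u, D^* (f s) - f D^* s + sigma(df)^* s > = 0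
    in L^2.  The second entry is continuous, so if it were nonzero at a point
    then for u a cut-off of its value there, concentrated near that point, the
    integrand would be nonnegative and somewhere positive.  Hence
    D^* (f s) - f D^* s = - sigma(df)^* s ([Dstar_defect]).  Multiplying by i
    gives sigma(i df)^*, since sigma^* is conjugate linear in df.  In
    components this is the stated formula: the contraction with R is conjugated
    and its first two indices change roles ([symbol_Dbar_adjoint],
    [riem_conjE]).

    The principal symbol is defined through functions f and sections s with
    prescribed df and s at the point, so one such pair must be exhibited:
    a cut-off times an affine function and a cut-off of a constant section, both
    extended by zero over X ([symbol_attained]).  The extension is smooth because
    compact sets of X are closed, and because smooth functions compose with the
    transition maps; the latter rests on the chain rule for functions with
    continuous directional derivatives.

    Injectivity.  Let xi <> 0, sigma_1 e = 0 and sigma_0^* e = 0 for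
    e = (kappa, gamma, W).  The last two components of sigma_1 e = 0 say that the
    wedge products of xi-bar with gamma and W vanish, so
    gamma = xi-bar (x) c and W = xi-bar (x) w.  With this W the curvature term of
    the first component is a wedge product with xi-bar as well, and
    kappa = xi-bar (x) u + alpha' R(xi, w).  So e = sigma_0 (u, c, w): the symbol
    sequence is exact at Q^{0,1} ([symbol_Dbar_exact]).  Then
    < e, e > = < (u, c, w), sigma_0^* e > = 0, and e = 0 because the product on
    Q^{0,1} is positive definite ([Qinner1_eq0]).  *)

(** * Finite and infinite differentiability along directions *)

Section Ck.
Variables (R : realType) (W : normedModType R).
Implicit Types (U : set W) (f g : W -> R) (k : nat).

(** Differentiation in all directions, rather than in coordinate directions, lets
    the induction on k run in any normed module. *)
Fixpoint Ck k U f : Prop :=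
  (forall p, U p -> {for p, continuous f}) /\
  (if k is k'.+1 then
     (forall p, U p -> forall v, derivable f p v) /\ forall v, Ck k' U ('D_v f)
   else True).

Lemma Ck_cont k U f p : Ck k U f -> U p -> {for p, continuous f}.
Proof. by case: k => [|k] [] H _; exact: H. Qed.

Lemma Ck_derivable k U f p v : Ck k.+1 U f -> U p -> derivable f p v.
Proof. by move=> [_ [H _]] Up; exact: H. Qed.

Lemma Ck_derive k U f v : Ck k.+1 U f -> Ck k U ('D_v f).
Proof. by move=> [_ [_ H]]; exact: H. Qed.

Lemma CkW k U f : Ck k.+1 U f -> Ck k U f.
Proof.
elim: k f => [|k IH] f [H1 [H2 H3]]; first by split.
split=> //; split=> // v; exact/IH.
Qed.

Lemma open_near_eq U f g p : open U -> (forall q, U q -> f q = g q) -> U p ->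
  \near p, f p = g p.
Proof. by move=> oU E Up; near=> q; apply: E; near: q; exact: open_nbhs_nbhs. Unshelve. all: by end_near. Qed.

Lemma Ck_eq k U f g : open U -> (forall q, U q -> f q = g q) ->
  Ck k U f -> Ck k U g.
Proof.
move=> oU; elim: k f g => [|k IH] f g E.
  move=> [H _]; split=> // p Up; rewrite /prop_for /continuous_at -(E _ Up).
  apply: cvg_trans (H _ Up).
  by apply: near_eq_cvg; exact: (open_near_eq oU E Up).
move=> [H1 [H2 H3]]; split.
  move=> p Up; rewrite /prop_for /continuous_at -(E _ Up).
  by apply: cvg_trans (H1 _ Up); apply: near_eq_cvg; exact: (open_near_eq oU E Up).
split=> [p Up v|v].
  by apply: near_eq_derivable (H2 _ Up v); exact: (open_near_eq oU E Up).
apply: IH (H3 v) => q Uq; apply: near_eq_derive; exact: (open_near_eq oU E Uq).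
Qed.

Lemma Ck_local k U f :
  (forall p, U p -> exists U', [/\ open U', U' p & Ck k U' f]) -> Ck k U f.
Proof.
elim: k f => [|k IH] f H.
  by split=> // p /H[U' [_ U'p C]]; exact: Ck_cont C U'p.
split; first by move=> p /H[U' [_ U'p C]]; exact: Ck_cont C U'p.
split=> [p /H[U' [_ U'p C]] v|v]; first exact: Ck_derivable C U'p.
by apply: IH => p /H[U' [oU' U'p C]]; exists U'; split => //; exact: Ck_derive.
Qed.

Lemma Ck_cst k U (c : R) : Ck k U (fun=> c).
Proof.
elim: k c => [|k IH] c; first by split => // p _; exact: cvg_cst.
split; first by move=> p _; exact: cvg_cst.
split=> [p _ v|v]; first exact: derivable_cst.
have -> : 'D_v (fun=> c) = (fun=> 0) :> (W -> R); last exact: IH.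
by apply/funext => p; rewrite derive_cst.
Qed.

Lemma CkD k U f g : open U -> Ck k U f -> Ck k U g -> Ck k U (fun p => f p + g p).
Proof.
move=> oU; elim: k f g => [|k IH] f g Hf Hg.
  by split=> // p Up; apply: cvgD; [exact: Ck_cont Hf Up|exact: Ck_cont Hg Up].
split.
  by move=> p Up; apply: cvgD; [exact: Ck_cont Hf Up|exact: Ck_cont Hg Up].
split=> [p Up v|v].
  by apply: derivableD; [exact: Ck_derivable Hf Up|exact: Ck_derivable Hg Up].
apply: (@Ck_eq _ _ (fun p => 'D_v f p + 'D_v g p)) => //.
  by move=> q Uq; rewrite deriveD//; [exact: Ck_derivable Hf Uq|exact: Ck_derivable Hg Uq].
by apply: IH; exact: Ck_derive.
Qed.

Lemma CkM k U f g : open U -> Ck k U f -> Ck k U g -> Ck k U (fun p => f p * g p).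
Proof.
move=> oU; elim: k f g => [|k IH] f g Hf Hg.
  by split=> // p Up; apply: cvgM; [exact: Ck_cont Hf Up|exact: Ck_cont Hg Up].
split.
  by move=> p Up; apply: cvgM; [exact: Ck_cont Hf Up|exact: Ck_cont Hg Up].
split=> [p Up v|v].
  by apply: derivableM; [exact: Ck_derivable Hf Up|exact: Ck_derivable Hg Up].
apply: (@Ck_eq _ _ (fun p => f p * 'D_v g p + g p * 'D_v f p)) => //.
  by move=> q Uq; rewrite deriveM//; [exact: Ck_derivable Hf Uq|exact: Ck_derivable Hg Uq].
by apply: CkD => //; apply: IH; [exact: CkW| exact: Ck_derive|exact: CkW| exact: Ck_derive].
Qed.

Lemma CkN k U f : open U -> Ck k U f -> Ck k U (fun p => - f p).
Proof.
move=> oU H; apply: (@Ck_eq _ _ (fun p => (-1) * f p)) => //.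
  by move=> q _; rewrite mulN1r.
by apply: CkM => //; exact: Ck_cst.
Qed.

Lemma CkV k U f : open U -> (forall p, U p -> f p != 0) -> Ck k U f ->
  Ck k U (fun p => (f p)^-1).
Proof.
move=> oU f0; elim: k => [|k IH] H.
  by split=> // p Up; apply: cvgV; [exact: f0|exact: Ck_cont H Up].
split; first by move=> p Up; apply: cvgV; [exact: f0|exact: Ck_cont H Up].
split=> [p Up v|v].
  by apply: derivableV; [exact: f0|exact: Ck_derivable H Up].
apply: (@Ck_eq _ _ (fun p => - ((f p)^-1 * (f p)^-1) * 'D_v f p)) => //.
  move=> q Uq; rewrite deriveV//; [|exact: f0|exact: Ck_derivable H Uq].
  by rewrite -exprVn expr2.
apply: CkM => //; last exact: Ck_derive.
by apply: CkN => //; apply: CkM => //; apply: IH; exact: CkW.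
Qed.

End Ck.

(** * The chain rule for continuously differentiable functions *)

Section Segment.
Variables (R : realType) (W : normedModType R).
Implicit Types (U : set W) (f : W -> R).

Lemma is_derive_line f p h (t : R) : derivable f (t *: h + p) h ->
  is_derive t 1 (fun s : R => f (s *: h + p)) ('D_h f (t *: h + p)).
Proof.
move=> df.
have E : (fun s => s^-1 *: (((fun s : R => f (s *: h + p)) \o shift t) (s *: 1) - f (t *: h + p)))
  = (fun s => s^-1 *: ((f \o shift (t *: h + p)) (s *: h) - f (t *: h + p))).
  apply/funext => s /=; congr (_ *: (f _ - _)).
  by rewrite scalerDl addrA [s *: 1]mulr1.
by split; rewrite /derivable /derive E.
Qed.

(** One-dimensional mean value theorem on the segment from p to h + p; all the
    later estimates of increments come from it. *)
Lemma mvt_line k U f p h : Ck k.+1 U f ->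
  (forall t, 0 <= t <= 1 -> U (t *: h + p)) ->
  exists2 t : R, 0 <= t <= 1 & f (h + p) - f p = 'D_h f (t *: h + p).
Proof.
move=> Cf HU.
have [//|||t] := @MVT_segment R (fun s : R => f (s *: h + p))
   (fun s => 'D_h f (s *: h + p)) 0 1.
- move=> x; rewrite in_itv /= => /andP[x0 x1]; apply: is_derive_line.
  by apply: Ck_derivable Cf _; apply: HU; rewrite !ltW.
- apply: continuous_in_subspaceT => x; rewrite inE /= in_itv /= => x01.
  apply: (@continuous_comp _ _ _ (fun s : R => s *: h + p) f); last first.
    exact: Ck_cont Cf (HU _ _).
  by apply: cvgD; [exact: scalel_continuous|exact: cvg_cst].
rewrite in_itv /= => t01 E; exists t => //.
by move: E; rewrite scale1r scale0r add0r subr0 mulr1.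
Qed.

(** The substitution h -> c h in the difference quotient. *)
Lemma derive_scale f p (c : R) v : derivable f p v -> 'D_(c *: v) f p = c * 'D_v f p.
Proof.
have [->|c0] := eqVneq c 0; first by rewrite scale0r derive0 mul0r.
move=> df; have H : (fun h => c * (h^-1 *: ((f \o shift p) (h *: v) - f p))) h @[h --> 0^'] --> c * 'D_v f p.
  by apply: cvgM; [exact: cvg_cst|exact: df].
apply: cvg_lim => //.
have -> : (fun h => h^-1 *: ((f \o shift p) (h *: (c *: v)) - f p)) =
  (fun h => c * (h^-1 *: ((f \o shift p) (h *: v) - f p))) \o (fun h => c * h).
  apply/funext => h /=.
  rewrite scalerA [h * c]mulrC [RHS]mulrA; congr (_ * _).
  by rewrite invfM mulrA divff// mul1r.
apply: cvg_comp H.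
move=> A; rewrite /= !nbhs_simpl.
move=> /nbhs_ballP[/= e e0 H]; apply/nbhs_ballP.
exists (e / `|c|) => /=; first by rewrite divr_gt0// normr_gt0.
move=> y; rewrite /ball /= sub0r normrN => ye y0.
apply: H; last by rewrite mulf_neq0.
by rewrite /ball /= sub0r normrN normrM mulrC -ltr_pdivlMr// normr_gt0.
Qed.

End Segment.

Lemma continuous_rV (R : realType) (T : topologicalType) n (phi : T -> 'rV[R]_n) p :
  (forall a, {for p, continuous (fun q => phi q ord0 a)}) -> {for p, continuous phi}.
Proof.
move=> H; apply/cvgrPdist_lt => d d0.
near=> q; rewrite /Num.norm /= mx_normrE.
apply/bigmax_ltP; split => // -[i j] _ /=; rewrite !mxE (ord1 i).
move: j; near: q; apply: filter_forall => j.
by have /cvgrPdist_lt := H j; apply.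
Unshelve. all: by end_near. Qed.

Section Chain.
Variables (R : realType) (n : nat).
Local Notation V := 'rV[R]_n.
Implicit Types (U : set V) (f : V -> R).

(** Directional derivatives of a C^1 function are additive in the direction: the
    increment along u + v is the increment along v followed by one along u, whose
    mean value point tends to p, where 'D_u f is continuous. *)
Lemma deriveDdir (k : nat) U f p u v : open U -> Ck k.+1 U f -> U p ->
  'D_(u + v) f p = 'D_u f p + 'D_v f p.
Proof.
move=> oU Cf Up.
have [e e0 He] : exists2 e : R, 0 < e & ball p e `<=` U.
  by apply/nbhs_ballP; exact: open_nbhs_nbhs.
have M0 : 0 < `|u| + `|v| + 1 by rewrite ltr_wpDl// addr_ge0.
(* the mean value point of the increment along s u, chosen for each s *)
pose y (s : R) := xget p [set y : V | `|y - p| <= `|s| * (`|u| + `|v|) /\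
   s^-1 *: (f (s *: (u + v) + p) - f (s *: v + p)) = 'D_u f y].
have nearH : \forall s \near 0^', `|y s - p| <= `|s| * (`|u| + `|v|) /\
   s^-1 *: (f (s *: (u + v) + p) - f (s *: v + p)) = 'D_u f (y s).
  near=> s.
  have s0 : s != 0 by near: s; exact: nbhs_dnbhs_neq.
  have se : `|s| * (`|u| + `|v| + 1) < e.
    rewrite -ltr_pdivlMr//; near: s; apply: dnbhs0_lt; exact: divr_gt0.
  have B t : 0 <= t <= 1 -> `|t *: (s *: u) + (s *: v + p) - p| <= `|s| * (`|u| + `|v|).
    move=> /andP[t0 t1]; rewrite addrA addrK (le_trans (ler_normD _ _))// !normrZ.
    by rewrite mulrDr lerD// ler_piMl// ?mulr_ge0// ger0_norm.
  suff: exists y, `|y - p| <= `|s| * (`|u| + `|v|) /\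
   s^-1 *: (f (s *: (u + v) + p) - f (s *: v + p)) = 'D_u f y.
    by case=> z Hz; rewrite /y; exact: (@xgetPex _ p [set y : V | _ /\ _] (ex_intro _ z Hz)).
  have HU t : 0 <= t <= 1 -> U (t *: (s *: u) + (s *: v + p)).
    move=> t01; apply: He; rewrite -ball_normE /= distrC.
    apply: le_lt_trans (B _ t01) _; apply: le_lt_trans se.
    by rewrite ler_wpM2l// lerDl.
  have [t t01 E] := mvt_line Cf HU.
  exists (t *: (s *: u) + (s *: v + p)); split; first exact: B.
  rewrite (scalerDr s u v) -addrA E derive_scale; last exact: Ck_derivable Cf (HU _ t01).
  by rewrite [s^-1 *: _]mulrA mulVf// mul1r.
have cy : y s @[s --> 0^'] --> p.
  apply/cvgrPdist_lt => d d0; near=> s.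
  have [H _] : `|y s - p| <= `|s| * (`|u| + `|v|) /\
   s^-1 *: (f (s *: (u + v) + p) - f (s *: v + p)) = 'D_u f (y s) by near: s.
  rewrite distrC; apply: le_lt_trans H _.
  apply: (@le_lt_trans _ _ (`|s| * (`|u| + `|v| + 1))).
    by rewrite ler_wpM2l// lerDl.
  rewrite -ltr_pdivlMr//; near: s; apply: dnbhs0_lt; exact: divr_gt0.
apply: cvg_lim => //.
have -> : (fun h => h^-1 *: ((f \o shift p) (h *: (u + v)) - f p)) =
  (fun h => h^-1 *: (f (h *: (u + v) + p) - f (h *: v + p)) +
            h^-1 *: ((f \o shift p) (h *: v) - f p)).
  by apply/funext => h /=; rewrite -scalerDr addrA subrK.
have Dv : h^-1 *: ((f \o shift p) (h *: v) - f p) @[h --> 0^'] --> 'D_v f p.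
  exact: (Ck_derivable Cf Up).
apply: cvgD Dv.
apply: (@cvg_trans _ (('D_u f \o y) s @[s --> 0^'])).
  by apply: near_eq_cvg; apply: filterS nearH => s [_ /= ->].
exact: (cvg_comp _ _ cy (Ck_cont (Ck_derive u Cf) Up)).
Unshelve. all: by end_near. Qed.

Lemma derive_lin (k : nat) U f p h : open U -> Ck k.+1 U f -> U p ->
  'D_h f p = \sum_(a < n) h ord0 a * 'D_(delta_mx ord0 a) f p.
Proof.
move=> oU Cf Up; rewrite {1}[h]row_sum_delta.
elim: (index_enum _) => [|a r IH]; first by rewrite !big_nil derive0.
rewrite !big_cons (deriveDdir _ _ oU Cf Up) IH derive_scale//.
exact: Ck_derivable Cf Up.
Qed.

Variable W : normedModType R.

(** The increment of f between phi p and phi (s v + p) is a derivative of f at an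
    intermediate point, in the direction of the increment of phi.  Expanding it in
    coordinates and dividing by s gives the chain rule. *)
Lemma is_derive_chain (k : nat) U f (phi : W -> V) p v :
  open U -> Ck k.+1 U f -> U (phi p) ->
  (forall a, derivable (fun q => phi q ord0 a) p v) ->
  is_derive p v (fun q => f (phi q))
    (\sum_(a < n) 'D_v (fun q => phi q ord0 a) p * 'D_(delta_mx ord0 a) f (phi p)).
Proof.
move=> oU Cf Up dphi.
have [e e0 He] : exists2 e : R, 0 < e & ball (phi p) e `<=` U.
  by apply/nbhs_ballP; exact: open_nbhs_nbhs.
have Dphi : derivable phi p v by apply/derivable_mxP => i j; rewrite ord1.
pose h (s : R) : V := phi (s *: v + p) - phi p.
have ch : h s @[s --> 0^'] --> (0 : V).
  apply: (@cvg_trans _ ((fun s => s *: (s^-1 *: h s)) s @[s --> 0^'])).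
    apply: near_eq_cvg; near=> s.
    rewrite scalerA divff ?scale1r//; near: s; exact: nbhs_dnbhs_neq.
  rewrite -(scale0r ('D_v phi p)).
  apply: cvgZ; last exact: Dphi.
  exact: nbhs_dnbhs.
(* the intermediate point, chosen for each s *)
pose y (s : R) : V := xget (phi p) [set y : V | `|y - phi p| <= `|h s| /\
   f (phi (s *: v + p)) - f (phi p) = 'D_(h s) f y /\ U y].
have nearH : \forall s \near 0^', `|y s - phi p| <= `|h s| /\
   f (phi (s *: v + p)) - f (phi p) = 'D_(h s) f (y s) /\ U (y s).
  have ne : \forall s \near 0^', `|h s| < e by move/cvgr0Pnorm_lt : ch; apply.
  apply: filterS ne => s hs.
  have B t : 0 <= t <= 1 -> `|t *: h s + phi p - phi p| <= `|h s|.
    by move=> /andP[t0 t1]; rewrite addrK normrZ ger0_norm// ler_piMl.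
  suff: exists y : V, `|y - phi p| <= `|h s| /\
   f (phi (s *: v + p)) - f (phi p) = 'D_(h s) f y /\ U y.
    by case=> z Hz; rewrite /y; exact: (@xgetPex _ (phi p) [set y : V | _ /\ _] (ex_intro _ z Hz)).
  have HU t : 0 <= t <= 1 -> U (t *: h s + phi p).
    move=> t01; apply: He; rewrite -ball_normE /= distrC.
    exact: le_lt_trans (B _ t01) _.
  have [t t01 E] := mvt_line Cf HU.
  exists (t *: h s + phi p); split; first exact: B.
  by split; [rewrite -E /h subrK|exact: HU].
have cy : y s @[s --> 0^'] --> phi p.
  apply/cvgrPdist_lt => d d0.
  have ne : \forall s \near 0^', `|h s| < d by move/cvgr0Pnorm_lt : ch; apply.
  by apply: filterS2 nearH ne => s [H _] hd; rewrite distrC; exact: le_lt_trans H hd.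
suff H : s^-1 *: (((fun q => f (phi q)) \o shift p) (s *: v) - f (phi p)) @[s --> 0^'] -->
    \sum_(a < n) 'D_v (fun q => phi q ord0 a) p * 'D_(delta_mx ord0 a) f (phi p).
  split; last exact: cvg_lim H.
  by apply/cvg_ex; eexists; exact: H.
apply: (@cvg_trans _ ((\sum_(a < n) (s^-1 *: (phi (s *: v + p) ord0 a - phi p ord0 a)) *
   'D_(delta_mx ord0 a) f (y s)) @[s --> 0^'])).
  apply: near_eq_cvg; apply: filterS nearH => s [_ [/= -> Uy]].
  rewrite (derive_lin (h s) oU Cf Uy) scaler_sumr; apply: eq_bigr => a _.
  by rewrite -scalerAl !mxE.
apply: cvg_big => [|a _]; first exact: add_continuous.
apply: cvgM; first exact: (dphi a).
exact: (cvg_comp _ _ cy (Ck_cont (Ck_derive (delta_mx ord0 a) Cf) Up)).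
Unshelve. all: by end_near. Qed.

Lemma Ck_comp k U (U' : set W) f (phi : W -> V) : open U -> open U' ->
  (forall p, U' p -> U (phi p)) -> Ck k U f ->
  (forall a, Ck k U' (fun q => phi q ord0 a)) -> Ck k U' (fun q => f (phi q)).
Proof.
move=> oU oU' HU.
have C0 k' g : Ck k' U g -> (forall a, Ck k' U' (fun q => phi q ord0 a)) ->
    forall p, U' p -> {for p, continuous (fun q => g (phi q))}.
  move=> Cg Cp p Up.
  apply: (@continuous_comp _ _ _ phi g); last exact: Ck_cont Cg (HU _ Up).
  by apply: continuous_rV => a; exact: Ck_cont (Cp a) Up.
elim: k f => [|k IH] f Cf Cphi; first by split => //; exact: C0 Cf Cphi.
have dphi p a v : U' p -> derivable (fun q => phi q ord0 a) p v.
  by move=> Up; exact: Ck_derivable (Cphi a) Up.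
split; first exact: C0 Cf Cphi.
split=> [p Up v|v].
  have [] // := is_derive_chain oU Cf (HU _ Up) (fun a => dphi p a v Up).
apply: (@Ck_eq _ _ _ _ (fun p => \sum_(a < n) 'D_v (fun q => phi q ord0 a) p *
   'D_(delta_mx ord0 a) f (phi p))) => //.
  move=> q Uq.
  by have [_ ->] := is_derive_chain oU Cf (HU _ Uq) (fun a => dphi q a v Uq).
elim: (index_enum _) => [|a r IHr].
  apply: (@Ck_eq _ _ _ _ (fun=> 0)) => //; last exact: Ck_cst.
  by move=> q _; rewrite big_nil.
under eq_fun do rewrite big_cons.
apply: CkD => //; apply: CkM => //; first exact: Ck_derive.
by apply: (IH _ (Ck_derive (delta_mx ord0 a) Cf)) => b; exact: CkW.
Qed.

End Chain.

(** * A flat function on the line *)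

Section SmoothBump.
Variable R : realType.

(** exp(-1/t) for t > 0, extended by 0, divided by t^n: the family is stable under
    differentiation, which is what makes flat 0 smooth. *)
Definition flat (n : nat) (t : R) : R := if 0 < t then t^-1 ^+ n * expR (- t^-1) else 0.

Lemma flat_ge0 n t : 0 <= flat n t.
Proof.
rewrite /flat; case: ifP => // t0.
by rewrite mulr_ge0 ?exprn_ge0 ?invr_ge0 ?expR_ge0// ltW.
Qed.

(** exp x >= (x / (n+1))^(n+1) at x = 1/t. *)
Lemma flat_le n t : 0 < t -> flat n t <= n.+1%:R ^+ n.+1 * t.
Proof.
move=> t0; rewrite /flat t0 expRN.
have t'0 : 0 < t^-1 by rewrite invr_gt0.
have n0 : 0 < n.+1%:R :> R by rewrite ltr0n.
have H : (t^-1 / n.+1%:R) ^+ n.+1 <= expR t^-1.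
  have {2}-> : t^-1 = n.+1%:R * (t^-1 / n.+1%:R) by rewrite mulrCA divff ?mulr1// gt_eqF.
  rewrite expRM_natl; apply: lerXn2r; rewrite ?nnegrE ?expR_ge0 ?divr_ge0 ?(ltW t'0) ?(ltW n0)//.
    by apply: (@le_trans _ _ (1 + t^-1 / n.+1%:R)); [rewrite lerDr|exact: expR_ge1Dx].
rewrite ler_pdivrMr ?expR_gt0//.
apply: le_trans; last by apply: (ler_wpM2l _ H); rewrite mulr_ge0 ?exprn_ge0 ?ltW.
rewrite expr_div_n (exprS t^-1).
set A := n.+1%:R ^+ n.+1; set B := t^-1 ^+ n.
have A0 : A != 0 by rewrite expf_neq0 ?gt_eqF.
have tn0 : t != 0 by rewrite gt_eqF.
by rewrite le_eqVlt; apply/orP; left; apply/eqP; field; rewrite A0.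
Qed.

Lemma is_derive_flat n (t : R) : is_derive t 1 (flat n) (flat n.+2 t - n%:R * flat n.+1 t).
Proof.
have [t0|t0|t0] := ltgtP t 0.
- have -> : flat n.+2 t - n%:R * flat n.+1 t = 0.
    by rewrite /flat !ltNge !(ltW t0) /= mulr0 subrr.
  have Cst : is_derive t 1 (cst (0 : R) : R -> R) 0 by exact: is_derive_cst.
  apply: near_eq_is_derive Cst.
  near=> s; rewrite /flat ifF//; apply/negbTE; rewrite -leNgt ltW//.
  by near: s; exact: lt_nbhsl.
- suff D : is_derive t 1 (fun s => s^-1 ^+ n * expR (- s^-1)) (flat n.+2 t - n%:R * flat n.+1 t).
    apply: near_eq_is_derive D.
    near=> s; rewrite /flat ifT//; near: s; exact: lt_nbhsr.
  have tn0 : t != 0 by rewrite gt_eqF.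
  have D1 : is_derive t 1 (fun s : R => s^-1) (- t^-1 ^+ 2).
    apply: is_derive_eq; first by apply: is_deriveV.
    by rewrite -exprVn [_ *: _]mulr1.
  have D2 : is_derive t 1 (fun s => expR (- s^-1)) (expR (- t^-1) * t^-1 ^+ 2).
    have := is_deriveN D1; rewrite opprK => N1.
    have N2 : is_derive t 1 (fun s : R => - s^-1) (t^-1 ^+ 2) by exact: N1.
    exact: (@is_derive1_comp _ expR (fun s : R => - s^-1) t _ _ (is_derive_expR (- t^-1)) N2).
  have D3 : is_derive t 1 (fun s => s^-1 ^+ n) (n%:R * t^-1 ^+ n.-1 * - t^-1 ^+ 2).
    have X1 := @is_deriveX _ _ (fun s : R => s^-1) n t 1 _ D1.
    by rewrite exprfctE in X1.
  have M1 := is_deriveM D3 D2.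
  apply: is_derive_eq M1 _.
  rewrite /flat t0 /GRing.scale /=.
  case: n {D3} => [|n] /=; first by rewrite !mul0r mulr0; ring.
  by rewrite !exprS; ring.
rewrite t0.
have -> : flat n.+2 0 - n%:R * flat n.+1 0 = 0.
  by rewrite /flat ltxx mulr0 subrr.
suff H : s^-1 *: ((flat n \o shift 0) (s *: 1) - flat n 0) @[s --> 0^'] --> (0 : R).
  by split; [apply/cvg_ex; eexists; exact: H|exact: cvg_lim H].
have E s : s != 0 -> s^-1 *: ((flat n \o shift 0) (s *: 1) - flat n 0) = flat n.+1 s.
  move=> s0; rewrite /= addr0 [s *: 1]mulr1 {2}/flat ltxx subr0 /flat.
  by case: ifP => _; [rewrite exprS -mulrA|rewrite [_ *: _]mulr0].
apply/cvgr0Pnorm_lt => e e0; near=> s.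
rewrite E; last by near: s; exact: nbhs_dnbhs_neq.
rewrite ger0_norm ?flat_ge0//.
have [s0|s0] := ltP 0 s; last by rewrite /flat (ltNge 0 s) s0.
apply: le_lt_trans (flat_le _ s0) _.
rewrite mulrC -ltr_pdivlMr ?exprn_gt0 ?ltr0n//.
apply: le_lt_trans (ler_norm _) _; near: s; apply: dnbhs0_lt.
by rewrite divr_gt0 ?exprn_gt0 ?ltr0n.
Unshelve. all: by end_near. Qed.

Lemma is_derive_comp1 (W : normedModType R) (h : R -> R) (psi : W -> R) p v dh :
  is_derive (psi p) 1 h dh -> derivable psi p v ->
  is_derive p v (fun q => h (psi q)) (dh * 'D_v psi p).
Proof.
move=> H dpsi.
pose g (s : R) := psi (s *: v + p).
have g0 : g 0 = psi p by rewrite /g scale0r add0r.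
have dg : is_derive (0 : R) 1 g ('D_v psi p).
  have := @is_derive_line R W psi p v 0; rewrite scale0r add0r; exact.
have {}H : is_derive (g 0) 1 h dh by rewrite g0.
have [D1 D2] := is_derive1_comp H dg.
have E : (fun s => s^-1 *: (((fun q => h (psi q)) \o shift p) (s *: v) - h (psi p)))
  = (fun s => s^-1 *: (((h \o g) \o shift 0) (s *: 1) - (h \o g) 0)).
  by apply/funext => s /=; rewrite g0 /g addr0 [s *: 1]mulr1.
by split; rewrite /derivable /derive E//= mulrC.
Qed.

(** All n are treated together because the derivative of flat n involves flat n.+1
    and flat n.+2. *)
Lemma Ck_flat (W : normedModType R) (U : set W) (psi : W -> R) k n : open U ->
  Ck k U psi -> Ck k U (fun p => flat n (psi p)).
Proof.
move=> oU.
have C0 k' m : Ck k' U psi -> forall p, U p -> {for p, continuous (fun p => flat m (psi p))}.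
  move=> C p Up; apply: (@continuous_comp _ _ _ psi (flat m)); first exact: Ck_cont C Up.
  have [D _] := is_derive_flat m (psi p).
  exact/differentiable_continuous/derivable1_diffP.
elim: k n => [|k IH] n C; first by split=> //; exact: C0 C.
split; first exact: C0 C.
split=> [p Up v|v].
  by have [] := is_derive_comp1 (is_derive_flat n (psi p)) (Ck_derivable C Up : derivable psi p v).
apply: (@Ck_eq _ _ _ _ (fun p => (flat n.+2 (psi p) + (- n%:R) * flat n.+1 (psi p)) * 'D_v psi p)) => //.
  move=> q Uq; rewrite mulNr.
  by have [_ ->] := is_derive_comp1 (is_derive_flat n (psi q)) (Ck_derivable C Uq : derivable psi q v).
apply: CkM => //; last exact: Ck_derive.
apply: CkD => //; first exact/IH/CkW.
by apply: CkM => //; [exact: Ck_cst|exact/IH/CkW].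
Qed.

End SmoothBump.

(** * The algebra of smooth functions on open sets of the model space *)

Section SmoothOn.
Variable R : realType.
Local Notation C := R[i].
Local Notation V := (model R).
Implicit Types (U : set V).

Lemma conjE (z : C) : z^*%R = complex.Re z -i* complex.Im z.
Proof. by case: z. Qed.

Lemma iterD_rcons vs v (f : V -> R) : Defs.iterD (rcons vs v) f = Defs.iterD vs ('D_v f).
Proof. by elim: vs => //= u vs ->. Qed.

Lemma smooth_on_derive U (f : V -> R) v : smooth_on U f -> smooth_on U ('D_v f).
Proof.
move=> H vs p Up; have := H (rcons vs v) p Up.
by rewrite iterD_rcons.
Qed.

(** Brings the iterated derivatives of smooth_on into a form in which closure
    properties are inductions on the order. *)
Lemma smooth_onP U (f : V -> R) : smooth_on U f <-> forall k, Ck k U f.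
Proof.
split=> [H k|].
  elim: k f H => [|k IH] f H; first by split=> // p Up; have [] := H [::] p Up.
  split; first by move=> p Up; have [] := H [::] p Up.
  split; first by move=> p Up v; have [] := H [::] p Up.
  by move=> v; apply: IH; exact: smooth_on_derive.
move=> H vs; elim/last_ind: vs f H => [|vs v IH] f H p Up.
  split; first exact: Ck_cont (H 0%N) Up.
  by move=> v; exact: Ck_derivable (H 1%N) Up.
rewrite iterD_rcons.
by apply: IH => // k; exact: Ck_derive.
Qed.

Lemma csmooth_onP U (f : V -> C) : csmooth_on U f <->
  smooth_on U (fun p => complex.Re (f p)) /\ smooth_on U (fun p => complex.Im (f p)).
Proof. by []. Qed.

Lemma smooth_sub U U' (f : V -> R) : U' `<=` U -> smooth_on U f -> smooth_on U' f.
Proof. by move=> s H vs p /s; exact: H. Qed.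

#[local] Opaque smooth_on csmooth_on.

Lemma smooth_eq U (f g : V -> R) : open U -> (forall q, U q -> f q = g q) ->
  smooth_on U f -> smooth_on U g.
Proof. by move=> oU E /smooth_onP H; apply/smooth_onP => k; apply: Ck_eq E (H k). Qed.

Lemma smooth_cst U (c : R) : smooth_on U (fun=> c).
Proof. by apply/smooth_onP => k; exact: Ck_cst. Qed.

Lemma smoothD U (f g : V -> R) : open U -> smooth_on U f -> smooth_on U g ->
  smooth_on U (fun p => f p + g p).
Proof. by move=> oU /smooth_onP Hf /smooth_onP Hg; apply/smooth_onP => k; exact: CkD. Qed.

Lemma smoothN U (f : V -> R) : open U -> smooth_on U f ->
  smooth_on U (fun p => - f p).
Proof. by move=> oU /smooth_onP Hf; apply/smooth_onP => k; exact: CkN. Qed.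

Lemma smoothB U (f g : V -> R) : open U -> smooth_on U f -> smooth_on U g ->
  smooth_on U (fun p => f p - g p).
Proof. by move=> oU Hf Hg; exact: (smoothD oU Hf (smoothN oU Hg)). Qed.

Lemma smoothM U (f g : V -> R) : open U -> smooth_on U f -> smooth_on U g ->
  smooth_on U (fun p => f p * g p).
Proof. by move=> oU /smooth_onP Hf /smooth_onP Hg; apply/smooth_onP => k; exact: CkM. Qed.

Lemma smoothV U (f : V -> R) : open U -> (forall p, U p -> f p != 0) ->
  smooth_on U f -> smooth_on U (fun p => (f p)^-1).
Proof. by move=> oU f0 /smooth_onP Hf; apply/smooth_onP => k; exact: CkV. Qed.

Lemma smooth_local U (f : V -> R) :
  (forall p, U p -> exists U', [/\ open U', U' p & smooth_on U' f]) -> smooth_on U f.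
Proof.
move=> H; apply/smooth_onP => k; apply: Ck_local => p /H[U' [oU' U'p /smooth_onP S ]].
by exists U'.
Qed.

Lemma smooth_comp U U' (f : V -> R) (phi : V -> V) : open U -> open U' ->
  (forall p, U' p -> U (phi p)) -> smooth_on U f ->
  (forall a, smooth_on U' (fun q => phi q ord0 a)) -> smooth_on U' (fun q => f (phi q)).
Proof.
move=> oU oU' HU /smooth_onP Hf Hp; apply/smooth_onP => k.
by apply: (Ck_comp oU oU') => // a; apply/smooth_onP: k.
Qed.

Lemma is_derive_coord (p v : V) a : is_derive p v (fun q : V => q ord0 a) (v ord0 a).
Proof.
have E : (fun h => h^-1 *: (((fun q : V => q ord0 a) \o shift p) (h *: v) - p ord0 a))
   = (fun h : R => h^-1 *: (h *: v ord0 a)).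
  by apply/funext => h /=; rewrite !mxE addrK.
suff H : h^-1 *: (((fun q : V => q ord0 a) \o shift p) (h *: v) - p ord0 a) @[h --> 0^']
    --> v ord0 a.
  by split; [apply/cvg_ex; eexists; exact: H|exact: cvg_lim H].
rewrite E; apply: (@cvg_trans _ ((fun=> v ord0 a) h @[h --> 0^'])); last exact: cvg_cst.
apply: near_eq_cvg; near=> h.
rewrite scalerA mulVf ?scale1r//; near: h; exact: nbhs_dnbhs_neq.
Unshelve. all: by end_near. Qed.

Lemma smooth_coord U a : smooth_on U (fun q : V => q ord0 a).
Proof.
apply/smooth_onP => -[|k].
  by split=> // p _; exact: coord_continuous.
split; first by move=> p _; exact: coord_continuous.
split=> [p _ v|v]; first by have [] := is_derive_coord p v a.
have -> : 'D_v (fun q : V => q ord0 a) = (fun=> v ord0 a).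
  by apply/funext => p; have [_ ->] := is_derive_coord p v a.
exact: Ck_cst.
Qed.

Lemma smooth_flat U n (f : V -> R) : open U -> smooth_on U f ->
  smooth_on U (fun p => flat n (f p)).
Proof. by move=> oU /smooth_onP Hf; apply/smooth_onP => k; exact: Ck_flat. Qed.

Lemma csmooth_eq U (f g : V -> C) : open U -> (forall q, U q -> f q = g q) ->
  csmooth_on U f -> csmooth_on U g.
Proof.
move=> oU E /csmooth_onP[H1 H2]; apply/csmooth_onP; split; [apply: smooth_eq H1|apply: smooth_eq H2] => // q Uq;
by rewrite E.
Qed.

Lemma csmooth_local U (f : V -> C) :
  (forall p, U p -> exists U', [/\ open U', U' p & csmooth_on U' f]) -> csmooth_on U f.
Proof.
move=> H; apply/csmooth_onP; split; apply: smooth_local => p /H[U' [oU' U'p /csmooth_onP[S1 S2]]]; by exists U'.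
Qed.

Lemma csmooth_real U (f : V -> R) : smooth_on U f -> csmooth_on U (fun p => (f p)%:C).
Proof. by move=> H; apply/csmooth_onP; split; [exact: H|exact: smooth_cst]. Qed.

Lemma csmooth_cst U (c : C) : csmooth_on U (fun=> c).
Proof. by apply/csmooth_onP; split; exact: smooth_cst. Qed.

Lemma csmoothD U (f g : V -> C) : open U -> csmooth_on U f -> csmooth_on U g ->
  csmooth_on U (fun p => f p + g p).
Proof.
move=> oU /csmooth_onP[f1 f2] /csmooth_onP[g1 g2]; apply/csmooth_onP; split.
  apply: smooth_eq (smoothD oU f1 g1) => // q _; by case: (f q) (g q) => a b [].
apply: smooth_eq (smoothD oU f2 g2) => // q _; by case: (f q) (g q) => a b [].
Qed.

Lemma csmoothM U (f g : V -> C) : open U -> csmooth_on U f -> csmooth_on U g ->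
  csmooth_on U (fun p => f p * g p).
Proof.
move=> oU /csmooth_onP[f1 f2] /csmooth_onP[g1 g2]; apply/csmooth_onP; split.
  apply: smooth_eq (smoothB oU (smoothM oU f1 g1) (smoothM oU f2 g2)) => // q _.
  by case: (f q) (g q) => a b [].
apply: smooth_eq (smoothD oU (smoothM oU f1 g2) (smoothM oU f2 g1)) => // q _.
by case: (f q) (g q) => a b [].
Qed.

Lemma csmoothN U (f : V -> C) : open U -> csmooth_on U f -> csmooth_on U (fun p => - f p).
Proof.
move=> oU H; apply: csmooth_eq (csmoothM oU (csmooth_cst U (-1)) H) => // q _.
by rewrite mulN1r.
Qed.

Lemma csmoothB U (f g : V -> C) : open U -> csmooth_on U f -> csmooth_on U g ->
  csmooth_on U (fun p => f p - g p).
Proof. by move=> oU Hf Hg; exact: (csmoothD oU Hf (csmoothN oU Hg)). Qed.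

Lemma csmooth_conj U (f : V -> C) : open U -> csmooth_on U f -> csmooth_on U (fun p => (f p)^*%R).
Proof.
move=> oU /csmooth_onP[f1 f2]; apply/csmooth_onP; split; first by apply: smooth_eq f1 => // q _; case: (f q).
by apply: smooth_eq (smoothN oU f2) => // q _; case: (f q).
Qed.

Lemma csmoothV U (f : V -> C) : open U -> (forall p, U p -> f p != 0) ->
  csmooth_on U f -> csmooth_on U (fun p => (f p)^-1).
Proof.
move=> oU f0 /csmooth_onP[f1 f2].
have N : smooth_on U (fun p => (complex.Re (f p) * complex.Re (f p) +
   complex.Im (f p) * complex.Im (f p))^-1).
  apply: (smoothV oU); last by apply: (smoothD oU); exact: smoothM.
  move=> p Up; have := f0 p Up; case: (f p) => a b; apply: contraNneq => /= /eqP.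
  rewrite paddr_eq0 -?expr2 ?sqr_ge0// !expf_eq0 /= => /andP[/eqP -> /eqP ->].
  by rewrite eq_complex /= eqxx.
apply/csmooth_onP; split.
  by apply: smooth_eq (smoothM oU f1 N) => // q _; case: (f q) => a b /=; rewrite !expr2.
apply: smooth_eq (smoothN oU (smoothM oU f2 N)) => // q _.
by case: (f q) => a b /=; rewrite !expr2.
Qed.

Lemma csmooth_sum U (I : Type) (r : seq I) (P : pred I) (F : I -> V -> C) : open U ->
  (forall i, csmooth_on U (F i)) -> csmooth_on U (fun p => \sum_(i <- r | P i) F i p).
Proof.
move=> oU H; elim: r => [|i r IH].
  by apply: csmooth_eq (csmooth_cst U 0) => // q _; rewrite big_nil.
under eq_fun do rewrite big_cons; by case: (P i); [exact: (csmoothD oU (H i) IH)|exact: IH].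
Qed.

Lemma csmooth_prod U (I : Type) (r : seq I) (P : pred I) (F : I -> V -> C) : open U ->
  (forall i, csmooth_on U (F i)) -> csmooth_on U (fun p => \prod_(i <- r | P i) F i p).
Proof.
move=> oU H; elim: r => [|i r IH].
  by apply: csmooth_eq (csmooth_cst U 1) => // q _; rewrite big_nil.
under eq_fun do rewrite big_cons; by case: (P i); [exact: (csmoothM oU (H i) IH)|exact: IH].
Qed.

Lemma csmooth_cderive U (f : V -> C) v : csmooth_on U f -> csmooth_on U (cderive v f).
Proof. by move=> /csmooth_onP[f1 f2]; apply/csmooth_onP; split; [exact: (smooth_on_derive v f1)|exact: (smooth_on_derive v f2)]. Qed.

Lemma csmooth_dhol U (f : V -> C) j : open U -> csmooth_on U f -> csmooth_on U (dhol j f).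
Proof.
move=> oU H; apply: (csmoothM oU); first exact: csmooth_cst.
apply: (csmoothB oU); first exact: csmooth_cderive.
by apply: (csmoothM oU); [exact: csmooth_cst|exact: csmooth_cderive].
Qed.

Lemma csmooth_dbar U (f : V -> C) j : open U -> csmooth_on U f -> csmooth_on U (dbar j f).
Proof.
move=> oU H; apply: (csmoothM oU); first exact: csmooth_cst.
apply: (csmoothD oU); first exact: csmooth_cderive.
by apply: (csmoothM oU); [exact: csmooth_cst|exact: csmooth_cderive].
Qed.

Definition mx_smooth U m n (A : V -> 'M[C]_(m, n)) := forall i j, csmooth_on U (fun p => A p i j).

Lemma csmooth_det U n (A : V -> 'M[C]_n) : open U -> mx_smooth U A -> csmooth_on U (fun p => \det (A p)).
Proof.
move=> oU H; rewrite /determinant; apply: (csmooth_sum _ _ oU) => s.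
apply: (csmoothM oU); first exact: csmooth_cst.
by apply: (csmooth_prod _ _ oU) => i; exact: H.
Qed.

(** Cramer's rule. *)
Lemma mx_smooth_inv U n (A : V -> 'M[C]_n) : open U -> (forall p, U p -> A p \in unitmx) ->
  mx_smooth U A -> mx_smooth U (fun p => invmx (A p)).
Proof.
move=> oU uA H i j.
apply: (@csmooth_eq _ (fun p => (\det (A p))^-1 * ((-1) ^+ (j + i) *
     \det (\matrix_(a, b) A p (lift j a) (lift i b))))) => //.
  move=> q Uq; rewrite /invmx uA// !mxE /cofactor; congr (_ * (_ * \det _)).
  by apply/matrixP => a b; rewrite !mxE.
apply: (csmoothM oU).
  apply: (csmoothV oU); last exact: (csmooth_det oU).
  by move=> p Up; have := uA p Up; rewrite unitmxE unitfE.
apply: (csmoothM oU); first exact: csmooth_cst.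
apply: (csmooth_det oU) => a b.
by under eq_fun do rewrite mxE; exact: H.
Qed.

End SmoothOn.

(** * Wirtinger derivatives *)


Lemma leibniz_complex (R : realType) (a b c d a' b' c' d' : R) :
  (a * c' + c * a' - (b * d' + d * b')) +i* (a * d' + d * a' + (b * c' + c * b')) =
  (a' +i* b') * (c +i* d) + (a +i* b) * (c' +i* d').
Proof. by apply/eqP; rewrite eq_complex /=; apply/andP; split; apply/eqP; ring. Qed.

Lemma leibniz_half (C : comPzRingType) (h i x y x' y' f g : C) :
  h * (x * g + f * y - i * (x' * g + f * y')) = h * (x - i * x') * g + f * (h * (y - i * y')).
Proof. ring. Qed.

Lemma dy_of_wirtinger (C : numFieldType) (i x y : C) : i * i = -1 ->
  y = i * (2%:R^-1 * (x - i * y) - 2%:R^-1 * (x + i * y)).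
Proof.
move=> ii; have -> : i * (2%:R^-1 * (x - i * y) - 2%:R^-1 * (x + i * y)) = - (i * i) * y by field.
by rewrite ii opprK mul1r.
Qed.

Lemma wirtinger_split (C : comPzRingType) (h b i s t : C) :
  s * (h + b) + t * (i * (h - b)) = h * (s + i * t) + b * (s + - i * t).
Proof. ring. Qed.

Lemma pull_factor (C : comPzRingType) (h i d x y : C) :
  h * (d * x - i * (d * y)) = d * (h * (x - i * y)).
Proof. ring. Qed.

Section ComplexDerivatives.
Variable R : realType.
Local Notation C := R[i].
Local Notation V := (model R).
Implicit Types (U : set V) (f g : V -> C) (p v : V).

(** The hypothesis under which the Wirtinger derivatives satisfy the Leibniz rule;
    without it the directional derivatives are junk values. *)
Definition cderivable f p : Prop := forall v,
  derivable (fun q => complex.Re (f q)) p v /\ derivable (fun q => complex.Im (f q)) p v.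

Lemma csmooth_derivable U f p : csmooth_on U f -> U p -> cderivable f p.
Proof.
move=> /csmooth_onP[/smooth_onP H1 /smooth_onP H2] Up v.
by split; [exact: Ck_derivable (H1 1%N) Up|exact: Ck_derivable (H2 1%N) Up].
Qed.

Lemma cderiveM f g p v : cderivable f p -> cderivable g p ->
  cderive v (fun q => f q * g q) p = cderive v f p * g p + f p * cderive v g p.
Proof.
move=> /(_ v)[f1 f2] /(_ v)[g1 g2]; rewrite /cderive.
have -> : (fun q => complex.Re (f q * g q)) =
  (fun q => complex.Re (f q)) * (fun q => complex.Re (g q)) -
  (fun q => complex.Im (f q)) * (fun q => complex.Im (g q)).
  apply/funext => q; change (complex.Re (f q * g q) =
    complex.Re (f q) * complex.Re (g q) - complex.Im (f q) * complex.Im (g q)).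
  by case: (f q) (g q) => a b [].
have -> : (fun q => complex.Im (f q * g q)) =
  (fun q => complex.Re (f q)) * (fun q => complex.Im (g q)) +
  (fun q => complex.Im (f q)) * (fun q => complex.Re (g q)).
  apply/funext => q; change (complex.Im (f q * g q) =
    complex.Re (f q) * complex.Im (g q) + complex.Im (f q) * complex.Re (g q)).
  by case: (f q) (g q) => a b [].
rewrite (deriveB (derivableM f1 g1) (derivableM f2 g2)).
rewrite (deriveD (derivableM f1 g2) (derivableM f2 g1)).
rewrite (deriveM f1 g1) (deriveM f2 g2) (deriveM f1 g2) (deriveM f2 g1).
case: (f p) (g p) => a b [c d]; exact: leibniz_complex.
Qed.

Lemma dholE f p j : dhol j f p = 2%:R^-1 * (cderive (dx R j) f p - 'i * cderive (dy R j) f p).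
Proof. by []. Qed.

Lemma dholM f g p j : cderivable f p -> cderivable g p ->
  dhol j (fun q => f q * g q) p = dhol j f p * g p + f p * dhol j g p.
Proof. by move=> df dg; rewrite /dhol (cderiveM _ df dg) (cderiveM _ df dg); exact: leibniz_half. Qed.

Lemma dbarM f g p j : cderivable f p -> cderivable g p ->
  dbar j (fun q => f q * g q) p = dbar j f p * g p + f p * dbar j g p.
Proof.
move=> df dg; rewrite /dbar (cderiveM _ df dg) (cderiveM _ df dg).
rewrite -[X in _ * (_ + X * _) = _]opprK -[X in _ = _ * (_ + X * _) * _ + _]opprK.
rewrite -[X in _ = _ + _ * (_ * (_ + X * _))]opprK !(mulNr (- _)); exact: leibniz_half.
Qed.

Lemma conj_complex_i : ('i%C : C)^*%R = - 'i%C.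
Proof. by rewrite conjE; apply/eqP; rewrite eq_complex /= oppr0 !eqxx. Qed.

Lemma conjC_realE (x : R) : (x%:C)^*%R = x%:C.
Proof. by rewrite conjE /= oppr0. Qed.

Lemma num_iE : ('i%R : C) = 'i%C.
Proof. by []. Qed.

Lemma cderive_conj f p v : cderivable f p ->
  cderive v (fun q => (f q)^*%R) p = (cderive v f p)^*%R.
Proof.
move=> /(_ v)[f1 f2]; rewrite /cderive conjE /=.
have -> : (fun q => complex.Re (f q)^*%R) = (fun q => complex.Re (f q)).
  by apply/funext => q; rewrite conjE.
have -> : (fun q => complex.Im (f q)^*%R) = - (fun q => complex.Im (f q)).
  by apply/funext => q; rewrite conjE.
by rewrite deriveN.
Qed.

Lemma dhol_conj f p j : cderivable f p ->
  dhol j (fun q => (f q)^*%R) p = (dbar j f p)^*%R.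
Proof.
move=> df; rewrite /dhol /dbar !(cderive_conj _ df) rmorphM rmorphD rmorphM /=.
by rewrite fmorphV rmorph_nat conj_complex_i mulNr.
Qed.

Lemma dbar_conj f p j : cderivable f p ->
  dbar j (fun q => (f q)^*%R) p = (dhol j f p)^*%R.
Proof.
move=> df; rewrite /dhol /dbar !(cderive_conj _ df) rmorphM rmorphB rmorphM /=.
by rewrite fmorphV rmorph_nat conj_complex_i mulNr opprK.
Qed.

Lemma dbar_real (f : V -> R) p j : cderivable (fun q => (f q)%:C) p ->
  dbar j (fun q => (f q)%:C) p = (dhol j (fun q => (f q)%:C) p)^*%R.
Proof.
move=> df; rewrite -(dbar_conj _ df); congr (dbar j _ p); apply/funext => q.
by rewrite conjE /= oppr0.
Qed.

Lemma cderive_near f g p v : (\near p, f p = g p) -> cderive v f p = cderive v g p.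
Proof.
move=> E; rewrite /cderive.
by congr (_ +i* _); apply: near_eq_derive; apply: filterS E => q ->.
Qed.

Lemma dhol_near f g p j : (\near p, f p = g p) -> dhol j f p = dhol j g p.
Proof. by move=> E; rewrite /dhol !(cderive_near _ E). Qed.

(** The real chain rule regrouped: dx h + dy k is the sum over the z-coordinates of
    the holomorphic and antiholomorphic parts. *)
Lemma cderive_chain U U' f (phi : V -> V) p v : open U -> open U' ->
  csmooth_on U f -> U (phi p) -> U' p -> (forall a, smooth_on U' (fun q => phi q ord0 a)) ->
  cderive v (fun q => f (phi q)) p =
  \sum_(a < 3) (dhol a f (phi p) * cderive v (fun q => zcoord a (phi q)) p +
                dbar a f (phi p) * (cderive v (fun q => zcoord a (phi q)) p)^*%R).
Proof.
move=> oU oU' /csmooth_onP[/smooth_onP H1 /smooth_onP H2] Up U'p Hphi.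
have dphi a : derivable (fun q => phi q ord0 a) p v.
  by have /smooth_onP H := Hphi a; exact: Ck_derivable (H 1%N) U'p.
have [_ E1] := is_derive_chain oU (H1 1%N) Up dphi.
have [_ E2] := is_derive_chain oU (H2 1%N) Up dphi.
transitivity (\sum_(a < 3 + 3) ('D_v (fun q => phi q ord0 a) p)%:C *
    cderive (delta_mx ord0 a) f (phi p)).
  rewrite {1}/cderive E1 E2; elim: (index_enum _) => [|a r IH]; first by rewrite !big_nil.
  rewrite !big_cons -IH /cderive; apply/eqP; rewrite eq_complex /= !mul0r subr0 addr0.
  by rewrite !eqxx.
rewrite big_split_ord /= -big_split /=; apply: eq_bigr => a _.
rewrite -/(dx R a) -/(dy R a).
have -> : cderive (dx R a) f (phi p) = dhol a f (phi p) + dbar a f (phi p).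
  by rewrite /dhol /dbar; field.
have -> : cderive (dy R a) f (phi p) = 'i%C * (dhol a f (phi p) - dbar a f (phi p)).
  by apply: dy_of_wirtinger; rewrite -expr2 sqr_i.
set h := dhol a f _; set b := dbar a f _.
rewrite [cderive v (fun q => zcoord a (phi q)) p]complexE /cderive /zcoord /=.
set s := 'D_v _ p; set t := 'D_v _ p.
rewrite rmorphD rmorphM /= conj_complex_i !conjC_realE; exact: wirtinger_split.
Qed.

Lemma dhol_chain U U' f (phi : V -> V) p b : open U -> open U' ->
  holomorphic_on U f -> U (phi p) -> U' p -> (forall a, smooth_on U' (fun q => phi q ord0 a)) ->
  dhol b (fun q => f (phi q)) p =
  \sum_(a < 3) dhol a f (phi p) * dhol b (fun q => zcoord a (phi q)) p.
Proof.
move=> oU oU' [Cf Hf] Up U'p Hphi.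
have E v : cderive v (fun q => f (phi q)) p =
    \sum_(a < 3) dhol a f (phi p) * cderive v (fun q => zcoord a (phi q)) p.
  rewrite (cderive_chain v oU oU' Cf Up U'p Hphi); apply: eq_bigr => a _.
  by rewrite (Hf a _ Up) mul0r addr0.
rewrite [in LHS]dholE (E (dx R b)) (E (dy R b)) mulr_sumr -sumrB mulr_sumr.
apply: eq_bigr => a _; exact: pull_factor.
Qed.

Lemma dhol_zcoord (p : V) a b : dhol b (zcoord a) p = (a == b)%:R.
Proof.
have dc v a' : 'D_v (fun q : V => q ord0 a') p = v ord0 a'.
  by have [_ ->] := is_derive_coord p v a'.
rewrite /dhol /cderive /zcoord /= !dc !mxE /=.
rewrite !eq_shift ?(eq_lshift, eq_rshift) /=.
apply: (canLR (mulKf _)); first by rewrite pnatr_eq0.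
by case: (a == b); apply/eqP; rewrite eq_complex /=; apply/andP; split; apply/eqP; ring.
Qed.

End ComplexDerivatives.

(** * Iterated integrals of continuous functions with bounded support *)

Lemma continuous_forD (R : realType) (T : topologicalType) (f g : T -> R) p :
  {for p, continuous f} -> {for p, continuous g} -> {for p, continuous (fun q => f q + g q)}.
Proof. by move=> cf cg; apply: cvgD; [exact: cf|exact: cg]. Qed.

Lemma continuous_forZ (R : realType) (T : topologicalType) (f : T -> R) c p :
  {for p, continuous f} -> {for p, continuous (fun q => c * f q)}.
Proof. by move=> cf; apply: cvgM; [exact: cvg_cst|exact: cf]. Qed.

Section IntegralR.
Variable R : realType.
Local Notation mu := (@lebesgue_measure R).
Implicit Types h : R -> R.

Definition bsupp1 h (M : R) := forall x, h x != 0 -> `|x| <= M.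

(** Turns integrals over the line into integrals over a compact interval. *)
Lemma restrict_bsupp h M : bsupp1 h M -> h = h \_ `[- M, M].
Proof.
move=> hM; apply/funext => x; rewrite patchE; case: ifPn => // xM.
apply/eqP; apply: contraNT xM => /hM; rewrite ler_norml inE /= in_itv /=.
by [].
Qed.

Lemma itv_length (a b : R) : fine (mu `[a, b]) = if a < b then b - a else 0.
Proof.
have E := lebesgue_measure_itv (`[a, b]%R : interval R).
by transitivity (fine (if (a%:E < b%:E)%E then b%:E - a%:E else 0)%E); [congr fine; exact: E|rewrite lte_fin; case: ifP].
Qed.

Lemma integrable_bsupp h M : continuous h -> bsupp1 h M -> mu.-integrable setT (EFin \o h).
Proof.
move=> ch hM; rewrite (restrict_bsupp hM) -restrict_EFin.
have mI : measurable (`[- M, M] : set R) by exact: measurable_itv.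
apply: (iffLR (@integrable_mkcond _ _ _ mu _ _ mI)).
apply: continuous_compact_integrable; first exact: segment_compact.
exact: continuous_subspaceT.
Qed.

Lemma Rint_bound h M e : continuous h -> 0 <= M -> bsupp1 h M ->
  (forall x, `|h x| <= e) -> `|\int[mu]_x h x| <= (2%:R * M) * e.
Proof.
move=> ch M0 hM he.
rewrite (restrict_bsupp hM) -Rintegral_mkcond.
have mI : measurable (`[- M, M] : set R) by exact: measurable_itv.
have iI g : continuous g -> mu.-integrable `[- M, M] (EFin \o g).
  move=> cg; apply: continuous_compact_integrable; first exact: segment_compact.
  exact: continuous_subspaceT.
apply: (@le_trans _ _ (\int[mu]_(x in `[- M, M]) `|h x|)); first by apply: le_normr_Rintegral => //; exact: iI.
apply: (@le_trans _ _ (\int[mu]_(x in `[- M, M]) e)).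
  apply: le_Rintegral => //.
  - apply: iI => x; apply: continuous_comp; [exact: ch|exact: norm_continuous].
  - apply: (iI (cst e)) => x; exact: cvg_cst.
rewrite Rintegral_cst// (itv_length (- M) M).
rewrite mulrC; case: ltP => [_|_] /=; first by rewrite opprK mulr_natl mulr2n.
by rewrite mul0r mulr_ge0 ?mulr_ge0//; exact: le_trans (normr_ge0 (h 0)) (he 0).
Qed.

Lemma Rint_gt0 h M x0 : continuous h -> bsupp1 h M -> (forall x, 0 <= h x) ->
  0 < h x0 -> 0 < \int[mu]_x h x.
Proof.
move=> ch hM h0 hx0.
have e0 : 0 < h x0 / 2 by rewrite divr_gt0.
have [d /= d0 Hd] : exists2 d : R, 0 < d & forall y, `|x0 - y| < d -> h x0 / 2 <= h y.
  have /cvgrPdist_lt/(_ _ e0)/nbhs_ballP[d /= d0 H] := ch x0.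
  exists d => // y xy; have := H y; rewrite /ball /= => /(_ xy).
  by rewrite ltr_norml => /andP[_]; set a := h x0; set b := h y; lra.
pose I : set R := `[x0 - d / 2, x0 + d / 2]%classic.
have mI : measurable I by exact: measurable_itv.
have iI g : continuous g -> mu.-integrable I (EFin \o g).
  move=> cg; apply: continuous_compact_integrable; first exact: segment_compact.
  exact: continuous_subspaceT.
apply: (@lt_le_trans _ _ (\int[mu]_(x in I) (h x0 / 2))).
  rewrite Rintegral_cst// itv_length ifT; last by lra.
  by rewrite mulr_gt0//; lra.
apply: (@le_trans _ _ (\int[mu]_(x in I) h x)).
  apply: le_Rintegral => //.
  - apply: (iI (cst _)) => x; exact: cvg_cst.
  - exact: iI.
  - move=> x; rewrite /I /= in_itv /= => /andP[x1 x2]; apply: Hd.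
    by rewrite ltr_norml; lra.
rewrite Rintegral_mkcond; apply: le_Rintegral => //.
- rewrite -restrict_EFin; apply: (iffLR (@integrable_mkcond _ _ _ mu _ _ mI)); exact: iI.
- exact: integrable_bsupp hM.
- by move=> x _; rewrite patchE; case: ifP.
Qed.

End IntegralR.

Section IteratedIntegral.
Variable R : realType.

Definition bsupp n (f : 'rV[R]_n -> R) (M : R) := forall v, f v != 0 -> forall i, `|v ord0 i| <= M.

Definition slice n (f : 'rV[R]_n.+1 -> R) (x : R) : 'rV[R]_n -> R :=
  fun v => f (row_mx (x%:M : 'rV[R]_1) v).

Lemma iterated_integralS n (f : 'rV[R]_n.+1 -> R) :
  iterated_integral f = \int[lebesgue_measure]_x iterated_integral (slice f x).
Proof. by []. Qed.

Lemma row_mx0 n (x : R) (v : 'rV[R]_n) :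
  (row_mx (x%:M : 'rV[R]_1) v : 'rV[R]_n.+1) ord0 ord0 = x.
Proof.
rewrite mxE; case: splitP => [j _|k //]; by rewrite !mxE !ord1 ?eqxx ?mulr1n.
Qed.

Lemma row_mxS n (x : R) (v : 'rV[R]_n) (i : 'I_n) :
  (row_mx (x%:M : 'rV[R]_1) v : 'rV[R]_n.+1) ord0 (lift ord0 i) = v ord0 i.
Proof.
rewrite mxE; case: splitP => [j|k /=]; first by rewrite (ord1 j).
by rewrite /bump /= => -[] /val_inj ->.
Qed.

Lemma bsupp_slice n (f : 'rV[R]_n.+1 -> R) M x : bsupp f M -> bsupp (slice f x) M.
Proof. by move=> H v /H /= Hv i; have := Hv (lift ord0 i); rewrite row_mxS. Qed.

Lemma slice_eq0 n (f : 'rV[R]_n.+1 -> R) M x v : bsupp f M -> M < `|x| -> slice f x v = 0.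
Proof.
move=> H Mx; apply/eqP; apply: contraTT Mx => /H/(_ ord0); rewrite row_mx0 -leNgt.
by [].
Qed.

Lemma continuous_row_mx n (T : topologicalType) (a : T -> R) (b : T -> 'rV[R]_n) p :
  {for p, continuous a} -> {for p, continuous b} ->
  {for p, continuous (fun q => row_mx ((a q)%:M : 'rV[R]_1) (b q) : 'rV[R]_n.+1)}.
Proof.
move=> ca cb; apply: continuous_rV => i.
case: (unliftP ord0 i) => [j ->|->].
  have -> : (fun q => (row_mx ((a q)%:M : 'rV[R]_1) (b q) : 'rV[R]_n.+1) ord0 (lift ord0 j)) =
     (fun q => b q ord0 j) by apply/funext => q; exact: row_mxS.
  apply: (@continuous_comp _ _ _ b (fun v : 'rV[R]_n => v ord0 j)) => //.
  exact: coord_continuous.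
have -> // : (fun q => (row_mx ((a q)%:M : 'rV[R]_1) (b q) : 'rV[R]_n.+1) ord0 ord0) = a.
by apply/funext => q; exact: row_mx0.
Qed.

Lemma continuous_slice n (f : 'rV[R]_n.+1 -> R) x : continuous f -> continuous (slice f x).
Proof.
move=> cf v; apply: (@continuous_comp _ _ _ (fun v => row_mx (x%:M : 'rV[R]_1) v : 'rV[R]_n.+1) f); last exact: cf.
exact: (@continuous_row_mx n _ (fun=> x) (fun v => v) v (@cvg_cst _ x _ (nbhs v) _) (@cvg_id _ _)).
Qed.

(** Uniform continuity in the last variables, by the tube lemma on the compact box
    that contains the support of every slice. *)
Lemma slice_near n (f : 'rV[R]_n.+1 -> R) M x0 e : continuous f -> bsupp f M -> 0 < e ->
  \forall x \near x0, forall v, `|slice f x v - slice f x0 v| <= e.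
Proof.
move=> cf fM e0.
pose K : set 'rV[R]_n := [set v | forall i, `[- M, M]%classic (v ord0 i)].
have cK : compact K by apply: (@rV_compact R n (fun=> `[- M, M]%classic)) => i; exact: segment_compact.
have nK : \forall x \near x0, K `<=` (fun v => `|slice f x v - slice f x0 v| <= e).
  apply: (iffLR (compact_near_coveringP K) cK R (nbhs x0) (fun x v => `|slice f x v - slice f x0 v| <= e)) => v0 _.
  have c1 : {for (v0, x0), continuous (fun w : 'rV[R]_n * R => slice f w.2 w.1)}.
    apply: (@continuous_comp _ _ _ (fun w : 'rV[R]_n * R => row_mx (w.2%:M : 'rV[R]_1) w.1 : 'rV[R]_n.+1) f); last exact: cf.
    by apply: (@continuous_row_mx n _ (fun w : 'rV[R]_n * R => w.2) (fun w => w.1)); [exact: cvg_snd|exact: cvg_fst].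
  have c2 : {for (v0, x0), continuous (fun w : 'rV[R]_n * R => slice f x0 w.1)}.
    apply: (@continuous_comp _ _ _ (fun w : 'rV[R]_n * R => w.1) (slice f x0)); first exact: cvg_fst.
    exact: continuous_slice.
  have e2 : 0 < e / 2 by rewrite divr_gt0.
  have /cvgrPdist_lt/(_ _ e2) n1 := c1.
  have /cvgrPdist_lt/(_ _ e2) n2 := c2.
  have : \forall w \near (v0, x0), `|slice f w.2 w.1 - slice f x0 w.1| <= e.
    apply: filterS2 n1 n2 => w /=.
    move=> h1 h2; rewrite [e]splitr.
    rewrite -(subrKA (slice f x0 v0)) (le_trans (ler_normD _ _))// lerD// ltW//.
    by rewrite distrC.
  exact.
apply: filterS nK => x Hx v.
have [Kv|nKv] := pselect (K v); first exact: Hx.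
have Z y : slice f y v = 0.
  apply/eqP; apply: contra_notT nKv => /(bsupp_slice fM) Hv i.
  by rewrite /= in_itv /= -ler_norml.
by rewrite !Z subrr normr0 ltW.
Qed.

(** The bound it_B is what makes the next inner integral continuous in its
    parameter; the other fields are the properties used later.  They are proved
    together by induction on the dimension. *)
Record integral_theory n : Prop := {
  it_D : forall (f g : 'rV[R]_n -> R) M, continuous f -> continuous g -> bsupp f M -> bsupp g M ->
    iterated_integral (fun v => f v + g v) = iterated_integral f + iterated_integral g;
  it_Z : forall (f : 'rV[R]_n -> R) c M, continuous f -> bsupp f M ->
    iterated_integral (fun v => c * f v) = c * iterated_integral f;
  it_B : forall (f : 'rV[R]_n -> R) M e, continuous f -> 0 <= M -> bsupp f M ->
    (forall v, `|f v| <= e) -> `|iterated_integral f| <= (2%:R * M) ^+ n * e;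
  it_0 : forall (f : 'rV[R]_n -> R), (forall v, 0 <= f v) -> 0 <= iterated_integral f;
  it_P : forall (f : 'rV[R]_n -> R) M p, continuous f -> bsupp f M ->
    (forall v, 0 <= f v) -> 0 < f p -> 0 < iterated_integral f }.

Lemma continuous_int_slice n (f : 'rV[R]_n.+1 -> R) M : integral_theory n -> continuous f ->
  0 <= M -> bsupp f M -> continuous (fun x => iterated_integral (slice f x)).
Proof.
move=> T cf M0 fM x0; apply/cvgrPdist_le => e e0.
pose e' := e / ((2%:R * M) ^+ n + 1).
have D0 : 0 < (2%:R * M) ^+ n + 1 by rewrite ltr_wpDl// exprn_ge0// mulr_ge0.
have e'0 : 0 < e' by rewrite divr_gt0.
have N := @slice_near _ f M x0 e' cf fM e'0; apply: filterS N => x Hx.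
rewrite distrC -mulN1r -(it_Z T _ (@continuous_slice _ _ x0 cf) (@bsupp_slice _ _ _ x0 fM)).
rewrite -(it_D T (M := M)).
- apply: (@le_trans _ _ ((2%:R * M) ^+ n * e')).
    apply: (it_B T) => //.
    + move=> v; apply: continuous_forD; first exact: (@continuous_slice _ f x cf v).
      apply: continuous_forZ; exact: (@continuous_slice _ f x0 cf v).
    + move=> v; have [->|h _] := eqVneq (slice f x v) 0.
        by rewrite add0r mulN1r oppr_eq0; exact: bsupp_slice.
      exact: (bsupp_slice fM h).
    + by move=> v; rewrite mulN1r.
  rewrite /e' mulrA ler_pdivrMr// mulrC ler_wpM2l//; first exact: ltW.
  by rewrite lerDl.
- exact: continuous_slice.
- move=> v; apply: continuous_forZ; exact: (@continuous_slice _ f x0 cf v).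
- exact: bsupp_slice.
- by move=> v; rewrite mulN1r oppr_eq0; exact: bsupp_slice.
Qed.

Lemma iterated_integral_eq0 n (f : 'rV[R]_n -> R) : (forall v, f v = 0) -> iterated_integral f = 0.
Proof.
elim: n f => [|n IH] f H; first by rewrite /= H.
rewrite iterated_integralS (@eq_Rintegral _ _ _ _ _ (cst 0)) ?Rintegral_cst ?mul0r//.
by move=> x _; apply: IH => v; exact: H.
Qed.

Lemma bsupp_int_slice n (f : 'rV[R]_n.+1 -> R) M : bsupp f M ->
  bsupp1 (fun x => iterated_integral (slice f x)) M.
Proof.
move=> fM x; apply: contraNT; rewrite -ltNge => Mx.
by apply/eqP/iterated_integral_eq0 => v; exact: slice_eq0 fM Mx.
Qed.

Lemma bsupp_ge0 n (f : 'rV[R]_n -> R) M : bsupp f M -> bsupp f `|M|.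
Proof. by move=> H v /H Hv i; exact: le_trans (Hv i) (ler_norm _). Qed.

Lemma integral_theoryP n : integral_theory n.
Proof.
elim: n => [|n T].
  split=> //=.
  - by move=> f M e _ _ _ H; rewrite expr0 mul1r.
  - by move=> f M p _ _ _; rewrite (_ : p = 0)//; apply/rowP => -[].
have mT : measurable [set: R] by [].
have int (f : 'rV[R]_n.+1 -> R) M : continuous f -> bsupp f M ->
  lebesgue_measure.-integrable setT (EFin \o (fun x => iterated_integral (slice f x))).
  move=> cf fM; apply: integrable_bsupp (bsupp_int_slice fM).
  exact: (continuous_int_slice T cf (normr_ge0 M) (bsupp_ge0 fM)).
split.
- move=> f g M cf cg fM gM; rewrite !iterated_integralS -RintegralD//; last 2 first.
  + exact: int fM. + exact: int gM.
  apply: eq_Rintegral => x _; rewrite -(it_D T (M := M))//.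
  + exact: continuous_slice. + exact: continuous_slice.
  + exact: bsupp_slice. + exact: bsupp_slice.
- move=> f c M cf fM; rewrite !iterated_integralS -RintegralZl//; last exact: int fM.
  apply: eq_Rintegral => x _; exact: (it_Z T c (@continuous_slice _ f x cf) (@bsupp_slice _ _ _ x fM)).
- move=> f M e cf M0 fM fe; rewrite iterated_integralS exprS -mulrA.
  apply: Rint_bound => //.
  + exact: continuous_int_slice fM.
  + exact: bsupp_int_slice.
  + move=> x; apply: (it_B T) => //.
    * exact: continuous_slice.
    * exact: bsupp_slice.
    * by move=> v; exact: fe.
- move=> f f0; rewrite iterated_integralS; apply: Rintegral_ge0 => x _.
  by apply: (it_0 T) => v; exact: f0.
- move=> f M p cf fM f0 fp; rewrite iterated_integralS.
  apply: (@Rint_gt0 _ _ M (p ord0 ord0)).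
  + exact: (continuous_int_slice T cf (normr_ge0 M) (bsupp_ge0 fM)).
  + exact: bsupp_int_slice.
  + by move=> x; apply: (it_0 T) => v; exact: f0.
  + apply: (it_P T (M := M) (p := \row_i p ord0 (lift ord0 i))) => //.
    * exact: continuous_slice.
    * exact: bsupp_slice.
    * by move=> v; exact: f0.
    * have E : (row_mx ((p ord0 ord0)%:M : 'rV[R]_1) (\row_i p ord0 (lift ord0 i)) : 'rV[R]_n.+1) = p; last by rewrite /slice E.
      apply/rowP => i.
      by case: (unliftP ord0 i) => [j ->|->]; rewrite ?row_mxS ?row_mx0 ?mxE.
Qed.

End IteratedIntegral.

(** * Sums of squares and tensor products of positive forms *)

Section Gram.
Variable C : numClosedFieldType.

Local Notation conjC := (@Num.conj_op C).
Local Open Scope sesquilinear_scope.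

(** A congruence A = Q^T d Q-bar with d > 0: in this form inverses and tensor
    products of positive forms are explicit. *)
Definition gram n (A : 'M[C]_n) : Prop := exists (d : 'I_n -> C) (Q : 'M[C]_n),
  [/\ forall e, 0 < d e, Q \in unitmx &
      forall a b, A a b = \sum_e d e * Q e a * (Q e b)^*].

Lemma unit_row_neq0 n (P : 'M[C]_n) e : P \in unitmx -> exists a, P e a != 0.
Proof.
move=> uP; apply/existsP; apply: contraT; rewrite negb_exists => /forallP H.
suff : row e P *m invmx P = 0.
  rewrite -row_mul mulmxV// => /matrixP/(_ ord0 e); rewrite !mxE eqxx.
  by move/eqP; rewrite oner_eq0.
rewrite (_ : row e P = 0) ?mul0mx//.
by apply/rowP => a; rewrite !mxE; apply/eqP; have := H a; rewrite negbK.
Qed.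

(** The spectral theorem; the eigenvalues are the values of the form on the
    eigenvectors. *)
Lemma gram_posdef n (A : 'M[C]_n) : (forall a b, A b a = (A a b)^*) ->
  (forall u : 'I_n -> C, (exists a, u a != 0) ->
     0 < \sum_a \sum_b A a b * u a * (u b)^*) -> gram A.
Proof.
move=> hA pA.
have : A \is hermsymmx.
  by apply/is_hermitianmxP; apply/matrixP => i j; rewrite expr0 scale1r !mxE hA.
move=> /hermitian_normalmx/orthomx_spectralP; set P := spectralmx A; set D := spectral_diag A.
have uP : P \is unitarymx := spectral_unitarymx A.
have uuP := unitarymx_unit uP.
rewrite invmx_unitary// => EA.
exists (fun e => D ord0 e), (map_mx conjC P); split.
- move=> e; have [a0 Pe] := unit_row_neq0 e uuP.
  have := pA (fun a => P e a) (ex_intro _ a0 Pe).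
  suff -> : \sum_a \sum_b A a b * P e a * (P e b)^* = (P *m A *m P^t*) e e.
    rewrite EA !mulmxA (unitarymxP uP) mul1mx -mulmxA (unitarymxP uP) mulmx1 mxE eqxx.
    by rewrite mulr1n.
  rewrite !mxE exchange_big; apply: eq_bigr => b _; rewrite !mxE mulr_suml.
  by apply: eq_bigr => a _; rewrite [A a b * _]mulrC.
- by rewrite map_unitmx.
- move=> a b; rewrite {1}EA mul_mx_diag !mxE; apply: eq_bigr => e _.
  by rewrite !mxE conjCK [_ * D _ _]mulrC.
Qed.

Lemma gramE n (A : 'M[C]_n) (d : 'I_n -> C) (Q : 'M[C]_n) :
  (forall a b, A a b = \sum_e d e * Q e a * (Q e b)^*) ->
  A = Q^T *m diag_mx (\row_e d e) *m map_mx conjC Q.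
Proof.
move=> H; apply/matrixP => a b; rewrite H mul_mx_diag !mxE; apply: eq_bigr => e _.
by rewrite !mxE [Q e a * _]mulrC.
Qed.

Lemma diag_unit n (d : 'I_n -> C) : (forall e, 0 < d e) -> diag_mx (\row_e d e) \in unitmx.
Proof.
move=> d0; rewrite unitmxE det_diag unitfE; apply/prodf_neq0 => e _.
by rewrite mxE gt_eqF.
Qed.

Lemma gram_unit n (A : 'M[C]_n) : gram A -> A \in unitmx.
Proof.
move=> [d [Q [d0 uQ /gramE ->]]].
by rewrite !unitmx_mul unitmx_tr uQ map_unitmx uQ diag_unit.
Qed.

Lemma gram_inv n (A : 'M[C]_n) : gram A -> gram (invmx A)^T.
Proof.
move=> /[dup] /gram_unit uA [d [Q [d0 uQ /gramE EA]]].
pose S := invmx Q^T; have uS : S \in unitmx by rewrite unitmx_inv unitmx_tr.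
exists (fun e => (d e)^-1), S; split=> //; first by move=> e; rewrite invr_gt0.
suff -> : invmx A = map_mx conjC S^T *m diag_mx (\row_e (d e)^-1) *m S.
  move=> a b; rewrite mxE mul_mx_diag !mxE; apply: eq_bigr => e _.
  by rewrite !mxE; ring.
apply: (can_inj (mulKmx uA)); rewrite mulmxV// {1}EA.
have -> : map_mx conjC S^T = invmx (map_mx conjC Q).
  by rewrite /S trmx_inv trmxK map_invmx.
rewrite -[invmx _ *m _ *m _]mulmxA (mulmxA (_ *m map_mx conjC Q)) mulmxK ?map_unitmx//.
rewrite -mulmxA [diag_mx _ *m (_ *m _)]mulmxA mulmx_diag.
rewrite (_ : diag_mx _ = 1%:M) ?mul1mx ?mulmxV ?unitmx_tr//.
rewrite -diag_const_mx; congr diag_mx; apply/rowP => e.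
by rewrite !mxE divff// gt_eqF.
Qed.

(** The last clause makes the sum of squares definite.  Arbitrary finite index types
    allow tensor products of forms of different kinds. *)
Definition sumsq_form (T : finType) (S : T -> T -> C) : Prop :=
  exists (E : finType) (d : E -> C) (Q : E -> T -> C),
  [/\ forall e, 0 < d e, forall s t, S s t = \sum_e d e * Q e s * (Q e t)^* &
      forall x : T -> C, (forall e, \sum_s Q e s * x s = 0) -> forall s, x s = 0].

Lemma gram_sumsq n (A : 'M[C]_n) : gram A -> sumsq_form (fun a b => A a b).
Proof.
move=> [d [Q [d0 uQ EA]]]; exists 'I_n, d, (fun e a => Q e a); split=> // x H s.
have E : Q *m (\col_a x a) = 0.
  apply/matrixP => e j; rewrite !mxE -[RHS](H e); apply: eq_bigr => a _; by rewrite mxE.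
have /(congr1 (mulmx (invmx Q))) := E; rewrite mulKmx// mulmx0 => /matrixP/(_ s ord0).
by rewrite !mxE.
Qed.

(** The squares of the tensor product are the products of the squares; definiteness
    is checked one factor at a time. *)
Lemma sumsq_tensor (T T' : finType) (S : T -> T -> C) (S' : T' -> T' -> C) :
  sumsq_form S -> sumsq_form S' ->
  sumsq_form (fun x y : T * T' => S x.1 y.1 * S' x.2 y.2).
Proof.
move=> [E [d [Q [d0 SE iQ]]]] [E' [d' [Q' [d'0 SE' iQ']]]].
exists (E * E')%type, (fun e => d e.1 * d' e.2), (fun e x => Q e.1 x.1 * Q' e.2 x.2); split.
- by move=> e; rewrite mulr_gt0.
- move=> x y; rewrite SE SE' big_distrlr pair_bigA /=.
  by apply: eq_bigr => e _; rewrite rmorphM; ring.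
- move=> x H [s t]; apply: (iQ' (fun t => x (s, t))) => f.
  apply: (iQ (fun s => \sum_t Q' f t * x (s, t))) => e.
  rewrite -[RHS](H (e, f)); under eq_bigr => u _ do rewrite mulr_sumr.
  by rewrite pair_bigA; apply: eq_bigr => -[u v] _ /=; rewrite mulrA.
Qed.

Lemma sumsq_eval (T : finType) (S : T -> T -> C) (x : T -> C) : sumsq_form S ->
  0 <= \sum_s \sum_t S s t * x s * (x t)^* /\
  (\sum_s \sum_t S s t * x s * (x t)^* = 0 -> forall s, x s = 0).
Proof.
move=> [E [d [Q [d0 SE iQ]]]].
have -> : \sum_s \sum_t S s t * x s * (x t)^* = \sum_e d e * `|\sum_s Q e s * x s| ^+ 2.
  transitivity (\sum_s \sum_t \sum_e d e * (Q e s * x s) * (Q e t * x t)^*).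
    apply: eq_bigr => s _; apply: eq_bigr => t _; rewrite SE !mulr_suml.
    by apply: eq_bigr => e _; rewrite rmorphM; ring.
  under eq_bigr => s _ do rewrite exchange_big.
  rewrite exchange_big; apply: eq_bigr => e _.
  rewrite normCK rmorph_sum mulrA mulr_sumr mulr_suml; apply: eq_bigr => s _.
  by rewrite mulr_sumr.
have p0 e : 0 <= d e * `|\sum_s Q e s * x s| ^+ 2.
  by rewrite mulr_ge0 ?exprn_ge0// ltW.
split; first exact: sumr_ge0.
move=> /eqP; rewrite psumr_eq0// => /allP H; apply: iQ => e.
have := H e (mem_index_enum e); rewrite mulf_eq0 gt_eqF//= expf_eq0 normr_eq0.
by move=> /andP[_ /eqP].
Qed.

End Gram.

(** * The Hermitian product on Q in degrees 0 and 1 *)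

Section SymbolAlgebra.
Variables (R : realType) (r : nat).
Local Notation C := R[i].
Local Notation midx p := {ffun 'I_p -> 'I_3}.

(** The multi-indices of (0,1)-forms and of functions. *)
Definition idx1 (l : 'I_3) : midx 1 := [ffun=> l].
Definition idx0 : midx 0 := [ffun=> ord0].

Lemma midx0E (K : midx 0) : K = idx0.
Proof. by apply/ffunP => -[]. Qed.

Lemma midx1E (K : midx 1) : K = idx1 (K ord0).
Proof. by apply/ffunP => i; rewrite ffunE ord1. Qed.

Lemma sum_midx0 (F : midx 0 -> C) : \sum_K F K = F idx0.
Proof.
rewrite (bigD1 idx0)//= big1 ?addr0// => K.
by rewrite (midx0E K) eqxx.
Qed.

Lemma sum_midx1 (F : midx 1 -> C) : \sum_K F K = \sum_k F (idx1 k).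
Proof.
rewrite (reindex idx1)//; exists (fun K : midx 1 => K ord0) => K _.
  by rewrite ffunE.
by rewrite -midx1E.
Qed.

Lemma wedge1_0 (L : lmodType C) (X : 'I_3 -> midx 0 -> L) (K : midx 1) :
  wedge1 X K = X (K ord0) idx0.
Proof. by rewrite /wedge1 big_ord1 expr0 scale1r (midx0E (fdrop _ _)). Qed.

Lemma wedge1_1 (L : lmodType C) (X : 'I_3 -> midx 1 -> L) (k l : 'I_3) (K : midx 2) :
  K ord0 = k -> K ord_max = l -> wedge1 X K = X k (idx1 l) - X l (idx1 k).
Proof.
move=> Kk Kl; rewrite /wedge1 big_ord_recl big_ord1 expr0 scale1r expr1 scaleN1r.
have -> : lift ord0 ord0 = ord_max :> 'I_2 by apply: val_inj.
rewrite Kk Kl; congr (X _ _ - X _ _); apply/ffunP => i; rewrite !ffunE ord1.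
  by rewrite -Kl; congr (K _); apply: val_inj.
by rewrite -Kk; congr (K _); apply: val_inj.
Qed.

Variables (g : 'M[C]_3) (h : 'M[C]_r).

(** The product of two elements of the fibre of Q; the product on Q^{0,p} is its
    tensor product with the metric on (0,p)-forms. *)
Definition fibre_form (k1 k2 : 'I_3 -> C) (g1 g2 : 'M[C]_r) (v1 v2 : 'I_3 -> C) : C :=
  (\sum_j \sum_k upper g j k * k1 j * (k2 k)^*) +
  (\sum_a \sum_b \sum_c \sum_d h a c * upper h b d * g1 a b * (g2 c d)^*) +
  (\sum_j \sum_k g j k * v1 j * (v2 k)^*).

Lemma Qinner0E (u v : Qfib R r 0) : Qinner g h u v =
  fibre_form (fun j => kap u j idx0) (fun j => kap v j idx0) (gam u idx0) (gam v idx0)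
    (fun j => vec u j idx0) (fun j => vec v j idx0).
Proof.
rewrite /Qinner invr1 mul1r sum_midx0 sum_midx0 big_ord0 mul1r; reflexivity.
Qed.

Lemma Qinner1E (u v : Qfib R r 1) : Qinner g h u v =
  \sum_k \sum_l upper g l k *
  fibre_form (fun j => kap u j (idx1 k)) (fun j => kap v j (idx1 l)) (gam u (idx1 k)) (gam v (idx1 l))
    (fun j => vec u j (idx1 k)) (fun j => vec v j (idx1 l)).
Proof.
rewrite /Qinner invr1 mul1r sum_midx1; apply: eq_bigr => k _.
rewrite sum_midx1; apply: eq_bigr => l _.
by rewrite big_ord1 !ffunE.
Qed.

Hypotheses (hg : hermitian_posdef g) (hh : hermitian_posdef h).

Lemma posdef_gram n (A : 'M[C]_n) : hermitian_posdef A -> gram A.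
Proof. by move=> [h1 h2]; exact: gram_posdef. Qed.

Lemma posdef_unit n (A : 'M[C]_n) : hermitian_posdef A -> A \in unitmx.
Proof. by move=> /posdef_gram/gram_unit. Qed.

Lemma upper_sumsq n (A : 'M[C]_n) : hermitian_posdef A -> sumsq_form (upper A).
Proof.
move=> /posdef_gram/gram_inv/gram_sumsq [E [d [Q [H1 H2 H3]]]].
by exists E, d, Q; split=> // s t; rewrite /upper -H2 mxE.
Qed.

Lemma upper_conj n (A : 'M[C]_n) a b : hermitian_posdef A -> (upper A a b)^*%R = upper A b a.
Proof.
move=> /upper_sumsq [E [d [Q [H1 H2 _]]]]; rewrite !H2 rmorph_sum; apply: eq_bigr => e _.
rewrite !rmorphM /= conjCK (CrealP _); last by rewrite gtr0_real.
by rewrite mulrAC.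
Qed.

Lemma sum4 (T : finType) (F : T -> T -> T -> T -> C) :
  \sum_a \sum_b \sum_c \sum_d F a b c d = \sum_(x : T * T) \sum_(y : T * T) F x.1 x.2 y.1 y.2.
Proof.
by rewrite pair_bigA; apply: eq_bigr => x _; rewrite pair_bigA.
Qed.

Lemma fibre_form_pos k1 g1 v1 : 0 <= fibre_form k1 k1 g1 g1 v1 v1 /\
  (fibre_form k1 k1 g1 g1 v1 v1 = 0 ->
   [/\ forall j, k1 j = 0, g1 = 0 & forall j, v1 j = 0]).
Proof.
have [p1 e1] := sumsq_eval k1 (upper_sumsq hg).
have [p3 e3] := sumsq_eval v1 (gram_sumsq (posdef_gram hg)).
have [p2 e2] := sumsq_eval (fun x : 'I_r * 'I_r => g1 x.1 x.2)
   (sumsq_tensor (gram_sumsq (posdef_gram hh)) (upper_sumsq hh)).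
rewrite /fibre_form sum4.
split; first by rewrite !addr_ge0.
move=> /eqP; rewrite paddr_eq0 ?addr_ge0// paddr_eq0// => /andP[/andP[/eqP E1 /eqP E2] /eqP E3].
split; [exact: e1| |exact: e3].
by apply/matrixP => a b; rewrite mxE (e2 E2 (a, b)).
Qed.

(** The product on Q^{0,1} is a sum of three tensor products of definite forms. *)
Lemma Qinner1_eq0 (u : Qfib R r 1) : Qinner g h u u = 0 -> u = 0.
Proof.
pose U k l := upper g l k.
have sU : sumsq_form U.
  have [E [d [Q [H1 H2 H3]]]] := upper_sumsq hg.
  exists E, d, (fun e s => (Q e s)^*%R); split=> //.
    by move=> s t; rewrite /U H2; apply: eq_bigr => e _; rewrite conjCK mulrAC.
  move=> x Hx s; apply: (can_inj conjCK); rewrite rmorph0.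
  apply: (H3 (fun s => (x s)^*%R)) => e; apply: (can_inj conjCK).
  by rewrite rmorph0 rmorph_sum -[RHS](Hx e); apply: eq_bigr => i _; rewrite rmorphM /= conjCK.
have [p1 e1] := sumsq_eval (fun x : 'I_3 * 'I_3 => kap u x.2 (idx1 x.1))
   (sumsq_tensor sU (upper_sumsq hg)).
have [p3 e3] := sumsq_eval (fun x : 'I_3 * 'I_3 => vec u x.2 (idx1 x.1))
   (sumsq_tensor sU (gram_sumsq (posdef_gram hg))).
have [p2 e2] := sumsq_eval (fun x : 'I_3 * ('I_r * 'I_r) => gam u (idx1 x.1) x.2.1 x.2.2)
   (sumsq_tensor sU (sumsq_tensor (gram_sumsq (posdef_gram hh)) (upper_sumsq hh))).
have swap (T : finType) (S : T -> T -> C) (x : 'I_3 -> T -> C) :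
    \sum_k \sum_l upper g l k * (\sum_s \sum_t S s t * x k s * (x l t)^*%R) =
    \sum_(p : 'I_3 * T) \sum_(q : 'I_3 * T) U p.1 q.1 * S p.2 q.2 * x p.1 p.2 * (x q.1 q.2)^*%R.
  rewrite -(pair_bigA _ (fun k s => \sum_(q : 'I_3 * T) U k q.1 * S s q.2 * x k s * (x q.1 q.2)^*%R)) /=.
  apply: eq_bigr => k _.
  under [RHS]eq_bigr => s _ do rewrite -(pair_bigA _ (fun l t => U k l * S s t * x k s * (x l t)^*%R)) /=.
  rewrite [RHS]exchange_big; apply: eq_bigr => l _; rewrite mulr_sumr; apply: eq_bigr => s _.
  by rewrite mulr_sumr; apply: eq_bigr => t _; rewrite /U !mulrA.
rewrite Qinner1E /fibre_form.
under eq_bigr => k _ do under eq_bigr => l _ do rewrite sum4 !mulrDr.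
under eq_bigr => k _ do rewrite !big_split /=.
rewrite !big_split /= (swap _ _ (fun k j => kap u j (idx1 k))) (swap _ _ (fun k j => vec u j (idx1 k))).
rewrite (swap _ (fun x y : 'I_r * 'I_r => h x.1 y.1 * upper h x.2 y.2) (fun k x => gam u (idx1 k) x.1 x.2)).
move=> /eqP; rewrite paddr_eq0 ?addr_ge0// paddr_eq0// => /andP[/andP[/eqP E1 /eqP E2] /eqP E3].
case: u e1 e2 e3 E1 E2 E3 {p1 p2 p3} => -[u1 u2] u3 e1 e2 e3 E1 E2 E3.
congr (_, _, _).
- by apply/ffunP => -[j K]; rewrite ffunE (midx1E K); exact: (e1 E1 (K ord0, j)).
- apply/ffunP => K; rewrite ffunE (midx1E K); apply/matrixP => a b; rewrite mxE.
  exact: (e2 E2 (K ord0, (a, b))).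
- by apply/ffunP => -[j K]; rewrite ffunE (midx1E K); exact: (e3 E3 (K ord0, j)).
Qed.

End SymbolAlgebra.

(** * The symbol of the deformation operator and its adjoint *)

Section SymbolAdjoint.
Variables (R : realType) (r : nat).
Local Notation C := R[i].
Local Notation midx p := {ffun 'I_p -> 'I_3}.
Variables (g : 'M[C]_3) (h : 'M[C]_r).
Variables (al : C) (th thb : 'I_3 -> C) (Rm rc : 'I_3 -> 'I_3 -> 'I_3 -> 'I_3 -> C).

(** The symbol of the deformation operator at a covector with components th, thb of
    type (1,0) and (0,1); Rm k j l m stands for the component R_{\bar k j}{}^l{}_m
    and rc for the same component of the conjugate connection. *)
Definition symbol_Dbar (p : nat) (e : Qfib R r p) : Qfib R r p.+1 :=
  ([ffun jK => wedge1 (fun k (L : midx p) =>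
       thb k * kap e jK.1 L + al * \sum_m \sum_n
         Rm k jK.1 m n * th m * vec e n L) jK.2],
    [ffun K => wedge1 (fun k (L : midx p) => thb k *: gam e L) K],
    [ffun jK => wedge1 (fun k (L : midx p) => thb k * vec e jK.1 L) jK.2]).

Definition symbol_Dbar_adj (e : Qfib R r 1) : Qfib R r 0 :=
   ([ffun jK => \sum_q \sum_k
       upper g q k * (thb q)^*%R * kap e jK.1 (idx1 k)],
    [ffun _ => \sum_q \sum_k (upper g q k * (thb q)^*%R) *: gam e (idx1 k)],
    [ffun jK =>
       - al * (\sum_n \sum_a \sum_b \sum_j \sum_l \sum_m
           upper g jK.1 n * upper g a j * upper g l b *
           rc j l m n * (th m)^*%R * kap e a (idx1 b))
       + \sum_q \sum_k upper g q k * (thb q)^*%R * vec e jK.1 (idx1 k)]).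

Hypotheses (hg : hermitian_posdef g) (hh : hermitian_posdef h).
Hypotheses (hal : al^*%R = al) (hrc : forall j l m n, rc j l m n = - (Rm l j m n)^*%R).

Lemma exch4 (S T : finType) (F : S -> S -> T -> T -> C) :
  \sum_k \sum_l \sum_x \sum_y F k l x y = \sum_x \sum_y \sum_k \sum_l F k l x y.
Proof.
rewrite pair_bigA /=.
under eq_bigr => p _ do rewrite pair_bigA /=.
rewrite exchange_big /= -(pair_bigA _ (fun x y => \sum_p F p.1 p.2 x y)) /=.
by apply: eq_bigr => x _; apply: eq_bigr => y _; rewrite pair_bigA.
Qed.

(** Contraction with thb is adjoint to tensoring with thb, whatever form P is used on
    the coefficient fibre. *)
Lemma contraction_adjoint (T : finType) (P : T -> T -> C) (a : T -> C) (z : T -> 'I_3 -> C) :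
  \sum_k \sum_l upper g l k * (\sum_x \sum_y P x y * (thb k * a x) * (z y l)^*%R) =
  \sum_x \sum_y P x y * a x * (\sum_q \sum_k upper g q k * (thb q)^*%R * z y k)^*%R.
Proof.
transitivity (\sum_k \sum_l \sum_x \sum_y P x y * a x * (upper g l k * thb k * (z y l)^*%R)).
  apply: eq_bigr => k _; apply: eq_bigr => l _; rewrite mulr_sumr; apply: eq_bigr => x _.
  by rewrite mulr_sumr; apply: eq_bigr => y _; ring.
rewrite exch4; apply: eq_bigr => x _; apply: eq_bigr => y _.
rewrite rmorph_sum mulr_sumr; apply: eq_bigr => q _; rewrite rmorph_sum mulr_sumr.
by apply: eq_bigr => k _; rewrite !rmorphM /= conjCK (upper_conj _ _ hg).
Qed.

Lemma gl_upper a b : \sum_s g a s * upper g b s = (a == b)%:R.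
Proof.
have := mulmxV (posdef_unit hg) => /matrixP/(_ a b); rewrite !mxE => <-.
by apply: eq_bigr.
Qed.

(* R and th contracted with the conjugate of kappa *)
Let Tn (e : Qfib R r 1) n := \sum_a \sum_b \sum_j \sum_l \sum_m
   upper g j a * upper g b l * Rm l j m n * th m * (kap e a (idx1 b))^*%R.

(** The adjoint is taken in W, so the index of W is lowered by g and raised back:
    [gl_upper] removes the pair. *)
Lemma curvature_adjoint (w : 'I_3 -> C) (e : Qfib R r 1) :
  \sum_k \sum_l upper g l k * (\sum_i \sum_j upper g i j *
     (al * \sum_m \sum_n Rm k i m n * th m * w n) * (kap e j (idx1 l))^*%R) =
  \sum_s' \sum_s g s' s * w s' *
    (- al * (\sum_n \sum_a \sum_b \sum_j \sum_l \sum_m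
           upper g s n * upper g a j * upper g l b *
           rc j l m n * (th m)^*%R * kap e a (idx1 b)))^*%R.
Proof.
transitivity (al * \sum_n w n * Tn e n).
  transitivity (\sum_k \sum_l \sum_i \sum_j \sum_m \sum_n
    al * w n * (upper g i j * upper g l k * Rm k i m n * th m * (kap e j (idx1 l))^*%R)).
    apply: eq_bigr => k _; apply: eq_bigr => l _; rewrite mulr_sumr; apply: eq_bigr => i _.
    rewrite mulr_sumr; apply: eq_bigr => j _.
    rewrite !mulr_sumr mulr_suml mulr_sumr; apply: eq_bigr => m _.
    rewrite !mulr_sumr mulr_suml mulr_sumr; apply: eq_bigr => n _; ring.
  transitivity (\sum_n \sum_a \sum_b \sum_j \sum_l \sum_m
    al * w n * (upper g j a * upper g b l * Rm l j m n * th m * (kap e a (idx1 b))^*%R)).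
    rewrite !pair_bigA /=.
    (* (k, l, i, j, m, n) on the left is (l, b, j, a, m, n) on the right *)
    rewrite (reindex (fun x : 'I_3 * 'I_3 * 'I_3 * 'I_3 * 'I_3 * 'I_3 =>
      (x.1.2, x.1.1.1.2, x.1.1.2, x.1.1.1.1.2, x.2, x.1.1.1.1.1))) //=.
    by exists (fun x : 'I_3 * 'I_3 * 'I_3 * 'I_3 * 'I_3 * 'I_3 =>
      (x.2, x.1.1.2, x.1.1.1.1.2, x.1.1.1.2, x.1.1.1.1.1, x.1.2)) => -[[[[[a b] c] d] ee] f] _.
  rewrite mulr_sumr; apply: eq_bigr => n _; rewrite mulrA /Tn.
  rewrite mulr_sumr; apply: eq_bigr => a _; rewrite mulr_sumr; apply: eq_bigr => b _.
  rewrite mulr_sumr; apply: eq_bigr => j _; rewrite mulr_sumr; apply: eq_bigr => l _.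
  by rewrite mulr_sumr.
have E s : (- al * (\sum_n \sum_a \sum_b \sum_j \sum_l \sum_m
           upper g s n * upper g a j * upper g l b *
           rc j l m n * (th m)^*%R * kap e a (idx1 b)))^*%R = al * \sum_n upper g n s * Tn e n.
  rewrite mulNr rmorphN rmorphM /= hal -mulrN; congr (_ * _).
  rewrite rmorph_sum -sumrN; apply: eq_bigr => n _; rewrite /Tn.
  rewrite rmorph_sum -sumrN mulr_sumr; apply: eq_bigr => a _.
  rewrite rmorph_sum -sumrN mulr_sumr; apply: eq_bigr => b _.
  rewrite rmorph_sum -sumrN mulr_sumr; apply: eq_bigr => j _.
  rewrite rmorph_sum -sumrN mulr_sumr; apply: eq_bigr => l _.
  rewrite rmorph_sum -sumrN mulr_sumr; apply: eq_bigr => m _.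
  by rewrite !rmorphM /= hrc rmorphN /= !conjCK !(upper_conj _ _ hg); ring.
under [RHS]eq_bigr => s' _ do under eq_bigr => s _ do rewrite E mulr_sumr mulr_sumr.
under [RHS]eq_bigr => s' _ do rewrite exchange_big /=.
rewrite mulr_sumr; rewrite [RHS]exchange_big /=; apply: eq_bigr => n _.
transitivity (\sum_s' al * w s' * Tn e n * \sum_s g s' s * upper g n s).
  rewrite (bigD1 n)//= gl_upper eqxx mulr1 big1 ?addr0 ?mulrA// => s' sn.
  by rewrite gl_upper (negbTE sn) mulr0.
apply: eq_bigr => s' _; rewrite mulr_sumr; apply: eq_bigr => s _; ring.
Qed.

Lemma symbol_Dbar_adjoint (u : Qfib R r 0) (e : Qfib R r 1) :
  Qinner g h (symbol_Dbar u) e = Qinner g h u (symbol_Dbar_adj e).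
Proof.
rewrite Qinner0E Qinner1E.
transitivity (\sum_k \sum_l
   (upper g l k * (\sum_i \sum_j upper g i j * (thb k * kap u i (idx0)) * (kap e j (idx1 l))^*%R) +
    upper g l k * (\sum_i \sum_j upper g i j *
     (al * \sum_m \sum_n Rm k i m n * th m * vec u n idx0) * (kap e j (idx1 l))^*%R) +
    upper g l k * (\sum_(x : 'I_r * 'I_r) \sum_(y : 'I_r * 'I_r) (h x.1 y.1 * upper h x.2 y.2) *
      (thb k * gam u idx0 x.1 x.2) * (gam e (idx1 l) y.1 y.2)^*%R) +
    upper g l k * (\sum_i \sum_j g i j * (thb k * vec u i idx0) * (vec e j (idx1 l))^*%R))).
  apply: eq_bigr => k _; apply: eq_bigr => l _; rewrite -!mulrDr; congr (_ * _).
  rewrite /fibre_form sum4; congr (_ + _ + _).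
  - rewrite -big_split; apply: eq_bigr => i _; rewrite -big_split; apply: eq_bigr => j _ /=.
    by rewrite -mulrDl -mulrDr /kap !ffunE /= wedge1_0 !ffunE.
  - apply: eq_bigr => x _; apply: eq_bigr => y _.
    by rewrite {1}/gam /symbol_Dbar /= ffunE wedge1_0 !ffunE !mxE.
  - apply: eq_bigr => i _; apply: eq_bigr => j _.
    by rewrite {1}/vec /symbol_Dbar /= ffunE wedge1_0 !ffunE.
under eq_bigr => k _ do rewrite !big_split /=.
rewrite !big_split /=.
rewrite (contraction_adjoint (upper g) (fun i => kap u i idx0) (fun j l => kap e j (idx1 l))).
rewrite (contraction_adjoint g (fun i => vec u i idx0) (fun j l => vec e j (idx1 l))).
rewrite (contraction_adjoint (fun x y => h x.1 y.1 * upper h x.2 y.2)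
  (fun x => gam u idx0 x.1 x.2) (fun y l => gam e (idx1 l) y.1 y.2)).
rewrite curvature_adjoint /fibre_form sum4.
rewrite -!addrA; congr (_ + _).
  apply: eq_bigr => i _; apply: eq_bigr => j _; rewrite {4}/kap /symbol_Dbar_adj /= ffunE //=.
rewrite addrCA; congr (_ + _).
  apply: eq_bigr => x _; apply: eq_bigr => y _; congr (_ * _^*%R).
  rewrite /gam /symbol_Dbar_adj /= ffunE summxE; apply: eq_bigr => q _; rewrite summxE.
  by apply: eq_bigr => k _; rewrite mxE.
rewrite -big_split; apply: eq_bigr => i _; rewrite -big_split; apply: eq_bigr => j _ /=.
by rewrite -mulrDr -rmorphD /=; congr (_ * _^*%R); rewrite [RHS]/vec /symbol_Dbar_adj /= ffunE.
Qed.

(** Division by thb.  On gamma and W the symbol is the wedge product with thb, so both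
    are multiples of thb, with the factor read off from the component k0.  For
    W = thb w the curvature term is thb times [A], and kappa - A is again a
    multiple of thb. *)
Lemma symbol_Dbar_exact (e : Qfib R r 1) : (exists k, thb k != 0) -> symbol_Dbar e = 0 ->
  exists u : Qfib R r 0, e = symbol_Dbar u.
Proof.
move=> [k0 t0] se.
pose K k l : midx 2 := [ffun i => if i == ord0 then k else l].
have K0 k l : K k l ord0 = k by rewrite ffunE eqxx.
have K1 k l : K k l ord_max = l by rewrite ffunE.
have Eg k l : thb k *: gam e (idx1 l) = thb l *: gam e (idx1 k).
  apply/eqP; rewrite -subr_eq0; apply/eqP.
  have /(congr1 (fun s => gam s (K k l))) := se.
  by rewrite /gam /symbol_Dbar /= !ffunE (wedge1_1 _ (K0 k l) (K1 k l)).
have Ev j k l : thb k * vec e j (idx1 l) = thb l * vec e j (idx1 k).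
  apply/eqP; rewrite -subr_eq0; apply/eqP.
  have /(congr1 (fun s => vec s j (K k l))) := se.
  by rewrite /vec /symbol_Dbar /= !ffunE (wedge1_1 _ (K0 k l) (K1 k l)).
pose w n := (thb k0)^-1 * vec e n (idx1 k0).
have Ew n l : vec e n (idx1 l) = thb l * w n.
  by rewrite /w mulrCA -Ev mulKf.
pose A k j := al * \sum_m \sum_n Rm k j m n * th m * w n.
have EA k j l : al * (\sum_m \sum_n Rm k j m n * th m * vec e n (idx1 l)) = thb l * A k j.
  rewrite /A mulrCA; congr (_ * _); rewrite mulr_sumr; apply: eq_bigr => m _.
  by rewrite mulr_sumr; apply: eq_bigr => n _; rewrite Ew; ring.
have Ek j k l : thb k * (kap e j (idx1 l) - A l j) = thb l * (kap e j (idx1 k) - A k j).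
  apply/eqP; rewrite -subr_eq0; apply/eqP.
  have /(congr1 (fun s => kap s j (K k l))) := se.
  rewrite /kap /symbol_Dbar /= !ffunE (wedge1_1 _ (K0 k l) (K1 k l)) -/(kap e j _) -/(kap e j _) => E.
  rewrite -[RHS]E /= !EA; ring.
exists ([ffun jK => (thb k0)^-1 * (kap e jK.1 (idx1 k0) - A k0 jK.1)],
   [ffun _ => (thb k0)^-1 *: gam e (idx1 k0)], [ffun jK => w jK.1]).
rewrite /symbol_Dbar; case: e se Eg Ev @w Ew @A EA Ek => -[e1 e2] e3 se Eg Ev w Ew A EA Ek.
congr (_, _, _).
- apply/ffunP => -[j L]; rewrite !ffunE /= wedge1_0 (midx1E L) /kap /= !ffunE /=.
  have -> : al * (\sum_m \sum_n Rm (L ord0) j m n * th m *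
     vec ([ffun jK : 'I_3 * midx 0 => (thb k0)^-1 * (e1 (jK.1, idx1 k0) - A k0 jK.1)],
   [ffun _ : midx 0 => (thb k0)^-1 *: gam (e1, e2, e3) (idx1 k0)], [ffun jK => w jK.1]) n idx0) = A (L ord0) j.
    congr (_ * _); apply: eq_bigr => m _; apply: eq_bigr => n _.
    by rewrite /vec /= ffunE.
  by have /= := Ek j k0 (L ord0); rewrite /kap /= mulrCA => <-; rewrite mulKf// subrK.
- apply/ffunP => L; rewrite !ffunE wedge1_0 (midx1E L) /gam /= !ffunE.
  have /= := Eg k0 (L ord0); rewrite /gam /= => E.
  by rewrite scalerA mulrC -scalerA -E scalerA mulVf// scale1r.
- apply/ffunP => -[j L]; rewrite !ffunE /= wedge1_0 (midx1E L) /vec /= !ffunE /=.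
  by have /= := Ew j (L ord0); rewrite /vec.
Qed.

(** < sigma u, sigma u > = < u, sigma^* sigma u > = 0. *)
Lemma symbol_Dbar_kernel (e : Qfib R r 1) : (exists k, thb k != 0) ->
  symbol_Dbar e = 0 -> symbol_Dbar_adj e = 0 -> e = 0.
Proof.
move=> t0 s0 a0; apply: (Qinner1_eq0 hg hh).
have [u eu] := symbol_Dbar_exact t0 s0.
rewrite {1}eu symbol_Dbar_adjoint a0 Qinner0E /fibre_form.
rewrite !big1 ?addr0//.
- by move=> i _; rewrite big1// => j _; rewrite /vec !ffunE rmorph0 mulr0.
- move=> a _; rewrite big1// => b _; rewrite big1// => c _; rewrite big1// => d _.
  by rewrite [gam 0 _]ffunE mxE rmorph0 mulr0.
- by move=> i _; rewrite big1// => j _; rewrite /kap !ffunE rmorph0 mulr0.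
Qed.

End SymbolAdjoint.

Section SymbolLinear.
Variables (R : realType) (r : nat).
Local Notation C := R[i].
Local Notation midx p := {ffun 'I_p -> 'I_3}.

Lemma kapB p (e e' : Qfib R r p) j K : kap (e - e') j K = kap e j K - kap e' j K.
Proof. by rewrite /kap !ffunE. Qed.
Lemma gamB p (e e' : Qfib R r p) K : gam (e - e') K = gam e K - gam e' K.
Proof. by rewrite /gam !ffunE. Qed.
Lemma vecB p (e e' : Qfib R r p) j K : vec (e - e') j K = vec e j K - vec e' j K.
Proof. by rewrite /vec !ffunE. Qed.
Lemma kapD p (e e' : Qfib R r p) j K : kap (e + e') j K = kap e j K + kap e' j K.
Proof. by rewrite /kap !ffunE. Qed.
Lemma gamD p (e e' : Qfib R r p) K : gam (e + e') K = gam e K + gam e' K.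
Proof. by rewrite /gam !ffunE. Qed.
Lemma vecD p (e e' : Qfib R r p) j K : vec (e + e') j K = vec e j K + vec e' j K.
Proof. by rewrite /vec !ffunE. Qed.
Lemma kapZ p c (e : Qfib R r p) j K : kap (c *: e) j K = c * kap e j K.
Proof. by rewrite /kap !ffunE. Qed.
Lemma gamZ p c (e : Qfib R r p) K : gam (c *: e) K = c *: gam e K.
Proof. by rewrite /gam !ffunE. Qed.
Lemma vecZ p c (e : Qfib R r p) j K : vec (c *: e) j K = c * vec e j K.
Proof. by rewrite /vec !ffunE. Qed.

Lemma QfibP p (e e' : Qfib R r p) : (forall j K, kap e j K = kap e' j K) ->
  (forall K, gam e K = gam e' K) -> (forall j K, vec e j K = vec e' j K) -> e = e'.
Proof.
case: e e' => [[e1 e2] e3] [[f1 f2] f3] H1 H2 H3; congr (_, _, _).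
- by apply/ffunP => -[j K]; exact: H1.
- by apply/ffunP => K; exact: H2.
- by apply/ffunP => -[j K]; exact: H3.
Qed.

Lemma wedge1B (L : lmodType C) p (X Y : 'I_3 -> midx p -> L) K :
  wedge1 (fun k M => X k M - Y k M) K = wedge1 X K - wedge1 Y K.
Proof. by rewrite /wedge1 -sumrB; apply: eq_bigr => a _; rewrite scalerBr. Qed.

Lemma wedge1_eq (L : lmodType C) p (X Y : 'I_3 -> midx p -> L) K :
  (forall k M, X k M = Y k M) -> wedge1 X K = wedge1 Y K.
Proof. by move=> H; apply: eq_bigr => a _; rewrite H. Qed.

Lemma wedge1Z (L : lmodType C) p c (X : 'I_3 -> midx p -> L) K :
  wedge1 (fun k M => c *: X k M) K = c *: wedge1 X K.
Proof. by rewrite /wedge1 scaler_sumr; apply: eq_bigr => a _; rewrite !scalerA mulrC. Qed.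

Variables (al : C) (th thb : 'I_3 -> C) (Rm : 'I_3 -> 'I_3 -> 'I_3 -> 'I_3 -> C).

Lemma symbol_DbarB p (e e' : Qfib R r p) :
  symbol_Dbar al th thb Rm (e - e') = symbol_Dbar al th thb Rm e - symbol_Dbar al th thb Rm e'.
Proof.
apply: QfibP => [j K|K|j K]; rewrite ?kapB ?gamB ?vecB /kap /gam /vec /= !ffunE -wedge1B;
  apply: wedge1_eq => k M.
- rewrite -!/(kap _ _ _) kapB opprD addrACA -mulrBr; congr (_ + _).
  rewrite -mulrBr -sumrB; congr (_ * _); apply: eq_bigr => m _; rewrite -sumrB.
  by apply: eq_bigr => n _; rewrite vecB mulrBr.
- by rewrite -!/(gam _ _) gamB scalerBr.
- by rewrite -!/(vec _ _ _) vecB mulrBr.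
Qed.

Lemma symbol_Dbar_adjB (g : 'M[C]_3) rc (e e' : Qfib R r 1) :
  symbol_Dbar_adj g al th thb rc (e - e') = symbol_Dbar_adj g al th thb rc e - symbol_Dbar_adj g al th thb rc e'.
Proof.
apply: QfibP => [j K|K|j K]; rewrite ?kapB ?gamB ?vecB /kap /gam /vec /= !ffunE.
- rewrite -sumrB; apply: eq_bigr => q _; rewrite -sumrB; apply: eq_bigr => k _.
  by rewrite -!/(kap _ _ _) kapB mulrBr.
- rewrite -sumrB; apply: eq_bigr => q _; rewrite -sumrB; apply: eq_bigr => k _.
  by rewrite -!/(gam _ _) gamB scalerBr.
- rewrite opprD addrACA; congr (_ + _); last first.
    rewrite -sumrB; apply: eq_bigr => q _; rewrite -sumrB; apply: eq_bigr => k _.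
    by rewrite -!/(vec _ _ _) vecB mulrBr.
  rewrite -mulrBr; congr (_ * _).
  rewrite -sumrB; apply: eq_bigr => n _; rewrite -sumrB; apply: eq_bigr => a _.
  rewrite -sumrB; apply: eq_bigr => b _; rewrite -sumrB; apply: eq_bigr => j' _.
  rewrite -sumrB; apply: eq_bigr => l _; rewrite -sumrB; apply: eq_bigr => m _.
  by rewrite -!/(kap _ _ _) kapB mulrBr.
Qed.

End SymbolLinear.

(** * Change of frame in the fibres of Q *)

Section Pull.
Variables (R : realType) (r p : nat).
Local Notation C := R[i].
Local Notation midx p := {ffun 'I_p -> 'I_3}.
Implicit Types (J : 'M[C]_3) (T : 'M[C]_r) (e : Qfib R r p) (K L M : midx p).

Lemma conj_jacM J J' K L :
  conj_jac (J *m J') K L = \sum_M conj_jac J K M * conj_jac J' M L.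
Proof.
rewrite /conj_jac.
under [RHS]eq_bigr => M _ do rewrite -big_split /=.
rewrite -(bigA_distr_bigA (fun c m => (J (K c) m)^*%R * (J' m (L c))^*%R)).
apply: eq_bigr => c _; rewrite mxE rmorph_sum; apply: eq_bigr => m _.
by rewrite rmorphM.
Qed.

Lemma conj_jac1 K L : conj_jac (1%:M : 'M[C]_3) K L = (K == L)%:R.
Proof.
rewrite /conj_jac; have [->|KL] := eqVneq K L.
  by rewrite big1// => c _; rewrite mxE eqxx rmorph1.
have [c Kc] : exists c, K c != L c.
  apply/existsP; apply: contra_neqT KL; rewrite negb_exists => /forallP H.
  by apply/ffunP => c; apply/eqP; have := H c; rewrite negbK.
by rewrite (bigD1 c)//= mxE (negbTE Kc) rmorph0 mul0r.
Qed.

Definition perm_idx (t : 'S_p) K : midx p := [ffun a => K (t a)].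

Lemma conj_jac_perm J (t : 'S_p) K L :
  conj_jac J (perm_idx t K) (perm_idx t L) = conj_jac J K L.
Proof.
rewrite /conj_jac [RHS](reindex_inj (@perm_inj _ t)).
by apply: eq_bigr => c _; rewrite !ffunE.
Qed.

Lemma perm_idx_bij (t : 'S_p) : bijective (perm_idx t).
Proof.
exists (perm_idx t^-1) => K; apply/ffunP => a; rewrite !ffunE ?permK ?permKV//.
Qed.

(** The components in the frame of one chart of an element whose components in
    another chart are e; J is the Jacobian and T the transition matrix of E from the
    first chart to the second. *)
Definition pull J T e : Qfib R r p :=
  ([ffun bL => \sum_a \sum_K J a bL.1 * conj_jac J K bL.2 * kap e a K],
   [ffun L => invmx T *m (\sum_K conj_jac J K L *: gam e K) *m T],
   [ffun bL => \sum_a invmx J bL.1 a * \sum_K conj_jac J K bL.2 * vec e a K]).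

Lemma kap_pull J T e b L : kap (pull J T e) b L = \sum_a \sum_K J a b * conj_jac J K L * kap e a K.
Proof. by rewrite /kap /= ffunE. Qed.
Lemma gam_pull J T e L : gam (pull J T e) L = invmx T *m (\sum_K conj_jac J K L *: gam e K) *m T.
Proof. by rewrite /gam /= ffunE. Qed.
Lemma vec_pull J T e b L : vec (pull J T e) b L =
  \sum_a invmx J b a * \sum_K conj_jac J K L * vec e a K.
Proof. by rewrite /vec /= ffunE. Qed.

Lemma pull_rule J T e e' : J \in unitmx -> T \in unitmx ->
  e = pull J T e' <->
  [/\ forall b L, kap e b L = \sum_a \sum_K J a b * conj_jac J K L * kap e' a K,
      forall L, T *m gam e L = (\sum_K conj_jac J K L *: gam e' K) *m T &
      forall a L, \sum_b J a b * vec e b L = \sum_K conj_jac J K L * vec e' a K].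
Proof.
move=> uJ uT; split=> [->|[H1 H2 H3]].
  split=> [b L|L|a L]; first by rewrite kap_pull.
    by rewrite gam_pull -mulmxA mulKVmx.
  under eq_bigr => b _ do rewrite vec_pull mulr_sumr.
  rewrite exchange_big /=.
  under eq_bigr => c _ do (under eq_bigr => b _ do rewrite mulrA; rewrite -mulr_suml).
  have E c : \sum_b J a b * invmx J b c = (a == c)%:R.
    by have /matrixP/(_ a c) := mulmxV uJ; rewrite !mxE.
  rewrite (bigD1 a)//= E eqxx mul1r [X in _ + X]big1 ?addr0// => c ca.
  by rewrite E eq_sym (negbTE ca) mul0r.
apply: QfibP => [b L|L|b L]; first by rewrite kap_pull.
  by rewrite gam_pull -mulmxA -H2 mulKmx.
rewrite vec_pull; under eq_bigr => a _ do rewrite -H3 mulr_sumr.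
rewrite exchange_big /=.
under eq_bigr => c _ do (under eq_bigr => a _ do rewrite mulrA; rewrite -mulr_suml).
have E c : \sum_a invmx J b a * J a c = (b == c)%:R.
  by have /matrixP/(_ b c) := mulVmx uJ; rewrite !mxE.
rewrite (bigD1 b)//= E eqxx mul1r [X in _ + X]big1 ?addr0// => c ca.
by rewrite E eq_sym (negbTE ca) mul0r.
Qed.

Lemma pullZ J T c e : pull J T (c *: e) = c *: pull J T e.
Proof.
apply: QfibP => [b L|L|b L]; rewrite ?kapZ ?gamZ ?vecZ ?kap_pull ?gam_pull ?vec_pull.
- rewrite mulr_sumr; apply: eq_bigr => a _; rewrite mulr_sumr; apply: eq_bigr => K _.
  by rewrite kapZ mulrCA.
- rewrite scalemxAl scalemxAr scaler_sumr; congr (_ *m _ *m _); apply: eq_bigr => K _.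
  by rewrite gamZ !scalerA mulrC.
- rewrite mulr_sumr; apply: eq_bigr => a _; rewrite mulrCA; congr (_ * _).
  by rewrite mulr_sumr; apply: eq_bigr => K _; rewrite vecZ mulrCA.
Qed.

Lemma pull1 e : pull 1%:M 1%:M e = e.
Proof.
symmetry; apply/pull_rule; rewrite ?unitmx1//; split=> [b L|L|a L].
- rewrite (bigD1 b)//= [X in _ + X]big1 ?addr0 => [|a ab]; last first.
    by rewrite big1// => K _; rewrite mxE (negbTE ab) !mul0r.
  rewrite (bigD1 L)//= big1 ?addr0 => [|K KL]; rewrite conj_jac1 mxE eqxx ?eqxx ?mul1r//.
  by rewrite (negbTE KL) mul0r.
- rewrite mul1mx mulmx1 (bigD1 L)//= conj_jac1 eqxx scale1r big1 ?addr0// => K KL.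
  by rewrite conj_jac1 (negbTE KL) scale0r.
- transitivity (vec e a L).
    rewrite (bigD1 a)//= mxE eqxx mul1r big1 ?addr0// => b ba.
    by rewrite mxE eq_sym (negbTE ba) mul0r.
  rewrite (bigD1 L)//= conj_jac1 eqxx mul1r big1 ?addr0// => K KL.
  by rewrite conj_jac1 (negbTE KL) mul0r.
Qed.

(** Together with the cocycle rules for J and T this makes the components of a
    section in three charts compatible. *)
Lemma pullM J J' T T' e : J \in unitmx -> J' \in unitmx -> T \in unitmx -> T' \in unitmx ->
  pull (J *m J') (T *m T') e = pull J' T' (pull J T e).
Proof.
move=> uJ uJ' uT uT'; symmetry; apply/pull_rule; rewrite ?unitmx_mul ?uJ ?uT//.
have [_ _ H3] := (pull_rule (pull J' T' (pull J T e)) (pull J T e) uJ' uT').1 erefl.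
have [_ _ H3'] := (pull_rule (pull J T e) e uJ uT).1 erefl.
split=> [b L|L|a L].
- rewrite kap_pull.
  under eq_bigr => a _ do under eq_bigr => K _ do rewrite kap_pull mulr_sumr.
  under eq_bigr => a _ do under eq_bigr => K _ do under eq_bigr => c _ do rewrite mulr_sumr.
  under [RHS]eq_bigr => a _ do under eq_bigr => K _ do rewrite mxE conj_jacM big_distrlr mulr_suml.
  under [RHS]eq_bigr => a _ do under eq_bigr => K _ do under eq_bigr => c _ do rewrite mulr_suml.
  rewrite !pair_bigA /=.
  rewrite (reindex (fun x : 'I_3 * midx p * 'I_3 * midx p => (x.1.2, x.2, x.1.1.1, x.1.1.2))) /=.
    by apply: eq_bigr => x _; ring.
  by exists (fun x : 'I_3 * midx p * 'I_3 * midx p => (x.1.2, x.2, x.1.1.1, x.1.1.2)) => -[[[a b'] c] d] _.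
- rewrite gam_pull -[T *m T' *m _]mulmxA [T' *m _]mulmxA mulKVmx//.
  rewrite [in RHS]mulmxA mulmxA; congr (_ *m _).
  rewrite mulmx_sumr.
  under eq_bigr => K _ do rewrite -scalemxAr gam_pull mulmxA mulKVmx// scalemxAl scaler_sumr.
  rewrite -mulmx_suml; congr (_ *m _); rewrite exchange_big /=; apply: eq_bigr => K _.
  by rewrite conj_jacM scaler_suml; apply: eq_bigr => M _; rewrite scalerA mulrC.
- under eq_bigr => b _ do rewrite mxE mulr_suml.
  rewrite exchange_big /=.
  under eq_bigr => c _ do (under eq_bigr => b _ do rewrite -mulrA; rewrite -mulr_sumr H3 mulr_sumr).
  rewrite exchange_big /=.
  under eq_bigr => K _ do (under eq_bigr => c _ do rewrite mulrCA; rewrite -mulr_sumr H3' mulr_sumr).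
  rewrite exchange_big /=; apply: eq_bigr => K _; rewrite conj_jacM mulr_suml.
  by apply: eq_bigr => M _; rewrite mulrCA mulrA.
Qed.

Lemma in_fibre_pull J T e : T \in unitmx -> in_fibre e -> in_fibre (pull J T e).
Proof.
move=> uT [H1 H2 H3 H4].
have ri (F : midx p -> C) (t : 'S_p) : \sum_K F K = \sum_K F (perm_idx t K).
  by rewrite (reindex (perm_idx t))//; exact/onW_bij/perm_idx_bij.
have rj (F : midx p -> 'M[C]_r) (t : 'S_p) : \sum_K F K = \sum_K F (perm_idx t K).
  by rewrite (reindex (perm_idx t))//; exact/onW_bij/perm_idx_bij.
split.
- move=> K; rewrite gam_pull mxtrace_mulC mulmxA mulmxV// mul1mx raddf_sum big1// => L _.
  by rewrite /= mxtraceZ H1 mulr0.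
- move=> j K t; rewrite !kap_pull mulr_sumr; apply: eq_bigr => a _.
  rewrite (ri _ t) mulr_sumr; apply: eq_bigr => M _.
  by rewrite -/(perm_idx t K) conj_jac_perm H2 mulrCA.
- move=> K t; rewrite !gam_pull scalemxAl scalemxAr scaler_sumr; congr (_ *m _ *m _).
  rewrite (rj _ t); apply: eq_bigr => M _.
  by rewrite -/(perm_idx t K) conj_jac_perm H3 !scalerA mulrC.
- move=> j K t; rewrite !vec_pull mulr_sumr; apply: eq_bigr => a _.
  rewrite mulrCA; congr (_ * _); rewrite (ri _ t) mulr_sumr; apply: eq_bigr => M _.
  by rewrite -/(perm_idx t K) conj_jac_perm H4 mulrCA.
Qed.

Lemma in_fibreZ (c : C) e : in_fibre e -> in_fibre (c *: e).
Proof.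
move=> [H1 H2 H3 H4]; split.
- by move=> K; rewrite gamZ mxtraceZ H1 mulr0.
- by move=> j K t; rewrite !kapZ H2 mulrCA.
- by move=> K t; rewrite !gamZ H3 !scalerA mulrC.
- by move=> j K t; rewrite !vecZ H4 mulrCA.
Qed.

Lemma in_fibre0 : in_fibre (0 : Qfib R r p).
Proof.
split; rewrite /kap /gam /vec /=.
- by move=> K; rewrite ffunE mxtrace0.
- by move=> j K t; rewrite !ffunE mulr0.
- by move=> K t; rewrite !ffunE scaler0.
- by move=> j K t; rewrite !ffunE mulr0.
Qed.

End Pull.

(** * Charts, cut-off functions and extension by zero *)

Section Bump.
Variable R : realType.
Local Notation V := (model R).

Definition box (x : V) (rho : R) : set V := [set q | forall a, `|q ord0 a - x ord0 a| <= rho].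

Lemma box_compact x rho : compact (box x rho).
Proof.
have -> : box x rho = [set q : V | forall a, `[x ord0 a - rho, x ord0 a + rho]%classic (q ord0 a)].
  by apply/seteqP; split => q /= H a; have := H a; rewrite /= in_itv /= ler_distl.
by apply: (@rV_compact R _ (fun a => `[x ord0 a - rho, x ord0 a + rho]%classic)) => a;
  exact: segment_compact.
Qed.

Lemma box_bounded x rho q : box x rho q -> forall a, `|q ord0 a| <= `|x| + rho.
Proof.
move=> Hq a; rewrite -(subrK (x ord0 a) (q ord0 a)) addrC.
rewrite (le_trans (ler_normD _ _))// lerD//.
rewrite {2}/Num.norm /= mx_normrE.
exact: (le_bigmax _ (fun i => `|x i.1 i.2|) (ord0, a)).
Qed.

Lemma box_sub (W : set V) x : open W -> W x -> exists rho : R, 0 < rho /\ box x rho `<=` W.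
Proof.
move=> oW Wx.
have /nbhs_ballP[e /= e0 He] := open_nbhs_nbhs (conj oW Wx).
exists (e / 2); split; first by rewrite divr_gt0.
move=> q Hq; apply: He; rewrite -ball_normE /= /Num.norm /= mx_normrE.
apply/bigmax_ltP; split => // -[i j] _ /=; rewrite !mxE (ord1 i) distrC.
by apply: le_lt_trans (Hq j) _; rewrite ltr_pdivrMr// ltr_pMr// ltr1n.
Qed.

(** Polynomial in q, hence smooth, and positive only in the box of radius rho. *)
Definition radial (x : V) (rho : R) (q : V) : R :=
  rho ^+ 2 - \sum_(a < 3 + 3) (q ord0 a - x ord0 a) * (q ord0 a - x ord0 a).

(** Normalised so that the value at x is 1: then a product with a function vanishing
    at x has the same differential at x as that function. *)
Definition bump_fun x rho (q : V) : R := flat 0 (radial x rho q) / flat 0 (rho ^+ 2).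

Lemma flat0_gt0 (t : R) : 0 < t -> 0 < flat 0 t.
Proof. by move=> t0; rewrite /flat t0 expr0 mul1r expR_gt0. Qed.

Lemma bump_ge0 x rho q : 0 <= bump_fun x rho q.
Proof. by rewrite /bump_fun divr_ge0 ?flat_ge0. Qed.

Lemma bump1 x rho : 0 < rho -> bump_fun x rho x = 1.
Proof.
move=> r0; rewrite /bump_fun /radial big1 ?subr0 ?divff ?gt_eqF ?flat0_gt0 ?exprn_gt0//.
by move=> a _; rewrite subrr mulr0.
Qed.

Lemma bump_supp x rho q : 0 < rho -> bump_fun x rho q != 0 -> box x rho q.
Proof.
move=> r0 H a; have : 0 < radial x rho q.
  by move: H; rewrite /bump_fun /flat; case: ifP => //; rewrite mul0r eqxx.
rewrite /radial subr_gt0 => S.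
have : (q ord0 a - x ord0 a) ^+ 2 <= rho ^+ 2.
  apply: le_trans (ltW S); rewrite (bigD1 a)//= expr2 lerDl sumr_ge0// => b _.
  by rewrite -expr2 sqr_ge0.
by move=> H2; rewrite -(@ler_pXn2r _ 2) ?nnegrE ?(ltW r0)// real_normK// num_real.
Qed.

Lemma smooth_sum U (I : Type) (s : seq I) (F : I -> V -> R) : open U ->
  (forall i, smooth_on U (F i)) -> smooth_on U (fun q => \sum_(i <- s) F i q).
Proof.
move=> oU H; elim: s => [|i s IH].
  by apply: (smooth_eq oU _ (@smooth_cst R U 0)) => q _; rewrite big_nil.
by under eq_fun do rewrite big_cons; exact: (smoothD oU (H i) IH).
Qed.

Lemma smooth_bump U x rho : open U -> smooth_on U (bump_fun x rho).
Proof.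
move=> oU; apply: (smoothM oU); last exact: smooth_cst.
apply: (smooth_flat 0 oU); apply: (smoothB oU); first exact: smooth_cst.
apply: (smooth_sum _ oU) => a.
have S := smoothB oU (@smooth_coord R U a) (@smooth_cst R U (x ord0 a)).
exact: (smoothM oU S S).
Qed.

End Bump.

Section Manifold.
Variables (R : realType) (X : topologicalType) (M : complex_threefold R X).
Local Notation C := R[i].
Local Notation V := (model R).
Local Notation I := (chart_idx M).
Implicit Types (i j k : I) (p q : V).

Lemma cimg_inv i p : cimg i p -> cdom i (chart_inv i p).
Proof. by move=> [x xi <-]; rewrite chartK. Qed.

Lemma chart_invK i p : cimg i p -> chart i (chart_inv i p) = p.
Proof. by move=> [x xi <-]; rewrite chartK. Qed.

Lemma open_cimg i : open (cimg i).
Proof. exact: cimg_open. Qed.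

Lemma open_preimg i (O : set X) : open O -> open (cimg i `&` [set p | O (chart_inv i p)]).
Proof.
move=> oO; have := @chart_inv_continuous _ _ M i.
rewrite continuous_open_subspace; last exact: cimg_open.
by move=> /(continuous_inP _ (@open_cimg i)); exact.
Qed.

Lemma overlapP i j p : overlap i j p <-> cimg i p /\ cdom j (chart_inv i p).
Proof.
split=> [[x [xi xj] <-]|[pi pj]]; first by rewrite chartK//; split=> //; exists x.
by exists (chart_inv i p); [split=> //; exact: cimg_inv|exact: chart_invK].
Qed.

Lemma open_overlap i j : open (overlap i j).
Proof.
have -> : overlap i j = cimg i `&` [set p | cdom j (chart_inv i p)].
  by apply/seteqP; split=> p /overlapP.
exact/open_preimg/cdom_open.
Qed.

Lemma overlap_cimg i j p : overlap i j p -> cimg i p.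
Proof. by move=> /overlapP[]. Qed.

Lemma transition_inv i j p : overlap i j p -> chart_inv j (transition i j p) = chart_inv i p.
Proof. by move=> /overlapP[_ pj]; rewrite /transition chartK. Qed.

Lemma transition_overlap i j p : overlap i j p -> overlap j i (transition i j p).
Proof.
move=> pij; apply/overlapP; rewrite transition_inv//.
move: pij => /overlapP[pi pj]; split; first by exists (chart_inv i p).
exact: cimg_inv.
Qed.

Lemma transition_comp i j k p : overlap i j p ->
  transition j k (transition i j p) = transition i k p.
Proof. by move=> pij; rewrite {1}/transition transition_inv. Qed.

Lemma overlap_comp i j k p : overlap i j p -> overlap i k p -> overlap j k (transition i j p).
Proof.
move=> pij /overlapP[_ pk]; apply/overlapP; rewrite transition_inv//; split=> //.
exact: overlap_cimg (transition_overlap pij).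
Qed.

Lemma overlap_id i p : cimg i p -> overlap i i p.
Proof. by move=> pi; apply/overlapP; split=> //; exact: cimg_inv. Qed.

Lemma transition_id i p : cimg i p -> transition i i p = p.
Proof. by move=> pi; rewrite /transition chart_invK. Qed.

Lemma hol_transition i j a : holomorphic_on (overlap i j) (fun p => zcoord a (transition i j p)).
Proof. exact: transition_holomorphic. Qed.

Lemma smooth_transition i j a : smooth_on (overlap i j) (fun p => transition i j p ord0 a).
Proof.
rewrite -(splitK a); case: (fintype.split a) => b /=.
  by have [/csmooth_onP[H _] _] := hol_transition i j b; exact: H.
by have [/csmooth_onP[_ H] _] := hol_transition i j b; exact: H.
Qed.

Lemma jac_smooth i j : mx_smooth (overlap i j) (jac i j).
Proof.
move=> a b; under eq_fun do rewrite mxE.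
apply: (csmooth_dhol _ (@open_overlap i j)); exact: (hol_transition i j a).1.
Qed.

Lemma near_open (W : set V) (P : V -> Prop) p : open W -> W p -> (forall q, W q -> P q) ->
  \near p, P p.
Proof. by move=> oW Wp H; apply: filterS (open_nbhs_nbhs (conj oW Wp)). Qed.

(** The chain rule for holomorphic maps. *)
Lemma jac_comp i j k p : overlap i j p -> overlap i k p ->
  jac i k p = jac j k (transition i j p) *m jac i j p.
Proof.
move=> pij pik; apply/matrixP => a b; rewrite !mxE.
transitivity (dhol b (fun q => zcoord a (transition j k (transition i j q))) p).
  apply: dhol_near; apply: (near_open (@open_overlap i j)) => // q qij.
  by rewrite transition_comp.
rewrite (@dhol_chain _ (overlap j k) (overlap i j) (fun q => zcoord a (transition j k q))
   (transition i j)).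
- by apply: eq_bigr => c _; rewrite !mxE.
- exact: open_overlap.
- exact: open_overlap.
- exact: hol_transition.
- exact: overlap_comp.
- exact: pij.
- exact: smooth_transition.
Qed.

Lemma jac_id i p : cimg i p -> jac i i p = 1%:M.
Proof.
move=> pi; apply/matrixP => a b; rewrite !mxE.
rewrite -(dhol_zcoord p a b); apply: dhol_near.
by apply: (near_open (@open_cimg i)) => // q qi; rewrite transition_id.
Qed.

Lemma jac_unit i j p : overlap i j p -> jac i j p \in unitmx.
Proof.
move=> pij; have := jac_comp pij (overlap_id (overlap_cimg pij)).
rewrite jac_id; last exact: overlap_cimg pij.
by move=> /esym/mulmx1_unit[].
Qed.

(** The image of B in X is compact, hence closed, so a point of chart j outside chart
    i has a neighbourhood that misses it, on which the function is 0. *)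
Lemma csmooth_ext0 i j (B : set V) (G : V -> C) : compact B -> B `<=` cimg i ->
  csmooth_on (overlap j i) G ->
  (forall q, overlap j i q -> G q != 0 -> B (transition j i q)) ->
  csmooth_on (cimg j) (fun q => if `[< cdom i (chart_inv j q) >] then G q else 0).
Proof.
move=> cB Bi sG GB.
have cK : compact (chart_inv i @` B).
  apply: continuous_compact cB; apply: continuous_subspaceW Bi _.
  exact: chart_inv_continuous.
have oK : open (~` (chart_inv i @` B)).
  apply: closed_openC; apply: compact_closed; [exact: (X_hausdorff M)|exact: cK].
apply: csmooth_local => p pj.
have [pi|npi] := pselect (cdom i (chart_inv j p)).
  exists (overlap j i); split; [exact: open_overlap|exact/overlapP|].
  apply: csmooth_eq (sG); first exact: open_overlap.
  by move=> q /overlapP[_ qi]; case: asboolP.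
exists (cimg j `&` [set p | (~` (chart_inv i @` B)) (chart_inv j p)]); split.
- exact: open_preimg.
- split=> // -[q Bq E]; apply: npi; rewrite -E; exact/cimg_inv/Bi.
apply: csmooth_eq (@csmooth_cst R _ 0); first exact: open_preimg.
move=> q [qj nq]; case: asboolP => // qi.
apply/esym/eqP; apply: contra_notT nq => Gq.
have ov : overlap j i q by apply/overlapP.
exists (transition j i q); first exact: GB.
exact: transition_inv.
Qed.

Definition extend0 i (F : V -> R) (y : X) : R := if `[< cdom i y >] then F (chart i y) else 0.

Lemma smooth_extend0 i (B : set V) (F : V -> R) : compact B -> B `<=` cimg i ->
  smooth_on (cimg i) F -> (forall q, cimg i q -> F q != 0 -> B q) ->
  smooth_fun M (extend0 i F).
Proof.
move=> cB Bi sF FB j.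
have : csmooth_on (cimg j) (fun q => if `[< cdom i (chart_inv j q) >] then (F (transition j i q))%:C else 0).
  apply: (csmooth_ext0 cB Bi).
    apply: csmooth_real; apply: (smooth_comp (@open_cimg i) (@open_overlap j i) _ sF).
      by move=> p pji; exact: overlap_cimg (transition_overlap pji).
    exact: smooth_transition.
  move=> q qji Fq; apply: FB; first exact: overlap_cimg (transition_overlap qji).
  by apply: contraNneq Fq => ->.
move=> /csmooth_onP[H _]; apply: smooth_eq H; first exact: open_cimg.
by move=> q qj; rewrite /extend0 /transition; case: asboolP.
Qed.

End Manifold.

(** * Sections of Q supported in a chart *)

Section Sections.
Variables (R : realType) (X : topologicalType) (r : nat) (D : het_data R X r).
Local Notation C := R[i].
Local Notation V := (model R).
Local Notation I := (chart_idx D).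
Local Notation midx p := {ffun 'I_p -> 'I_3}.
Implicit Types (i j k : I) (q : V).
Hypothesis bD : bundle_axiom D.

Lemma trans_comp i j k q : overlap i j q -> overlap i k q ->
  trans i k q = trans j k (transition i j q) *m trans i j q.
Proof.
move=> qij qik; have [_ [_ H]] := bD.
have qi := overlap_cimg qij.
have := H i j k (chart_inv i q); rewrite chart_invK//; apply.
- exact: cimg_inv.
- by move: qij => /overlapP[].
- by move: qik => /overlapP[].
Qed.

Lemma trans_id i q : cimg i q -> trans i i q = 1%:M.
Proof. by move=> qi; have [_ [H _]] := bD; exact: H. Qed.

Lemma trans_unit i j q : overlap i j q -> trans i j q \in unitmx.
Proof.
move=> qij; have := trans_comp qij (overlap_id (overlap_cimg qij)).
rewrite trans_id; last exact: overlap_cimg qij.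
by move=> /esym/mulmx1_unit[].
Qed.

Lemma trans_smooth i j : mx_smooth (overlap i j) (trans i j).
Proof. by move=> a b; have [H _] := bD; exact: (H i j a b).1. Qed.

Definition smooth_field p (U : set V) (s : V -> Qfib R r p) : Prop :=
  [/\ forall a K, csmooth_on U (fun q => kap (s q) a K),
      forall K a b, csmooth_on U (fun q => gam (s q) K a b) &
      forall a K, csmooth_on U (fun q => vec (s q) a K)].

Lemma is_sectionP p (s : field D (Qfib R r p)) : is_section s <->
  [/\ forall i, smooth_field (cimg i) (s i),
      forall i q, cimg i q -> in_fibre (s i q) &
      forall i j q, overlap i j q ->
        s i q = pull (jac i j q) (trans i j q) (s j (transition i j q))].
Proof.
split=> -[H1 H2 H3]; split.
- by move=> i; have [h1 [h2 h3]] := H1 i; split.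
- exact: H2.
- move=> i j q qij; apply/(pull_rule _ _ (jac_unit qij) (trans_unit qij)); exact: H3.
- by move=> i; have [h1 h2 h3] := H1 i; split; [|split].
- exact: H2.
- move=> i j q qij; apply/(pull_rule _ _ (jac_unit qij) (trans_unit qij)); exact: H3.
Qed.

Lemma conj_jac_smooth p i j (K L : midx p) :
  csmooth_on (overlap i j) (fun q => conj_jac (jac i j q) K L).
Proof.
rewrite /conj_jac; apply: (csmooth_prod _ _ (@open_overlap _ _ _ i j)) => c.
apply: (csmooth_conj (@open_overlap _ _ _ i j)); exact: jac_smooth.
Qed.

Lemma pull_smooth p i j (e : Qfib R r p) :
  smooth_field (overlap i j) (fun q => pull (jac i j q) (trans i j q) e).
Proof.
have oO := @open_overlap _ _ _ i j.
have sJ := conj_jac_smooth i j.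
split=> [b L|L a b|b L].
- under eq_fun do rewrite kap_pull.
  apply: (csmooth_sum _ _ oO) => a; apply: (csmooth_sum _ _ oO) => K.
  apply: (csmoothM oO); last exact: csmooth_cst.
  apply: (csmoothM oO); [exact: jac_smooth|exact: sJ].
- under eq_fun do rewrite gam_pull mxE.
  apply: (csmooth_sum _ _ oO) => c; apply: (csmoothM oO); last exact: trans_smooth.
  under eq_fun do rewrite mxE.
  apply: (csmooth_sum _ _ oO) => d; apply: (csmoothM oO).
    exact: (mx_smooth_inv oO (fun q => @trans_unit i j q) (@trans_smooth i j)).
  under eq_fun do rewrite summxE.
  apply: (csmooth_sum _ _ oO) => K; under eq_fun do rewrite mxE.
  apply: (csmoothM oO); [exact: sJ|exact: csmooth_cst].
- under eq_fun do rewrite vec_pull.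
  apply: (csmooth_sum _ _ oO) => a; apply: (csmoothM oO).
    exact: (mx_smooth_inv oO (fun q => @jac_unit _ _ _ i j q) (@jac_smooth _ _ _ i j)).
  apply: (csmooth_sum _ _ oO) => K; apply: (csmoothM oO); [exact: sJ|exact: csmooth_cst].
Qed.

Lemma smooth_fieldZ p U (c : V -> C) (s : V -> Qfib R r p) : open U -> csmooth_on U c ->
  smooth_field U s -> smooth_field U (fun q => c q *: s q).
Proof.
move=> oU Hc [H1 H2 H3]; split=> [j K|K a b|j K].
- under eq_fun do rewrite kapZ; exact: (csmoothM oU Hc (H1 _ _)).
- under eq_fun do rewrite gamZ mxE; exact: (csmoothM oU Hc (H2 _ _ _)).
- under eq_fun do rewrite vecZ; exact: (csmoothM oU Hc (H3 _ _)).
Qed.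

(** The section chi e of chart i, written in the frames of all charts. *)
Definition cutoff_section p i (chi : V -> R) (e : Qfib R r p) : field D (Qfib R r p) :=
  fun j q => if `[< cdom i (chart_inv j q) >]
             then (chi (transition j i q))%:C *: pull (jac j i q) (trans j i q) e else 0.

Section CutoffSection.
Variables (p : nat) (i : I) (B : set V) (chi : V -> R) (e : Qfib R r p).
Hypotheses (cB : compact B) (Bi : B `<=` cimg i) (schi : smooth_on (cimg i) chi)
  (chiB : forall q, cimg i q -> chi q != 0 -> B q) (fe : in_fibre e).

Lemma cutoff_section_chart q : cimg i q -> cutoff_section i chi e i q = (chi q)%:C *: e.
Proof.
move=> qi; rewrite /cutoff_section asboolT; last exact: cimg_inv.
by rewrite transition_id// jac_id// trans_id// pull1.
Qed.

Lemma is_section_cutoff : is_section (cutoff_section i chi e).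
Proof.
apply/is_sectionP; split.
- move=> j; have oO := @open_overlap _ _ _ j i.
  have sc : csmooth_on (overlap j i) (fun q => (chi (transition j i q))%:C).
    apply: csmooth_real; apply: (smooth_comp (@open_cimg _ _ _ i) oO _ schi).
      by move=> q qji; exact: overlap_cimg (transition_overlap qji).
    exact: smooth_transition.
  have [S1 S2 S3] := smooth_fieldZ oO sc (pull_smooth j i e).
  have Bz q : overlap j i q -> (chi (transition j i q))%:C != 0 -> B (transition j i q).
    move=> qji Fq; apply: chiB; first exact: overlap_cimg (transition_overlap qji).
    by apply: contraNneq Fq => ->.
  split=> [b K|K a b|b K].
  + apply: csmooth_eq (csmooth_ext0 cB Bi (S1 b K) _) => [|q _|q qji].
    * exact: open_cimg.
    * by rewrite /cutoff_section; case: ifP => // _; rewrite /kap ffunE.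
    * by rewrite kapZ mulf_eq0 negb_or => /andP[/(Bz _ qji)].
  + apply: csmooth_eq (csmooth_ext0 cB Bi (S2 K a b) _) => [|q _|q qji].
    * exact: open_cimg.
    * by rewrite /cutoff_section; case: ifP => // _; rewrite /gam ffunE mxE.
    * by rewrite gamZ mxE mulf_eq0 negb_or => /andP[/(Bz _ qji)].
  + apply: csmooth_eq (csmooth_ext0 cB Bi (S3 b K) _) => [|q _|q qji].
    * exact: open_cimg.
    * by rewrite /cutoff_section; case: ifP => // _; rewrite /vec ffunE.
    * by rewrite vecZ mulf_eq0 negb_or => /andP[/(Bz _ qji)].
- move=> j q qj; rewrite /cutoff_section; case: asboolP => [qi|_]; last exact: in_fibre0.
  by apply/in_fibreZ/in_fibre_pull => //; apply: trans_unit; apply/overlapP.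
- move=> j k q qjk; rewrite /cutoff_section transition_inv//; case: asboolP => [qi|_].
    have qji : overlap j i q by apply/overlapP; split=> //; exact: overlap_cimg qjk.
    rewrite pullZ (transition_comp _ qjk).
    congr (_ *: _).
    rewrite (jac_comp qjk qji) (trans_comp qjk qji) pullM//.
    + exact/jac_unit/overlap_comp. + exact: jac_unit.
    + exact/trans_unit/overlap_comp. + exact: trans_unit.
  by rewrite -[0 in RHS](scale0r (0 : Qfib R r p)) pullZ scale0r.
Qed.

Lemma supported_cutoff : supported_in i (cutoff_section i chi e).
Proof.
exists (chart_inv i @` B); split.
- by apply: continuous_compact cB; apply: continuous_subspaceW Bi _; exact: chart_inv_continuous.
- by move=> _ [q Bq <-]; exact/cimg_inv/Bi.
- move=> j q qj nq; rewrite /cutoff_section; case: asboolP => // qi.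
  have qji : overlap j i q by apply/overlapP.
  have [->|c0] := eqVneq (chi (transition j i q)) 0; first by rewrite scale0r.
  exfalso; apply: nq; exists (transition j i q); last exact: transition_inv.
  by apply: chiB => //; exact: overlap_cimg (transition_overlap qji).
Qed.

End CutoffSection.

Lemma is_section_scale p (f : X -> R) (s : field D (Qfib R r p)) : smooth_fun D f ->
  is_section s -> is_section (fun k q => (f (chart_inv k q))%:C *: s k q).
Proof.
move=> sf /is_sectionP[H1 H2 H3]; apply/is_sectionP; split.
- move=> i; apply: (smooth_fieldZ (@open_cimg _ _ _ i) _ (H1 i)).
  by apply: csmooth_real; exact: sf.
- by move=> i q qi; apply/in_fibreZ/H2.
- by move=> i j q qij; rewrite pullZ -H3// transition_inv.
Qed.

Lemma supported_scale p i (f : X -> R) (s : field D (Qfib R r p)) : supported_in i s ->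
  supported_in i (fun k q => (f (chart_inv k q))%:C *: s k q).
Proof.
move=> [K [cK Ki H]]; exists K; split=> // j q qj nq.
by rewrite H// scaler0.
Qed.

End Sections.

(** * Smoothness and Leibniz rule for the deformation operator *)

Section DbarSmooth.
Variables (R : realType) (r : nat).
Local Notation C := R[i].
Local Notation V := (model R).
Local Notation midx p := {ffun 'I_p -> 'I_3}.
Variables (U : set V) (al : R) (G : V -> 'M[C]_3) (H : V -> 'M[C]_r).
Hypotheses (oU : open U) (sG : mx_smooth U G) (sH : mx_smooth U H).
Hypotheses (uG : forall p, U p -> G p \in unitmx) (uH : forall p, U p -> H p \in unitmx).

Lemma upper_smooth n (A : V -> 'M[C]_n) a b : mx_smooth U A ->
  (forall p, U p -> A p \in unitmx) -> csmooth_on U (fun p => upper (A p) a b).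
Proof. by move=> sA uA; exact: (mx_smooth_inv oU uA sA b a). Qed.

Lemma chern_smooth n (A : V -> 'M[C]_n) j : mx_smooth U A ->
  (forall p, U p -> A p \in unitmx) -> mx_smooth U (chern A j).
Proof.
move=> sA uA c a; under eq_fun do rewrite mxE.
apply: (csmooth_sum _ _ oU) => b; apply: (csmoothM oU); last exact: upper_smooth.
exact: (csmooth_dhol _ oU (sA a b)).
Qed.

Lemma curvature_smooth n (A : V -> 'M[C]_n) j k : mx_smooth U A ->
  (forall p, U p -> A p \in unitmx) -> mx_smooth U (curvature A j k).
Proof.
move=> sA uA c a; under eq_fun do rewrite mxE.
by apply: (csmoothN oU); apply: (csmooth_dbar _ oU); exact: chern_smooth.
Qed.

Lemma riem_smooth k j l m : csmooth_on U (riem G k j l m).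
Proof. by apply: (csmoothN oU); exact: curvature_smooth. Qed.

Lemma riem_conj_smooth k j l m : csmooth_on U (riem_conj G k j l m).
Proof.
by apply: (csmoothN oU); apply: (csmooth_dhol _ oU); apply: (csmooth_conj oU); exact: chern_smooth.
Qed.

Lemma form11_smooth (a : 'I_3 -> 'I_3 -> V -> C) K :
  (forall j k, csmooth_on U (a j k)) -> csmooth_on U (form11 a K).
Proof.
move=> sa; rewrite /form11; case: (K ord0) => j; case: (K ord_max) => k.
- exact: csmooth_cst. - exact: sa. - exact: (csmoothN oU (sa _ _)). - exact: csmooth_cst.
Qed.

Lemma tors_form_smooth j k l : csmooth_on U (tors_form G j k l).
Proof.
apply: (csmoothM oU); first exact: csmooth_cst.
rewrite /d_hol /extd; apply: (csmooth_sum _ _ oU) => a.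
apply: (csmoothM oU); first exact: csmooth_cst.
have S K : csmooth_on U (kahler_form G K).
  by apply: form11_smooth => b c; apply: (csmoothM oU); [exact: csmooth_cst|exact: sG].
by case: (idx3 _ _ _ a) => b; [exact: (csmooth_dhol _ oU (S _))|exact: (csmooth_dbar _ oU (S _))].
Qed.

Lemma tors_smooth l j k : csmooth_on U (tors G l j k).
Proof.
apply: (csmoothN oU); apply: (csmooth_sum _ _ oU) => m.
by apply: (csmoothM oU); [exact: upper_smooth|exact: tors_form_smooth].
Qed.

Lemma wedge1_smooth p (X : 'I_3 -> midx p -> V -> C) K :
  (forall k L, csmooth_on U (X k L)) -> csmooth_on U (fun q => wedge1 (fun k L => X k L q) K).
Proof.
move=> sX; rewrite /wedge1; apply: (csmooth_sum _ _ oU) => a.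
by apply: (csmoothM oU); [exact: csmooth_cst|exact: sX].
Qed.

Lemma nabla_plus_smooth p (s : V -> Qfib R r p) l m L : smooth_field U s ->
  csmooth_on U (nabla_plus G s l m L).
Proof.
move=> [_ _ s3]; apply: (csmoothB oU); first apply: (csmoothD oU).
- exact: (csmooth_dhol _ oU (s3 m L)).
- apply: (csmooth_sum _ _ oU) => n; apply: (csmoothM oU); [exact: chern_smooth|exact: s3].
- apply: (csmooth_sum _ _ oU) => n; apply: (csmoothM oU); [exact: tors_smooth|exact: s3].
Qed.

Lemma Dbar_loc_smooth p (s : V -> Qfib R r p) : smooth_field U s ->
  smooth_field U (Dbar_loc al G H s).
Proof.
move=> /[dup] sm [s1 s2 s3]; split=> [j K|K a b|j K].
- rewrite /kap /Dbar_loc /=; under eq_fun do rewrite ffunE /=.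
  apply: wedge1_smooth => k L.
  apply: (csmoothD oU); first apply: (csmoothD oU); first apply: (csmoothD oU).
  + exact: (csmooth_dbar _ oU (s1 j L)).
  + apply: (csmoothM oU); first exact: csmooth_cst.
    apply: (csmooth_sum _ _ oU) => a; under eq_fun do rewrite mxE.
    apply: (csmooth_sum _ _ oU) => b; apply: (csmoothM oU); [exact: curvature_smooth|exact: s2].
  + apply: (csmooth_sum _ _ oU) => l; apply: (csmoothM oU); [exact: tors_form_smooth|exact: s3].
  + apply: (csmoothM oU); first exact: csmooth_cst.
    apply: (csmooth_sum _ _ oU) => l; apply: (csmooth_sum _ _ oU) => m; apply: (csmoothM oU).
      exact: riem_smooth.
    exact: nabla_plus_smooth.
- rewrite /gam /Dbar_loc /=; under eq_fun do rewrite ffunE /wedge1 summxE.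
  apply: (csmooth_sum _ _ oU) => c; under eq_fun do rewrite !mxE summxE.
  apply: (csmoothM oU); first exact: csmooth_cst.
  apply: (csmoothD oU); first exact: (csmooth_dbar _ oU (s2 _ a b)).
  apply: (csmooth_sum _ _ oU) => j; under eq_fun do rewrite mxE.
  apply: (csmoothM oU); [exact: s3|exact: curvature_smooth].
- rewrite /vec /Dbar_loc /=; under eq_fun do rewrite ffunE /=.
  apply: wedge1_smooth => k L; exact: (csmooth_dbar _ oU (s3 j L)).
Qed.

Lemma Qinner_smooth p (s t : V -> Qfib R r p) : smooth_field U s -> smooth_field U t ->
  csmooth_on U (fun q => Qinner (G q) (H q) (s q) (t q)).
Proof.
move=> [s1 s2 s3] [t1 t2 t3]; rewrite /Qinner.
apply: (csmoothM oU); first exact: csmooth_cst.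
apply: (csmooth_sum _ _ oU) => K; apply: (csmooth_sum _ _ oU) => L; apply: (csmoothM oU).
  by apply: (csmooth_prod _ _ oU) => c; exact: upper_smooth.
apply: (csmoothD oU); first apply: (csmoothD oU).
- apply: (csmooth_sum _ _ oU) => j; apply: (csmooth_sum _ _ oU) => k; apply: (csmoothM oU).
    by apply: (csmoothM oU); [exact: upper_smooth|exact: s1].
  exact: (csmooth_conj oU (t1 k L)).
- apply: (csmooth_sum _ _ oU) => a; apply: (csmooth_sum _ _ oU) => b.
  apply: (csmooth_sum _ _ oU) => c; apply: (csmooth_sum _ _ oU) => d; apply: (csmoothM oU).
    apply: (csmoothM oU); last exact: s2.
    by apply: (csmoothM oU); [exact: sH|exact: upper_smooth].
  exact: (csmooth_conj oU (t2 L c d)).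
- apply: (csmooth_sum _ _ oU) => j; apply: (csmooth_sum _ _ oU) => k; apply: (csmoothM oU).
    by apply: (csmoothM oU); [exact: sG|exact: s3].
  exact: (csmooth_conj oU (t3 k L)).
Qed.

Lemma symbol_Dbar_adj_smooth (th thb : V -> 'I_3 -> C) (s : V -> Qfib R r 1) :
  (forall j, csmooth_on U (fun q => th q j)) -> (forall j, csmooth_on U (fun q => thb q j)) ->
  smooth_field U s ->
  smooth_field U (fun q => symbol_Dbar_adj (G q) al%:C (th q) (thb q)
    (fun j l m n => riem_conj G j l m n q) (s q)).
Proof.
move=> sth sthb [s1 s2 s3].
have su q k : csmooth_on U (fun p => upper (G p) q k * (thb p q)^*%R).
  by apply: (csmoothM oU); [exact: upper_smooth|exact: (csmooth_conj oU (sthb q))].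
split=> [j K|K a b|j K].
- rewrite /kap /symbol_Dbar_adj /=; under eq_fun do rewrite ffunE /=.
  apply: (csmooth_sum _ _ oU) => q; apply: (csmooth_sum _ _ oU) => k.
  by apply: (csmoothM oU); [exact: su|exact: s1].
- rewrite /gam /symbol_Dbar_adj /=; under eq_fun do rewrite ffunE summxE.
  apply: (csmooth_sum _ _ oU) => q; under eq_fun do rewrite summxE.
  apply: (csmooth_sum _ _ oU) => k; under eq_fun do rewrite mxE.
  by apply: (csmoothM oU); [exact: su|exact: s2].
- rewrite /vec /symbol_Dbar_adj /=; under eq_fun do rewrite ffunE /=.
  apply: (csmoothD oU); last first.
    apply: (csmooth_sum _ _ oU) => q; apply: (csmooth_sum _ _ oU) => k.
    by apply: (csmoothM oU); [exact: su|exact: s3].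
  apply: (csmoothM oU); first exact: csmooth_cst.
  apply: (csmooth_sum _ _ oU) => n; apply: (csmooth_sum _ _ oU) => a; apply: (csmooth_sum _ _ oU) => b.
  apply: (csmooth_sum _ _ oU) => j'; apply: (csmooth_sum _ _ oU) => l; apply: (csmooth_sum _ _ oU) => m.
  apply: (csmoothM oU); last exact: s1.
  apply: (csmoothM oU); last exact: (csmooth_conj oU (sth m)).
  apply: (csmoothM oU); last exact: riem_conj_smooth.
  apply: (csmoothM oU); last exact: upper_smooth.
  by apply: (csmoothM oU); exact: upper_smooth.
Qed.

Lemma smooth_fieldD p (s t : V -> Qfib R r p) : smooth_field U s -> smooth_field U t ->
  smooth_field U (fun q => s q + t q).
Proof.
move=> [s1 s2 s3] [t1 t2 t3]; split=> [j K|K a b|j K].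
- under eq_fun do rewrite kapD; exact: (csmoothD oU (s1 _ _) (t1 _ _)).
- under eq_fun do rewrite gamD mxE; exact: (csmoothD oU (s2 _ _ _) (t2 _ _ _)).
- under eq_fun do rewrite vecD; exact: (csmoothD oU (s3 _ _) (t3 _ _)).
Qed.

End DbarSmooth.

Section DbarLeibniz.
Variables (R : realType) (r : nat).
Local Notation C := R[i].
Local Notation V := (model R).
Local Notation midx p := {ffun 'I_p -> 'I_3}.
Variables (U : set V) (al : R) (G : V -> 'M[C]_3) (H : V -> 'M[C]_r).

Lemma wedge1D (L : lmodType C) p (X Y : 'I_3 -> midx p -> L) K :
  wedge1 (fun k M => X k M + Y k M) K = wedge1 X K + wedge1 Y K.
Proof. by rewrite /wedge1 -big_split; apply: eq_bigr => a _; rewrite /= scalerDr. Qed.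

(** The algebra of one component: c differentiated by dbar and by nabla^+ leaves t1
    and S2. *)
Lemma leibniz_kap (c k1 k2 F t1 T1 S1 S2 a : C) :
  t1 + c * k1 + a * (c * F) + c * T1 + a * (c * S1 + S2) =
  c * (k1 + a * F + T1 + a * S1) + (t1 + a * S2).
Proof. ring. Qed.

Lemma leibniz_nabla (c t a b d : C) : t + c * a + c * b - c * d = c * (a + b - d) + t.
Proof. ring. Qed.

Lemma leibniz_riem (rho c N d v : C) : rho * (c * N + d * v) = c * (rho * N) + rho * d * v.
Proof. ring. Qed.

(** Differentiating c yields exactly the symbol at dc; in nabla^+ only the partial
    derivative sees c, the connection and torsion terms being linear. *)
Lemma Dbar_loc_leibniz p (c : V -> C) (s : V -> Qfib R r p) q :
  csmooth_on U c -> smooth_field U s -> U q ->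
  Dbar_loc al G H (fun q => c q *: s q) q =
  c q *: Dbar_loc al G H s q +
  symbol_Dbar al%:C (fun l => dhol l c q) (fun k => dbar k c q) (fun k j l m => riem G k j l m q) (s q).
Proof.
move=> sc [s1 s2 s3] Uq.
have dc := csmooth_derivable sc Uq.
apply: QfibP => [j K|K|j K]; rewrite ?kapD ?gamD ?vecD ?kapZ ?gamZ ?vecZ.
- rewrite /kap /Dbar_loc /symbol_Dbar /= !ffunE /= -[c q * _]wedge1Z -wedge1D.
  apply: wedge1_eq => k L; rewrite -!/(kap _ _ _) -!/(gam _ _) -!/(vec _ _ _).
  have -> : (fun q0 => kap (c q0 *: s q0) j L) = (fun q0 => c q0 * kap (s q0) j L).
    by apply/funext => y; rewrite kapZ.
  rewrite (dbarM _ dc (csmooth_derivable (s1 j L) Uq)) gamZ -scalemxAr mxtraceZ.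
  have -> : \sum_l tors_form G l j k q * vec (c q *: s q) l L =
    c q * \sum_l tors_form G l j k q * vec (s q) l L.
    by rewrite mulr_sumr; apply: eq_bigr => l _; rewrite vecZ mulrCA.
  have E l m : nabla_plus G (fun q0 => c q0 *: s q0) l m L q =
      c q * nabla_plus G s l m L q + dhol l c q * vec (s q) m L.
    rewrite /nabla_plus.
    have -> : (fun q0 => vec (c q0 *: s q0) m L) = (fun q0 => c q0 * vec (s q0) m L).
      by apply/funext => y; rewrite vecZ.
    rewrite (dholM _ dc (csmooth_derivable (s3 m L) Uq)).
    have -> : \sum_n chern G l q m n * vec (c q *: s q) n L =
      c q * \sum_n chern G l q m n * vec (s q) n L.
      by rewrite mulr_sumr; apply: eq_bigr => n _; rewrite vecZ mulrCA.
    have -> : \sum_n tors G m l n q * vec (c q *: s q) n L =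
      c q * \sum_n tors G m l n q * vec (s q) n L.
      by rewrite mulr_sumr; apply: eq_bigr => n _; rewrite vecZ mulrCA.
    exact: leibniz_nabla.
  have -> : \sum_l \sum_m riem G k j l m q * nabla_plus G (fun q0 => c q0 *: s q0) l m L q =
     c q * (\sum_l \sum_m riem G k j l m q * nabla_plus G s l m L q) +
     \sum_l \sum_m riem G k j l m q * dhol l c q * vec (s q) m L.
    rewrite mulr_sumr -big_split; apply: eq_bigr => l _; rewrite mulr_sumr -big_split.
    by apply: eq_bigr => m _; rewrite E; exact: leibniz_riem.
  exact: leibniz_kap.
- rewrite /gam /Dbar_loc /symbol_Dbar /= !ffunE /= -wedge1Z -wedge1D.
  apply: wedge1_eq => k L; rewrite -!/(kap _ _ _) -!/(gam _ _) -!/(vec _ _ _).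
  apply/matrixP => a b; rewrite !mxE.
  have -> : (fun q0 => gam (c q0 *: s q0) L a b) = (fun q0 => c q0 * gam (s q0) L a b).
    by apply/funext => y; rewrite gamZ mxE.
  rewrite (dbarM _ dc (csmooth_derivable (s2 L a b) Uq)).
  have -> : (\sum_j vec (c q *: s q) j L *: curvature H j k q) a b =
     c q * (\sum_j vec (s q) j L *: curvature H j k q) a b.
    rewrite !summxE mulr_sumr; apply: eq_bigr => j _; rewrite vecZ !mxE mulrA //.
  by rewrite mulrDr -addrA addrC.
- rewrite /vec /Dbar_loc /symbol_Dbar /= !ffunE /= -[c q * _]wedge1Z -wedge1D.
  apply: wedge1_eq => k L; rewrite -!/(kap _ _ _) -!/(gam _ _) -!/(vec _ _ _).
  have -> : (fun q0 => vec (c q0 *: s q0) j L) = (fun q0 => c q0 * vec (s q0) j L).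
    by apply/funext => y; rewrite vecZ.
  by rewrite (dbarM _ dc (csmooth_derivable (s3 j L) Uq)) addrC.
Qed.

Lemma dbar_near (f g : V -> C) p j : (\near p, f p = g p) -> dbar j f p = dbar j g p.
Proof. by move=> E; rewrite /dbar !(cderive_near _ E). Qed.

Lemma cderive_cst (c : C) (v p : V) : cderive v (fun=> c) p = 0.
Proof. by rewrite /cderive !derive_cst. Qed.

Lemma dbar_near0 (f : V -> C) p j : (\near p, f p = 0) -> dbar j f p = 0.
Proof. by move=> E; rewrite (dbar_near _ E) /dbar !cderive_cst mulr0 addr0 mulr0. Qed.

Lemma dhol_near0 (f : V -> C) p j : (\near p, f p = 0) -> dhol j f p = 0.
Proof. by move=> E; rewrite (dhol_near _ E) /dhol !cderive_cst mulr0 subr0 mulr0. Qed.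

Lemma wedge1_eq0 (L : lmodType C) p (X : 'I_3 -> midx p -> L) K :
  (forall k M, X k M = 0) -> wedge1 X K = 0.
Proof. by move=> E; rewrite /wedge1 big1// => a _; rewrite E scaler0. Qed.

Lemma Dbar_loc_near0 p (s : V -> Qfib R r p) q : (\near q, s q = 0) ->
  Dbar_loc al G H s q = 0.
Proof.
move=> s0.
have sq : s q = 0 by exact: nbhs_singleton s0.
have k0 j L : \near q, kap (s q) j L = 0 by apply: filterS s0 => y ->; rewrite /kap ffunE.
have g0 L a b : \near q, gam (s q) L a b = 0 by apply: filterS s0 => y ->; rewrite /gam ffunE mxE.
have v0 j L : \near q, vec (s q) j L = 0 by apply: filterS s0 => y ->; rewrite /vec ffunE.
have v0q j L : vec (s q) j L = 0 by rewrite sq /vec ffunE.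
apply: QfibP => [j K|K|j K]; rewrite /kap /gam /vec /= !ffunE; apply: wedge1_eq0 => k L.
- rewrite (dbar_near0 _ (k0 j L)) sq [gam 0 L]ffunE mulmx0 mxtrace0 mulr0 !add0r.
  rewrite big1 ?add0r => [|l _]; last by rewrite [vec _ _ _]ffunE mulr0.
  rewrite big1 ?mulr0// => l _; rewrite big1// => m _.
  rewrite /nabla_plus (dhol_near0 _ (v0 m L)) !big1 ?subr0 ?addr0 ?mulr0// => n _.
    by rewrite v0q mulr0.
  by rewrite v0q mulr0.
- apply/matrixP => a b; rewrite !mxE (dbar_near0 _ (g0 L a b)) add0r summxE big1// => j _.
  by rewrite v0q scale0r mxE.
- exact: (dbar_near0 _ (v0 j L)).
Qed.

End DbarLeibniz.

(** * Sesquilinearity and integrands on a chart *)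

Section QinnerLinear.
Variables (R : realType) (r p : nat) (g : 'M[R[i]]_3) (h : 'M[R[i]]_r).
Implicit Types u v : Qfib R r p.

Lemma QinnerDl u u' v : Qinner g h (u + u') v = Qinner g h u v + Qinner g h u' v.
Proof.
rewrite /Qinner -mulrDr -big_split; congr (_ * _); apply: eq_bigr => K _.
rewrite -big_split; apply: eq_bigr => L _; rewrite /= -mulrDr; congr (_ * _).
rewrite [RHS]addrACA [X in _ = X + _]addrACA -!big_split; congr (_ + _ + _).
- by apply: eq_bigr => j _; rewrite /= -big_split; apply: eq_bigr => k _; rewrite kapD mulrDr mulrDl.
- apply: eq_bigr => a _; rewrite /= -big_split; apply: eq_bigr => b _; rewrite /= -big_split.
  apply: eq_bigr => c _; rewrite /= -big_split; apply: eq_bigr => d _.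
  by rewrite gamD mxE mulrDr mulrDl.
- by apply: eq_bigr => j _; rewrite /= -big_split; apply: eq_bigr => k _; rewrite vecD mulrDr mulrDl.
Qed.

Lemma QinnerDr u v v' : Qinner g h u (v + v') = Qinner g h u v + Qinner g h u v'.
Proof.
rewrite /Qinner -mulrDr -big_split; congr (_ * _); apply: eq_bigr => K _.
rewrite -big_split; apply: eq_bigr => L _; rewrite /= -mulrDr; congr (_ * _).
rewrite [RHS]addrACA [X in _ = X + _]addrACA -!big_split; congr (_ + _ + _).
- by apply: eq_bigr => j _; rewrite /= -big_split; apply: eq_bigr => k _; rewrite kapD rmorphD mulrDr.
- apply: eq_bigr => a _; rewrite /= -big_split; apply: eq_bigr => b _; rewrite /= -big_split.
  apply: eq_bigr => c _; rewrite /= -big_split; apply: eq_bigr => d _.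
  by rewrite gamD mxE rmorphD mulrDr.
- by apply: eq_bigr => j _; rewrite /= -big_split; apply: eq_bigr => k _; rewrite vecD rmorphD mulrDr.
Qed.

Lemma QinnerZl c u v : Qinner g h (c *: u) v = c * Qinner g h u v.
Proof.
rewrite /Qinner mulrCA; congr (_ * _); rewrite mulr_sumr; apply: eq_bigr => K _.
rewrite mulr_sumr; apply: eq_bigr => L _; rewrite mulrCA; congr (_ * _).
rewrite !mulrDr !mulr_sumr; congr (_ + _ + _).
- apply: eq_bigr => j _; rewrite mulr_sumr; apply: eq_bigr => k _; rewrite kapZ; ring.
- apply: eq_bigr => a _; rewrite mulr_sumr; apply: eq_bigr => b _; rewrite mulr_sumr.
  apply: eq_bigr => d _; rewrite mulr_sumr; apply: eq_bigr => e _; rewrite gamZ mxE; ring.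
- apply: eq_bigr => j _; rewrite mulr_sumr; apply: eq_bigr => k _; rewrite vecZ; ring.
Qed.

Lemma QinnerZr c u v : Qinner g h u (c *: v) = c^*%R * Qinner g h u v.
Proof.
rewrite /Qinner mulrCA; congr (_ * _); rewrite mulr_sumr; apply: eq_bigr => K _.
rewrite mulr_sumr; apply: eq_bigr => L _; rewrite mulrCA; congr (_ * _).
rewrite !mulrDr !mulr_sumr; congr (_ + _ + _).
- apply: eq_bigr => j _; rewrite mulr_sumr; apply: eq_bigr => k _; rewrite kapZ rmorphM /=; ring.
- apply: eq_bigr => a _; rewrite mulr_sumr; apply: eq_bigr => b _; rewrite mulr_sumr.
  apply: eq_bigr => d _; rewrite mulr_sumr; apply: eq_bigr => e _; rewrite gamZ mxE rmorphM /=; ring.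
- apply: eq_bigr => j _; rewrite mulr_sumr; apply: eq_bigr => k _; rewrite vecZ rmorphM /=; ring.
Qed.

Lemma Qinner0l v : Qinner g h 0 v = 0.
Proof. by rewrite -(scale0r (0 : Qfib R r p)) QinnerZl mul0r. Qed.

End QinnerLinear.

Lemma continuous_near_eq (R : realType) (T : topologicalType) (f g : T -> R) (W : set T) p :
  open W -> W p -> (forall q, W q -> f q = g q) ->
  {for p, continuous f} -> {for p, continuous g}.
Proof.
move=> oW Wp E cf; rewrite /prop_for /continuous_at -(E p Wp).
apply: cvg_trans cf; apply: near_eq_cvg.
by apply: filterS (open_nbhs_nbhs (conj oW Wp)) => q /E.
Qed.

Section Indicator.
Variable R : realType.
Local Notation V := (model R).

(** Near a point outside U the function vanishes, because B is closed. *)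
Lemma continuous_indic (U B : set V) (F : V -> R) : open U -> compact B -> B `<=` U ->
  smooth_on U F -> (forall q, U q -> ~ B q -> F q = 0) ->
  forall p : V, {for p, continuous (fun q => \1_U q * F q)}.
Proof.
move=> oU cB BU sF F0 p.
have [Up|nUp] := pselect (U p).
  have cF : {for p, continuous F} by move/smooth_onP: sF => /(_ 0%N) H; exact: Ck_cont H Up.
  apply: (continuous_near_eq oU Up _ cF) => q Uq; by rewrite indicE mem_set// mul1r.
have oB : open (~` B) by apply: closed_openC; apply: compact_closed cB; exact: norm_hausdorff.
have nBp : (~` B) p by move=> /BU.
apply: (continuous_near_eq oB nBp _ (@cvg_cst _ (0 : R) _ (nbhs p) _)) => q nB.
rewrite indicE; have [Uq|nUq] := pselect (U q); last by rewrite memNset// mul0r.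
by rewrite (F0 q Uq nB) mulr0.
Qed.

Lemma bsupp_indic (U : set V) (F : V -> R) x rho : 
  (forall q, U q -> ~ box x rho q -> F q = 0) ->
  bsupp (fun q => \1_U q * F q) (`|x| + rho).
Proof.
move=> F0 q H i; apply: box_bounded; apply: contrapT => nb; move: H; rewrite indicE.
have [Uq|nUq] := pselect (U q); last by rewrite memNset// mul0r eqxx.
by rewrite (F0 q Uq nb) mulr0 eqxx.
Qed.

End Indicator.

(** * The commutator of the adjoint with a function *)
#[local] Opaque iterated_integral.

Lemma cancel_crossed (R : realType) (a b c d : R) :
  a = d -> b = c -> (a + -1 * b) + (c + -1 * d) = 0.
Proof. by move=> -> ->; rewrite !mulN1r addrA subrK subrr. Qed.

Lemma cancel_comm (R : comPzRingType) (c A B S Du : R) :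
  (A - c * B) + (c * Du + S - c * Du) = A + - c * B + S.
Proof. ring. Qed.

Lemma Re_combination (R : realType) (d a b c e : R[i]) :
  (complex.Re (d * a) + -1 * complex.Re (d * b)) +
  (complex.Re (d * c) + -1 * complex.Re (d * e)) = complex.Re (d * ((a - b) + (c - e))).
Proof. case: d a b c e => d d' [a a'] [b b'] [c c'] [e e'] /=; ring. Qed.

(** In degree 0 the symmetry conditions concern the trivial permutation only. *)
Lemma in_fibre_degree0 (R : realType) r (e : Qfib R r 0) :
  (forall K, \tr (gam e K) = 0) -> in_fibre e.
Proof.
have t1 (t : 'S_0) : odd_perm t = false by rewrite (_ : t = 1%g) ?odd_perm1//; apply/permP => -[].
have Kt (K : {ffun 'I_0 -> 'I_3}) (t : 'S_0) : [ffun a => K (t a)] = K.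
  by apply/ffunP => -[].
by split=> // *; rewrite t1 expr0 Kt ?mul1r ?scale1r.
Qed.

Section Commutator.
Variables (R : realType) (X : topologicalType) (r : nat) (D : het_data R X r).
Local Notation C := R[i].
Local Notation V := (model R).
Local Notation I := (chart_idx D).
Hypotheses (hg : metric_axiom D) (hb : bundle_axiom D) (hh : bundle_metric_axiom D).

Lemma gmet_posdef (i : I) q : cimg i q -> hermitian_posdef (gmet i q).
Proof. by have [_ [H _]] := hg; exact: H. Qed.

Lemma hmet_posdef (i : I) q : cimg i q -> hermitian_posdef (hmet i q).
Proof. by have [_ H _ _] := hh; exact: H. Qed.

Lemma gmet_smooth (i : I) : mx_smooth (cimg i) (gmet i).
Proof. by have [H _] := hg; exact: H. Qed.

Lemma hmet_smooth (i : I) : mx_smooth (cimg i) (hmet i).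
Proof. by have [H _ _ _] := hh; exact: H. Qed.

Lemma gmet_unit (i : I) q : cimg i q -> gmet i q \in unitmx.
Proof. by move=> /gmet_posdef/posdef_unit. Qed.

Lemma hmet_unit (i : I) q : cimg i q -> hmet i q \in unitmx.
Proof. by move=> /hmet_posdef/posdef_unit. Qed.

(** Conjugation exchanges the two types of derivatives. *)
Lemma riem_conjE (i : I) q j l m n : cimg i q ->
  riem_conj (gmet i) j l m n q = - (riem (gmet i) l j m n q)^*%R.
Proof.
move=> qi; rewrite /riem_conj /riem /curvature mxE opprK; congr (- _).
rewrite dhol_conj//.
apply: (csmooth_derivable _ qi).
exact: (chern_smooth (@open_cimg _ _ D i) j (gmet_smooth i) (@gmet_unit i)).
Qed.

Definition integrand p (i : I) (u v : V -> Qfib R r p) (q : V) : R :=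
  \1_(cimg i) q *
  complex.Re (8%:R * \det (gmet i q) * Qinner (gmet i q) (hmet i q) (u q) (v q)).

Lemma integrand_in p (i : I) (u v : V -> Qfib R r p) q : cimg i q -> integrand i u v q =
  complex.Re (8%:R * \det (gmet i q) * Qinner (gmet i q) (hmet i q) (u q) (v q)).
Proof. by move=> qi; rewrite /integrand indicE (mem_set qi) mul1r. Qed.

Lemma integrand_out p (i : I) (u v : V -> Qfib R r p) q : ~ cimg i q -> integrand i u v q = 0.
Proof. by move=> nq; rewrite /integrand indicE (memNset nq) mul0r. Qed.

Lemma integrand_good p (i : I) (u v : V -> Qfib R r p) x rho : box x rho `<=` cimg i ->
  smooth_field (cimg i) u -> smooth_field (cimg i) v ->
  (forall q, cimg i q -> ~ box x rho q -> u q = 0) ->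
  (forall q : V, {for q, continuous (integrand i u v)}) /\
  bsupp (integrand i u v) (`|x| + rho).
Proof.
move=> Bi su sv u0.
have oU := @open_cimg _ _ D i.
have F0 q : cimg i q -> ~ box x rho q ->
    complex.Re (8%:R * \det (gmet i q) * Qinner (gmet i q) (hmet i q) (u q) (v q)) = 0.
  by move=> qi nq; rewrite (u0 q qi nq) Qinner0l mulr0.
have sF : smooth_on (cimg i) (fun q => complex.Re (8%:R * \det (gmet i q) *
    Qinner (gmet i q) (hmet i q) (u q) (v q))).
  suff /csmooth_onP[S _] : csmooth_on (cimg i) (fun q => 8%:R * \det (gmet i q) *
    Qinner (gmet i q) (hmet i q) (u q) (v q)) by [].
  apply: (csmoothM oU).
    by apply: (csmoothM oU); [exact: csmooth_cst|exact: (csmooth_det oU (gmet_smooth i))].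
  exact: (Qinner_smooth oU (gmet_smooth i) (hmet_smooth i) (@gmet_unit i) (@hmet_unit i) su sv).
split; first exact: (continuous_indic oU (@box_compact _ x rho) Bi sF F0).
exact: (bsupp_indic F0).
Qed.

(** A continuous nonnegative function whose integral vanishes is 0; the integral of
    the combination vanishes because its terms cancel in pairs. *)
Lemma iterated_sum4 (f1 f2 f3 f4 : V -> R) M :
  (forall q : V, {for q, continuous f1}) -> (forall q : V, {for q, continuous f2}) ->
  (forall q : V, {for q, continuous f3}) -> (forall q : V, {for q, continuous f4}) ->
  bsupp f1 M -> bsupp f2 M -> bsupp f3 M -> bsupp f4 M ->
  iterated_integral f1 = iterated_integral f4 -> iterated_integral f2 = iterated_integral f3 ->
  (forall q, 0 <= (f1 q + -1 * f2 q) + (f3 q + -1 * f4 q)) ->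
  forall q, (f1 q + -1 * f2 q) + (f3 q + -1 * f4 q) = 0.
Proof.
have T := integral_theoryP R (3 + 3).
have sD (f g : V -> R) : bsupp f M -> bsupp g M -> bsupp (fun q => f q + g q) M.
  move=> H1 H2 q; have [E|fq _] := eqVneq (f q) 0; last exact: H1.
  by rewrite E add0r; exact: H2.
have sZ (f : V -> R) : bsupp f M -> bsupp (fun q => -1 * f q) M.
  by move=> H1 q; rewrite mulN1r oppr_eq0; exact: H1.
move=> c1 c2 c3 c4 b1 b2 b3 b4 E14 E23 ge0 q.
have cZ2 q' : {for q', continuous (fun q => -1 * f2 q)} by apply: continuous_forZ; exact: c2.
have cZ4 q' : {for q', continuous (fun q => -1 * f4 q)} by apply: continuous_forZ; exact: c4.
have cD12 q' : {for q', continuous (fun q => f1 q + -1 * f2 q)}.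
  by apply: continuous_forD; [exact: c1|exact: cZ2].
have cD34 q' : {for q', continuous (fun q => f3 q + -1 * f4 q)}.
  by apply: continuous_forD; [exact: c3|exact: cZ4].
have cD q' : {for q', continuous (fun q => (f1 q + -1 * f2 q) + (f3 q + -1 * f4 q))}.
  by apply: continuous_forD; [exact: cD12|exact: cD34].
have s12 := sD _ _ b1 (sZ _ b2); have s34 := sD _ _ b3 (sZ _ b4).
have I0 : iterated_integral (fun q => (f1 q + -1 * f2 q) + (f3 q + -1 * f4 q)) = 0.
  rewrite (it_D T cD12 cD34 s12 s34).
  rewrite (it_D T c1 cZ2 b1 (sZ _ b2)) (it_D T c3 cZ4 b3 (sZ _ b4)).
  rewrite (it_Z T (-1) c2 b2) (it_Z T (-1) c4 b4).
  exact: cancel_crossed E14 E23.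
apply/eqP; rewrite eq_le ge0 andbT leNgt; apply/negP => gt0.
have := it_P T cD (sD _ _ s12 s34) ge0 gt0.
by rewrite I0 ltxx.
Qed.

Variable Dstar : field D (Qfib R r 1) -> field D (Qfib R r 0).
Hypothesis hadj : formal_adjoint (@Dbar R X r D 0) Dstar.

Section AtPoint.
Variables (f : X -> R) (s : field D (Qfib R r 1)) (i : I).
Hypotheses (sf : smooth_fun D f) (ss : is_section s).

Let fs : field D (Qfib R r 1) := fun k q => (f (chart_inv k q))%:C *: s k q.
Let c (q : V) : C := (f (chart_inv i q))%:C.
Let th q j := dhol j c q.
Let thb q j := dbar j c q.
Let rm q k j l m := riem (gmet i) k j l m q.
Let rc q k j l m := riem_conj (gmet i) k j l m q.
Let adj q := symbol_Dbar_adj (gmet i q) (alphap D)%:C (th q) (thb q) (rc q) (s i q).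

(* the defect in the expected formula for the commutator of Dstar with f *)
Let w q := Dstar fs i q + (- c q) *: Dstar s i q + adj q.

Let smooth_c : csmooth_on (cimg i) c.
Proof. by apply: csmooth_real; exact: sf. Qed.

Let section_fs : is_section fs.
Proof. exact: is_section_scale. Qed.

Let smooth_w : smooth_field (cimg i) w.
Proof.
have oU := @open_cimg _ _ D i.
have [/(is_sectionP hb)[S1 _ _] _] := hadj section_fs.
have [/(is_sectionP hb)[S2 _ _] _] := hadj ss.
have [S3 _ _] := (is_sectionP hb s).1 ss.
apply: (smooth_fieldD oU); first apply: (smooth_fieldD oU).
- exact: (S1 i).
- by apply: (smooth_fieldZ oU); [exact: (csmoothN oU smooth_c)|exact: (S2 i)].
- have sth j : csmooth_on (cimg i) (fun q => th q j) by exact: (csmooth_dhol _ oU smooth_c).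
  have sthb j : csmooth_on (cimg i) (fun q => thb q j) by exact: (csmooth_dbar _ oU smooth_c).
  exact: (symbol_Dbar_adj_smooth (alphap D) oU (gmet_smooth i) (@gmet_unit i) sth sthb (S3 i)).
Qed.

Let dens (e : Qfib R r 0) q : R :=
  complex.Re (8%:R * \det (gmet i q) * Qinner (gmet i q) (hmet i q) e (w q)).

Let al_conj : ((alphap D)%:C)^*%R = (alphap D)%:C :> C.
Proof. exact: conjC_realE. Qed.

(* The four integrands of the two instances of adjointness add up to < u, w >: the
   first-order terms in u cancel, and the symbol that remains is moved to s. *)
Let pointwise (u : V -> Qfib R r 0) q : smooth_field (cimg i) u -> cimg i q ->
  (Qinner (gmet i q) (hmet i q) (u q) (Dstar fs i q) -
   Qinner (gmet i q) (hmet i q) (c q *: u q) (Dstar s i q)) +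
  (Qinner (gmet i q) (hmet i q) (Dbar_loc (alphap D) (gmet i) (hmet i) (fun q => c q *: u q) q) (s i q) -
   Qinner (gmet i q) (hmet i q) (Dbar_loc (alphap D) (gmet i) (hmet i) u q) (fs i q)) =
  Qinner (gmet i q) (hmet i q) (u q) (w q).
Proof.
move=> su qi.
have -> : Qinner (gmet i q) (hmet i q) (u q) (w q) =
    Qinner (gmet i q) (hmet i q) (u q) (Dstar fs i q) +
    - c q * Qinner (gmet i q) (hmet i q) (u q) (Dstar s i q) +
    Qinner (gmet i q) (hmet i q) (u q) (adj q).
  by rewrite /w !QinnerDr QinnerZr rmorphN /= conjC_realE.
have -> y : Qinner (gmet i q) (hmet i q) y (fs i q) = c q * Qinner (gmet i q) (hmet i q) y (s i q).
  by rewrite /fs QinnerZr conjC_realE.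
have <- : Qinner (gmet i q) (hmet i q)
    (symbol_Dbar (alphap D)%:C (th q) (thb q) (rm q) (u q)) (s i q) =
    Qinner (gmet i q) (hmet i q) (u q) (adj q).
  apply: (symbol_Dbar_adjoint (hmet i q) (th q) (thb q) (gmet_posdef qi) al_conj).
  by move=> j l m n; exact: riem_conjE.
rewrite (Dbar_loc_leibniz (alphap D) (gmet i) (hmet i) smooth_c su qi).
rewrite QinnerDl !QinnerZl; exact: cancel_comm.
Qed.

Let fibre_w x : cimg i x -> in_fibre (w x).
Proof.
move=> xi; apply: in_fibre_degree0 => K.
have [/(is_sectionP hb)[_ F1 _] _] := hadj section_fs.
have [/(is_sectionP hb)[_ F2 _] _] := hadj ss.
have [_ F3 _] := (is_sectionP hb s).1 ss.
have [T1 _ _ _] := F1 i x xi; have [T2 _ _ _] := F2 i x xi; have [T3 _ _ _] := F3 i x xi.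
rewrite /w !gamD gamZ !mxtraceD mxtraceZ T1 T2 mulr0 !add0r.
rewrite /adj /gam /symbol_Dbar_adj /= ffunE raddf_sum big1// => q _.
by rewrite /= raddf_sum big1// => k _; rewrite /= mxtraceZ T3 mulr0.
Qed.

(** A nonzero defect is detected by a test section concentrated near x. *)
Lemma Dstar_defect x : cimg i x -> w x = 0.
Proof.
move=> xi; have oU := @open_cimg _ _ D i.
apply/eqP/negPn/negP => wx.
pose d : C := 8%:R * \det (gmet i x).
have d0 : d != 0.
  by rewrite /d mulf_neq0 ?pnatr_eq0//; have := gmet_unit xi; rewrite unitmxE unitfE.
(* The factor turns the density 8 det g, taken at x, into a positive number. *)
pose e0 := d^*%R *: w x.
have fe0 : in_fibre e0 by apply/in_fibreZ/fibre_w.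
have N0 : 0 < Qinner (gmet i x) (hmet i x) (w x) (w x).
  rewrite Qinner0E.
  have [P0 P1] := fibre_form_pos (gmet_posdef xi) (hmet_posdef xi)
    (fun j => kap (w x) j (idx0)) (gam (w x) idx0) (fun j => vec (w x) j idx0).
  rewrite lt_def P0 andbT; apply: contra wx => /eqP/P1[k0 g0 v0]; apply/eqP.
  apply: QfibP => [j K|K|j K]; rewrite (midx0E K).
  - by rewrite k0 /kap ffunE.
  - by rewrite g0 /gam ffunE.
  - by rewrite v0 /vec ffunE.
have dx0 : 0 < dens e0 x.
  have : 0 < 8%:R * \det (gmet i x) * Qinner (gmet i x) (hmet i x) e0 (w x).
    by rewrite /e0 QinnerZl mulrA mulr_gt0// -normCK exprn_gt0// normr_gt0.
  by rewrite ltcE => /andP[].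
have sdens : smooth_on (cimg i) (dens e0).
  suff /csmooth_onP[S _] : csmooth_on (cimg i) (fun q => 8%:R * \det (gmet i q) *
    Qinner (gmet i q) (hmet i q) e0 (w q)) by [].
  apply: (csmoothM oU).
    by apply: (csmoothM oU); [exact: csmooth_cst|exact: (csmooth_det oU (gmet_smooth i))].
  apply: (Qinner_smooth oU (gmet_smooth i) (hmet_smooth i) (@gmet_unit i) (@hmet_unit i) _ smooth_w).
  by split=> *; exact: csmooth_cst.
have [rho [rho0 Hrho]] : exists rho : R, 0 < rho /\
    box x rho `<=` cimg i `&` [set q | 0 < dens e0 q].
  have cx : {for x, continuous (dens e0)}.
    by move/smooth_onP: sdens => /(_ 0%N) H; exact: Ck_cont H xi.
  have /cvgr_gt/(_ _ dx0) := cx.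
  rewrite nbhsE => -[W [oW Wx] WH].
  have oUW : open (cimg i `&` W) by exact: openI.
  have [rho [rho0 Hrho]] := box_sub oUW (conj xi Wx).
  by exists rho; split=> // q /Hrho[qi /WH]; split.
have Bi : box x rho `<=` cimg i by move=> q /Hrho[].
have chiB q : cimg i q -> bump_fun x rho q != 0 -> box x rho q.
  by move=> _; exact: bump_supp.
have schi : smooth_on (cimg i) (bump_fun x rho) by exact: smooth_bump.
pose u := cutoff_section i (bump_fun x rho) e0.
have su : is_section u by apply: (is_section_cutoff hb (@box_compact _ x rho) Bi schi chiB fe0).
have pu : supported_in i u by rewrite /u; apply: supported_cutoff; [exact: (@box_compact _ x rho)|exact: Bi|exact: chiB].
have uE q : cimg i q -> u i q = (bump_fun x rho q)%:C *: e0.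
  by move=> qi; apply: (cutoff_section_chart hb).
pose fu : field D (Qfib R r 0) := fun k q => (f (chart_inv k q))%:C *: u k q.
have sfu : is_section fu by exact: is_section_scale.
have pfu : supported_in i fu by exact: supported_scale.
have [_ /(_ i u su pu) A1] := hadj section_fs.
have [_ /(_ i fu sfu pfu) A2] := hadj ss.
have u0 q : cimg i q -> ~ box x rho q -> u i q = 0.
  move=> qi nb; rewrite (uE q qi).
  have [->|bq] := eqVneq (bump_fun x rho q) 0; first by rewrite scale0r.
  by case: (nb (chiB q qi bq)).
have fu0 q : cimg i q -> ~ box x rho q -> fu i q = 0.
  by move=> qi nb; rewrite /fu (u0 q qi nb) scaler0.
have near0 (v : V -> Qfib R r 0) : (forall q, cimg i q -> ~ box x rho q -> v q = 0) ->
    forall q, cimg i q -> ~ box x rho q -> Dbar_loc (alphap D) (gmet i) (hmet i) v q = 0.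
  move=> v0 q qi nb; apply: Dbar_loc_near0.
  have oB : open (~` box x rho).
    by apply: closed_openC; apply: compact_closed (@box_compact _ x rho); exact: norm_hausdorff.
  have oUB : open (cimg i `&` ~` box x rho) by exact: openI.
  by apply: filterS (open_nbhs_nbhs (conj oUB (conj qi nb))) => y [yi yb]; exact: v0.
have [S1 _ _] := (is_sectionP hb u).1 su.
have [S2 _ _] := (is_sectionP hb fu).1 sfu.
have [/(is_sectionP hb)[S3 _ _] _] := hadj section_fs.
have [/(is_sectionP hb)[S4 _ _] _] := hadj ss.
have [S5 _ _] := (is_sectionP hb s).1 ss.
have [S6 _ _] := (is_sectionP hb fs).1 section_fs.
have DS v : smooth_field (cimg i) v -> smooth_field (cimg i) (Dbar_loc (p:=0) (alphap D) (gmet i) (hmet i) v).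
  exact: (Dbar_loc_smooth _ oU (gmet_smooth i) (hmet_smooth i) (@gmet_unit i) (@hmet_unit i)).
have [c1 b1] := integrand_good Bi (S1 i) (S3 i) u0.
have [c2 b2] := integrand_good Bi (S2 i) (S4 i) fu0.
have [c3 b3] := integrand_good Bi (DS _ (S2 i)) (S5 i) (near0 _ fu0).
have [c4 b4] := integrand_good Bi (DS _ (S1 i)) (S6 i) (near0 _ u0).
(* With u = bump e0, what is integrated is the bump times the density of < e0, w >,
   and the latter is positive on the box. *)
have tot q : (integrand i (u i) (Dstar fs i) q + -1 * integrand i (fu i) (Dstar s i) q) +
    (integrand i (Dbar fu i) (s i) q + -1 * integrand i (Dbar u i) (fs i) q) =
    if `[< cimg i q >] then bump_fun x rho q * dens e0 q else 0.
  case: asboolP => qi; last by do 4!rewrite (integrand_out _ _ qi); rewrite mulr0 !addr0.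
  do 4!rewrite (integrand_in _ _ qi); rewrite Re_combination.
  have := pointwise (S1 i) qi; rewrite -/(fu i q) => ->.
  rewrite (uE q qi) QinnerZl mulrCA /dens; set z := 8%:R * _ * _.
  by case: z => a b; rewrite /= mul0r subr0.
have ge0 q : 0 <= (integrand i (u i) (Dstar fs i) q + -1 * integrand i (fu i) (Dstar s i) q) +
    (integrand i (Dbar fu i) (s i) q + -1 * integrand i (Dbar u i) (fs i) q).
  rewrite tot; case: asboolP => qi; last exact: lexx.
  have [->|/(chiB q qi)/Hrho[_ /= dq]] := eqVneq (bump_fun x rho q) 0; first by rewrite mul0r.
  exact: mulr_ge0 (bump_ge0 x rho q) (ltW dq).
have := iterated_sum4 c1 c2 c3 c4 b1 b2 b3 b4
  (esym (congr1 (@complex.Re R) A1)) (esym (congr1 (@complex.Re R) A2)) ge0 x.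
by rewrite tot (asboolT xi) (bump1 x rho0) mul1r => /eqP; rewrite (gt_eqF dx0).
Qed.

End AtPoint.

End Commutator.

(** * The symbol formula and ellipticity *)
#[local] Opaque iterated_integral.

Section SymbolScale.
Variables (R : realType) (r : nat).
Local Notation C := R[i].
Variables (al c : C) (th thb : 'I_3 -> C) (Rm rc : 'I_3 -> 'I_3 -> 'I_3 -> 'I_3 -> C).

Lemma symbol_DbarZ p (e : Qfib R r p) :
  c *: symbol_Dbar al th thb Rm e = symbol_Dbar al (fun j => c * th j) (fun j => c * thb j) Rm e.
Proof.
apply: QfibP => [j K|K|j K]; rewrite ?kapZ ?gamZ ?vecZ /kap /gam /vec /= !ffunE.
- rewrite -[c * _]wedge1Z; apply: wedge1_eq => k M; rewrite [c *: _]mulrDr mulrA; congr (_ + _).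
  rewrite mulrCA; congr (_ * _); rewrite mulr_sumr; apply: eq_bigr => m _.
  by rewrite mulr_sumr; apply: eq_bigr => n _; ring.
- by rewrite -wedge1Z; apply: wedge1_eq => k M; rewrite scalerA.
- by rewrite -[c * _]wedge1Z; apply: wedge1_eq => k M; rewrite [c *: _]mulrA.
Qed.

Lemma symbol_Dbar_adjZ (g : 'M[C]_3) (e : Qfib R r 1) :
  c^*%R *: symbol_Dbar_adj g al th thb rc e =
  symbol_Dbar_adj g al (fun j => c * th j) (fun j => c * thb j) rc e.
Proof.
apply: QfibP => [j K|K|j K]; rewrite ?kapZ ?gamZ ?vecZ /kap /gam /vec /= !ffunE.
- rewrite mulr_sumr; apply: eq_bigr => q _; rewrite mulr_sumr; apply: eq_bigr => k _.
  by rewrite rmorphM /=; ring.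
- rewrite scaler_sumr; apply: eq_bigr => q _; rewrite scaler_sumr; apply: eq_bigr => k _.
  by rewrite scalerA rmorphM /=; congr (_ *: _); ring.
- rewrite mulrDr; congr (_ + _); last first.
    rewrite mulr_sumr; apply: eq_bigr => q _; rewrite mulr_sumr; apply: eq_bigr => k _.
    by rewrite rmorphM /=; ring.
  rewrite mulrCA; congr (_ * _).
  rewrite mulr_sumr; apply: eq_bigr => n _; rewrite mulr_sumr; apply: eq_bigr => a _.
  rewrite mulr_sumr; apply: eq_bigr => b _; rewrite mulr_sumr; apply: eq_bigr => j' _.
  rewrite mulr_sumr; apply: eq_bigr => l _; rewrite mulr_sumr; apply: eq_bigr => m _.
  by rewrite rmorphM /=; ring.
Qed.

End SymbolScale.

Section LinearFunction.
Variable R : realType.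
Local Notation C := R[i].
Local Notation V := (model R).

(** The affine function of gradient k that vanishes at x. *)
Definition linear_at (k : 'I_(3 + 3) -> R) (x q : V) : R :=
  \sum_a k a * (q ord0 a - x ord0 a).

Lemma linear_at0 k x : linear_at k x x = 0.
Proof. by rewrite /linear_at big1// => a _; rewrite subrr mulr0. Qed.

Lemma linear_at_smooth k x (U : set V) : open U -> smooth_on U (linear_at k x).
Proof.
move=> oU; apply: (smooth_sum _ oU) => a; apply: (smoothM oU); first exact: smooth_cst.
by apply: (smoothB oU); [exact: smooth_coord|exact: smooth_cst].
Qed.

Lemma derive_linear_at k (x v : V) : 'D_v (linear_at k x) x = \sum_a k a * v ord0 a.
Proof.
have E h : linear_at k x (h *: v + x) = h * \sum_a k a * v ord0 a.
  by rewrite /linear_at mulr_sumr; apply: eq_bigr => a _; rewrite !mxE addrK mulrCA.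
apply: cvg_lim => //.
apply: (@cvg_trans _ ((fun=> \sum_a k a * v ord0 a) h @[h --> 0^'])); last exact: cvg_cst.
apply: near_eq_cvg; near=> h; rewrite /= E linear_at0 subr0 [_ *: _]mulrA mulVf ?mul1r//.
near: h; exact: nbhs_dnbhs_neq.
Unshelve. all: by end_near. Qed.

(** Since the affine function vanishes at x, only its gradient survives. *)
Lemma dhol_bump_linear k (x : V) rho j : 0 < rho ->
  dhol j (fun q => (bump_fun x rho q * linear_at k x q)%:C) x =
  2%:R^-1 * (k (lshift 3 j) -i* k (rshift 3 j)).
Proof.
move=> rho0.
have dB v : derivable (bump_fun x rho) x v.
  have /smooth_onP/(_ 1%N) S := @smooth_bump R setT x rho openT.
  exact: (Ck_derivable S I).
have dL v : derivable (linear_at k x) x v.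
  have /smooth_onP/(_ 1%N) S := @linear_at_smooth k x setT openT.
  exact: (Ck_derivable S I).
have E v : cderive v (fun q => (bump_fun x rho q * linear_at k x q)%:C) x =
    (\sum_a k a * v ord0 a)%:C.
  rewrite /cderive /= derive_cst; congr (_ +i* _).
  have := deriveM (dB v) (dL v); rewrite linear_at0 scale0r addr0 (bump1 x rho0) scale1r.
  by rewrite derive_linear_at => <-.
rewrite dholE !E; congr (_ * _).
have Ek a : \sum_b k b * (delta_mx ord0 a : V) ord0 b = k a.
  rewrite (bigD1 a)//= mxE !eqxx mulr1 big1 ?addr0// => b ba.
  by rewrite mxE (negbTE ba) andbF mulr0.
rewrite !Ek num_iE; apply/eqP; rewrite eq_complex /=; apply/andP; split; apply/eqP; ring.
Qed.

End LinearFunction.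

Lemma pair_combination (C : pzRingType) (L1 L2 : lmodType C) (z c : C) (a a' : L1) (b b' : L2) :
  z *: ((a, b) - c *: (a', b')) = (z *: (a - c *: a'), z *: (b - c *: b')).
Proof. by []. Qed.

Lemma pair_components (A B : Type) (a a' : A) (b b' : B) : (a, b) = (a', b') -> a = a' /\ b = b'.
Proof. by case. Qed.

Section Main.
Variables (R : realType) (X : topologicalType) (r : nat) (D : het_data R X r).
Local Notation C := R[i].
Local Notation V := (model R).
Variable Dstar : field D (Qfib R r 1) -> field D (Qfib R r 0).
Hypotheses (hg : metric_axiom D) (hb : bundle_axiom D) (hh : bundle_metric_axiom D)
  (hadj : formal_adjoint (@Dbar R X r D 0) Dstar).

Local Notation al := ((alphap D)%:C : C).

Lemma symbol_formulaE (i : chart_idx D) x (xi : 'rV[C]_3) (e : Qfib R r 1) :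
  symbol_formula i x xi e =
  (symbol_Dbar al (fun j => 'i%R * xi ord0 j) (fun k => 'i%R * (xi ord0 k)^*%R)
     (fun k j m n => riem (gmet i) k j m n x) e,
   symbol_Dbar_adj (gmet i x) al (fun j => 'i%R * xi ord0 j) (fun k => 'i%R * (xi ord0 k)^*%R)
     (fun j l m n => riem_conj (gmet i) j l m n x) e).
Proof. by []. Qed.

Lemma symbol_formula0 (i : chart_idx D) x (xi : 'rV[C]_3) : symbol_formula i x xi 0 = 0.
Proof.
by rewrite symbol_formulaE -[X in symbol_Dbar _ _ _ _ X](subrr 0) symbol_DbarB subrr
  -[X in symbol_Dbar_adj _ _ _ _ _ X](subrr 0) symbol_Dbar_adjB subrr.
Qed.

(** The Leibniz rule gives the first component and [Dstar_defect] the second, in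
    which the factor i appears conjugated and absorbs the sign. *)
Lemma symbol_unique (i : chart_idx D) x (xi : 'rV[C]_3) (f : X -> R)
    (s : field D (Qfib R r 1)) : cimg i x -> smooth_fun D f -> is_section s ->
  (forall j, dhol j (fun q => (f (chart_inv i q))%:C) x = xi ord0 j) ->
  'i%R *: (Dbar_plus Dstar (fun k q => (f (chart_inv k q))%:C *: s k q) i x -
           (f (chart_inv i x))%:C *: Dbar_plus Dstar s i x) =
  symbol_formula i x xi (s i x).
Proof.
move=> xi0 sf ss dxi.
have sc : csmooth_on (cimg i) (fun q => (f (chart_inv i q))%:C) by apply: csmooth_real; exact: sf.
have dxib j : dbar j (fun q => (f (chart_inv i q))%:C) x = (xi ord0 j)^*%R.
  by rewrite dbar_real ?dxi//; exact: (csmooth_derivable sc xi0).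
have [S1 _ _] := (is_sectionP hb s).1 ss.
have E1 := Dbar_loc_leibniz (alphap D) (gmet i) (hmet i) sc (S1 i) xi0.
have E2 := Dstar_defect hg hb hh hadj sf ss xi0.
have Ea : (fun j => dhol j (fun q => (f (chart_inv i q))%:C) x) = (fun j => xi ord0 j).
  by apply/funext => j; exact: dxi.
have Eb : (fun j => dbar j (fun q => (f (chart_inv i q))%:C) x) = (fun j => (xi ord0 j)^*%R).
  by apply/funext => j; exact: dxib.
rewrite Ea Eb in E1 E2.
rewrite symbol_formulaE -symbol_DbarZ -symbol_Dbar_adjZ /Dbar_plus pair_combination.
apply: congr2.
  by rewrite /Dbar E1 addrAC subrr add0r.
rewrite Num.Theory.conjCi [RHS]scaleNr -[RHS]scalerN; congr (_ *: _).
by apply/eqP; rewrite -addr_eq0 -scaleNr; apply/eqP.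
Qed.

(** f is a cut-off times the affine function with gradient (2 Re xi, -2 Im xi), whose
    (1,0)-differential is xi; s is a cut-off of the constant section e. *)
Lemma symbol_attained (i : chart_idx D) x (xi : 'rV[C]_3) (e : Qfib R r 1) :
  cimg i x -> in_fibre e ->
  exists (f : X -> R) (s : field D (Qfib R r 1)),
    [/\ smooth_fun D f, is_section s,
        forall j, dhol j (fun q => (f (chart_inv i q))%:C) x = xi ord0 j & s i x = e].
Proof.
move=> xi0 fe; have oU := @open_cimg _ _ D i.
have [rho [rho0 Bi]] := box_sub oU xi0.
have cB := @box_compact R x rho.
have Sb := smooth_bump x rho oU.
pose k (a : 'I_(3 + 3)) : R := match fintype.split a with
  | inl j => 2%:R * complex.Re (xi ord0 j) | inr j => - (2%:R * complex.Im (xi ord0 j)) end.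
pose F q := bump_fun x rho q * linear_at k x q.
have SF : smooth_on (cimg i) F.
  by apply: (smoothM oU Sb); exact: linear_at_smooth.
have FB q : cimg i q -> F q != 0 -> box x rho q.
  by move=> _; rewrite mulf_eq0 negb_or => /andP[/(bump_supp rho0)].
exists (extend0 i F), (cutoff_section i (bump_fun x rho) e); split.
- exact: smooth_extend0 cB Bi SF FB.
- by apply: (is_section_cutoff hb cB Bi Sb _ fe) => q _; exact: bump_supp.
- move=> j.
  transitivity (dhol j (fun q => (F q)%:C) x).
    apply: dhol_near; apply: filterS (open_nbhs_nbhs (conj oU xi0)) => q qi.
    by rewrite /extend0 (asboolT (cimg_inv qi)) (chart_invK qi).
  rewrite (dhol_bump_linear k x j rho0).
  apply: (canLR (mulKf _)); first by rewrite pnatr_eq0.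
  rewrite /k; case: splitP => [j' /= /val_inj <-|j' /= E]; last first.
    by have := ltn_ord j; rewrite E ltnNge leq_addr.
  case: splitP => [j'' /= E|j'' /= /addnI/val_inj <-].
    by have := ltn_ord j''; rewrite -E ltnNge leq_addr.
  case: (xi ord0 j) => a b /=.
  by apply/eqP; rewrite eq_complex /=; apply/andP; split; apply/eqP; ring.
- by rewrite (cutoff_section_chart hb _ _ xi0) (bump1 x rho0) scale1r.
Qed.

Lemma principal_symbolE (i : chart_idx D) x (xi : 'rV[C]_3) (e : Qfib R r 1) :
  cimg i x -> in_fibre e ->
  principal_symbol (Dbar_plus Dstar) i x xi e = symbol_formula i x xi e.
Proof.
move=> xi0 fe; rewrite /principal_symbol; set S := [set v | _].
have [f [s [sf ss df se]]] := symbol_attained xi xi0 fe.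
have : S (xget 0 S).
  apply: xgetPex; exists ('i%R *: (Dbar_plus Dstar (fun k q => (f (chart_inv k q))%:C *: s k q) i x -
           (f (chart_inv i x))%:C *: Dbar_plus Dstar s i x)).
  by exists f, s.
move=> [f' [s' [sf' ss' df' se' ->]]].
by rewrite (symbol_unique xi0 sf' ss' df') se'.
Qed.

Lemma symbol_formula_inj (i : chart_idx D) x (xi : 'rV[C]_3) (e e' : Qfib R r 1) :
  cimg i x -> xi != 0 -> symbol_formula i x xi e = symbol_formula i x xi e' -> e = e'.
Proof.
move=> xi0 xin0; rewrite !symbol_formulaE => E.
have [Es Ea] := pair_components E.
have [k xk] : exists k, xi ord0 k != 0.
  apply/existsP; apply: contraNT xin0; rewrite negb_exists => /forallP H.
  by apply/eqP/rowP => k; rewrite mxE; apply/eqP; have := H k; rewrite negbK.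
suff E0 : e - e' = 0 by rewrite -[e](subrK e') E0 add0r.
apply: (symbol_Dbar_kernel (gmet_posdef hg xi0) (hmet_posdef hh xi0) (al := al)
  (th := fun j => 'i%R * xi ord0 j) (thb := fun k => 'i%R * (xi ord0 k)^*%R)
  (Rm := fun k j m n => riem (gmet i) k j m n x)
  (rc := fun j l m n => riem_conj (gmet i) j l m n x)).
- exact: conjC_realE.
- by move=> j l m n; exact: riem_conjE.
- by exists k; rewrite mulf_neq0 ?conjC_eq0// neq0Ci.
- by rewrite symbol_DbarB Es subrr.
- by rewrite symbol_Dbar_adjB Ea subrr.
Qed.

End Main.

Theorem proposition2p14 (R : realType) :
  exists eps : R, 0 < eps /\
  forall (X : topologicalType) (r : nat) (D : het_data R X r)
    (Dstar : field D (Qfib R r 1) -> field D (Qfib R r 0)),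
  heterotic_solution D ->
  formal_adjoint (@Dbar R X r D 0) Dstar ->
  (forall (i : chart_idx D) (x : model R) (xi : 'rV[R[i]]_3) (e : Qfib R r 1),
     cimg i x -> in_fibre e ->
     principal_symbol (Dbar_plus Dstar) i x xi e = symbol_formula i x xi e) /\
  (forall R0 : R, 0 < R0 -> curvature_bounded D R0 ->
     `|alphap D| / R0 < eps ->
     symbol_ker0 (Dbar_plus Dstar) /\
     overdetermined_elliptic (Dbar_plus Dstar)).
Proof.
exists 1; split=> [|X r D Dstar [_ [hg [_ [hb [hh _]]]]] hadj]; first exact: ltr01.
have inj i x xi : cimg i x -> xi != 0 -> forall e e', in_fibre e -> in_fibre e' ->
    principal_symbol (Dbar_plus Dstar) i x xi e =
    principal_symbol (Dbar_plus Dstar) i x xi e' -> e = e'.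
  move=> xi0 xin0 e e' fe fe'.
  rewrite (principal_symbolE hg hb hh hadj xi xi0 fe) (principal_symbolE hg hb hh hadj xi xi0 fe').
  exact: (symbol_formula_inj hg hh xi0 xin0).
split=> [i x xi e xi0 fe|R0 _ _ _]; first exact: (principal_symbolE hg hb hh hadj).
split=> [i x xi xi0 xin0 e fe|]; last exact: inj.
rewrite (principal_symbolE hg hb hh hadj xi xi0 fe) => E.
by apply: (symbol_formula_inj hg hh xi0 xin0); rewrite E symbol_formula0.
Qed.
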